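(* If $M$ is a compact Riemannian manifold, then $\operatorname{reach}(x, M\subset W_p(M)) =0$ for every $p>1$ and every $x\in M$, where $M\subset W_p(M)$ via $x\mapsto\delta_x$.
   Context: Manifolds are connected, without boundary and of positive dimension, and carry the Riemannian distance. Wasserstein space: for a metric space $(X,\operatorname{dist})$ and $p\ge 1$, $\mathcal P_p(X)$ is the set of probability measures $\mu$ on $X$ with $\int_X \operatorname{dist}(x,x_0)^p\,d\mu(x)<\infty$ for some $x_0\in X$. $\Gamma(\mu,\nu)$ is the set of probability measures $\pi$ on $X\times X$ with marginals $\mu$ and $\nu$. $W_p(\mu,\nu)=\left(\inf_{\pi\in\Gamma(\mu,\nu)}\int_{X\times X}\operatorname{dist}(x,y)^p\,d\pi(x,y)\right)^{1/p}$, and $W_p(X)$ denotes the metric space $(\mathcal P_p(X),W_p)$. The map $x\mapsto\delta_x$ is an isometric embedding $X\hookrightarrow W_p(X)$, and $X$ is identified with its image. Reach: for a metric space $(Y,d)$ and a subset $A\subset Y$, let $\operatorname{Unp}(A)=\{y\in Y:\text{there exists a unique } a\in A \text{ with } d(y,A)=d(y,a)\}$. For $a\in A$, $\operatorname{reach}(a,A\subset Y)=\sup\{r\ge 0: B_r(a)\subset\operatorname{Unp}(A)\}$, where $B_r(a)$ is the open ball in $Y$. *)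

(* Defs.v *)
From HB Require Import structures.
From mathcomp Require Import all_boot all_order all_algebra.
From mathcomp Require Import all_classical all_reals all_analysis.
From mathcomp Require Import measurable_realfun.

Set Implicit Arguments.
Unset Strict Implicit.
Unset Printing Implicit Defensive.
Import Order.TTheory GRing.Theory Num.Theory.
Import numFieldNormedType.Exports.

Local Open Scope classical_set_scope.
Local Open Scope ring_scope.

(** * Smooth maps between normed spaces *)

(* Meant for an open [U] and a finite-dimensional [V]; only the values of [f]
   near points of [U] matter. *)
Fixpoint Ck (R : realType) (V W : normedModType R) (k : nat) (U : set V)
    (f : V -> W) : Prop :=
  match k with
  | 0 => forall x, U x -> {for x, continuous f}
  | k.+1 => (forall x, U x -> differentiable f x) /\
            (forall v : V, Ck k U (fun x => 'D_v f x))
  end.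

Definition smooth (R : realType) (V W : normedModType R) (U : set V)
  (f : V -> W) : Prop := forall k, Ck k U f.

(** * Smooth manifolds *)

(* A homeomorphism from an open subset of [M] onto an open subset of R^n; both
   [coord] and its inverse [param] are total, with arbitrary values outside
   [dom] and [chart_image] respectively. *)
Record chart (R : realType) (n : nat) (M : topologicalType) := Chart {
  dom : set M;
  coord : M -> 'rV[R]_n;
  param : 'rV[R]_n -> M;
  dom_open : open dom;
  image_open : open (coord @` dom);
  coord_continuous : forall x, dom x -> {for x, continuous coord};
  param_continuous : forall u, (coord @` dom) u -> {for u, continuous param};
  coordK : forall x, dom x -> param (coord x) = x
}.

Definition chart_image (R : realType) (n : nat) (M : topologicalType)
  (c : chart R n M) : set 'rV[R]_n := coord c @` dom c.

Definition transition (R : realType) (n : nat) (M : topologicalType)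
  (c c' : chart R n M) : 'rV[R]_n -> 'rV[R]_n := coord c' \o param c.

(* Nonemptiness is not a field: the carrier is pointed where this is used. *)
Record smooth_manifold (R : realType) (n : nat) (M : topologicalType) :=
  SmoothManifold {
  atlas_index : Type;
  atlas : atlas_index -> chart R n M;
  atlas_cover : forall x, exists i, dom (atlas i) x;
  atlas_smooth : forall i j,
    smooth (coord (atlas i) @` (dom (atlas i) `&` dom (atlas j)))
      (transition (atlas i) (atlas j));
  manifold_hausdorff : hausdorff_space M;
  manifold_second_countable : @second_countable M;
  manifold_connected : connected [set: M];
  manifold_dim_gt0 : (0 < n)%N
}.

Definition index_at (R : realType) (n : nat) (M : topologicalType)
    (S : smooth_manifold R n M) (x : M) : atlas_index S :=
  projT1 (cid (atlas_cover S x)).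

(** * Riemannian metrics and the Riemannian distance *)

Definition gram_form (R : realType) (n : nat) (G : 'M[R]_n)
  (v w : 'rV[R]_n) : R := (v *m G *m w^T) ord0 ord0.

(* The metric tensor is given by its Gram matrices in the charts of the atlas,
   subject to the transformation law of covariant 2-tensors. *)
Record riemannian_metric (R : realType) (n : nat) (M : topologicalType)
    (S : smooth_manifold R n M) := RiemannianMetric {
  gram : atlas_index S -> 'rV[R]_n -> 'M[R]_n;
  gram_smooth : forall i, smooth (chart_image (atlas i)) (gram i);
  gram_sym : forall i u, chart_image (atlas i) u -> (gram i u)^T = gram i u;
  gram_pos : forall i u v, chart_image (atlas i) u -> v != 0 ->
    0 < gram_form (gram i u) v v;
  gram_compat : forall i j x, dom (atlas i) x -> dom (atlas j) x ->
    forall v w,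
      let tau := transition (atlas i) (atlas j) in
      let u := coord (atlas i) x in
      gram_form (gram i u) v w =
      gram_form (gram j (coord (atlas j) x)) ('d tau u v) ('d tau u w)
}.

Section riemannian_distance.
Variables (R : realType) (n : nat) (M : topologicalType).
Variables (S : smooth_manifold R n M) (g : riemannian_metric S).

(* By [gram_compat] the value does not depend on the chart chosen around
   [gamma t], as long as [gamma] is differentiable at [t]. *)
Definition speed (gamma : R -> M) (t : R) : R :=
  let i := index_at S (gamma t) in
  let phi := coord (atlas i) in
  let v := derive1 (phi \o gamma) t in
  Num.sqrt (gram_form (gram g i (phi (gamma t))) v v).

Definition C1_curve (O : set R) (sigma : R -> M) : Prop :=
  forall t, O t -> {for t, continuous sigma} /\
    forall i : atlas_index S, dom (atlas i) (sigma t) ->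
      derivable (coord (atlas i) \o sigma) t 1 /\
      {for t, continuous (derive1 (coord (atlas i) \o sigma))}.

(* C^1 on the closed interval, i.e. extends to a C^1 curve on an open set
   containing it. *)
Definition C1_segment (gamma : R -> M) (a b : R) : Prop :=
  exists (O : set R) (sigma : R -> M),
    [/\ open O, `[a, b] `<=` O, C1_curve O sigma &
        forall t, t \in `[a, b] -> gamma t = sigma t].

Definition piecewise_C1 (gamma : R -> M) (a b : R) : Prop :=
  exists (k : nat) (t : nat -> R),
    [/\ t 0%N = a, t k = b &
        forall i, (i < k)%N ->
          t i < t i.+1 /\ C1_segment gamma (t i) (t i.+1)].

Definition curve_length (gamma : R -> M) : R :=
  \int[lebesgue_measure]_(t in `[0, 1]) speed gamma t.

Definition riemannian_dist (x y : M) : R :=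
  inf [set curve_length gamma | gamma in
        [set gamma : R -> M |
          [/\ piecewise_C1 gamma 0 1, gamma 0 = x & gamma 1 = y]]].

End riemannian_distance.

(** * Wasserstein spaces *)

Definition borel (M : ptopologicalType) := g_sigma_algebraType (@open M).

Section wasserstein.
Context {d : measure_display} {X : measurableType d} {R : realType}.
Variables (dist : X -> X -> R) (p : R).

Definition finite_moment (mu : probability X R) : Prop :=
  exists x0, (\int[mu]_x (dist x x0 `^ p)%:E < +oo)%E.

(* A [probability] also carries irrelevant values on nonmeasurable sets, so a
   measure may have several copies here, at distance 0 from one another. The
   Dirac measures [dirac x] give exactly one copy for each point, hence neither
   nearest points among them nor the reach of their set are affected. *)
Definition wasserstein_space : Type :=
  {mu : probability X R | finite_moment mu}.

Definition couplings (mu nu : probability X R) :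
    set (probability (X * X)%type R) :=
  [set pi : probability (X * X)%type R | forall A, measurable A ->
     pi (A `*` setT) = mu A /\ pi (setT `*` A) = nu A].

(* On [wasserstein_space] the infimum is finite, so that [fine] loses
   nothing. *)
Definition wasserstein_dist (mu nu : wasserstein_space) : R :=
  fine (ereal_inf [set (\int[pi]_z (dist z.1 z.2 `^ p)%:E)%E |
                    pi in couplings (sval mu) (sval nu)]) `^ p^-1.

Import HBNNSimple.

Lemma finite_moment_dirac (x : X) : finite_moment (dirac x : probability X R).
Proof.
exists x; rewrite ge0_integralE; last first.
  by move=> y _; rewrite lee_fin powR_ge0.
apply: (@le_lt_trans _ _ (dist x x `^ p)%:E); last exact: ltry.
apply: ge_ereal_sup => _ [h hle <-].
rewrite -integralT_nnsfun integral_dirac//; last first.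
  by apply/measurable_EFinP; exact: measurable_funPT.
by rewrite diracT mul1e; have := hle x; rewrite patchE in_setT.
Qed.

Definition wasserstein_dirac (x : X) : wasserstein_space :=
  exist _ _ (finite_moment_dirac x).

End wasserstein.

(** * Reach *)

Section reach.
Context {R : realType} {Y : Type}.
Variables (dist : Y -> Y -> R) (A : set Y).

Definition dist_to_set (y : Y) : R := inf [set dist y a | a in A].

Definition Unp : set Y :=
  [set y | exists! a, A a /\ dist_to_set y = dist y a].

Definition reach (a : Y) : \bar R :=
  ereal_sup [set r%:E | r in
    [set r : R | 0 <= r /\ [set y | dist a y < r] `<=` Unp]].

End reach.

(* Main.v *)
(* Suppose that some ball around [delta_x] consists of measures with a unique nearest point on [M],
   and let [y] be a point farthest from [x], at distance [L]. The measures
   [(1 - w) delta_x + w delta_y] with [w] small lie in that ball, and the points of [M] nearest to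
   them are those at distance [t] from [x] on minimal geodesics to [y], where [t] tends to [0] with
   [w]; so all these geodesics start with the same arc. Geodesics do not branch, hence there is only
   one of them, which contradicts Berger's lemma: if a single minimal geodesic joined [y] to [x], then
   prolonging it beyond [y] would increase the distance to [x].

   No geodesic equation is used. A geodesic is a chain of points realising the distance, and both
   facts come from the first variation inequality
   [d(o, u + v) <= d(o, u) + P v + K |v|^2 / d(o, u)], with [P] a linear form close to
   [<u - o, v> / d(o, u)], proved by moving the points of a fine chain in a chart. At an interior
   point of a geodesic the distances to the two ends give such a bound from both sides; hence
   [P] is unique there and Lipschitz in the point, and a discrete Gronwall argument excludes branching. *)

Require Import Defs.
From HB Require Import structures.
From mathcomp Require Import all_boot all_order all_algebra.
From mathcomp Require Import all_classical all_reals all_analysis.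
From mathcomp Require Import measurable_realfun ring lra.

Set Implicit Arguments.
Unset Strict Implicit.
Unset Printing Implicit Defensive.
Import Order.TTheory GRing.Theory Num.Theory.
Import numFieldNormedType.Exports.

Local Open Scope classical_set_scope.
Local Open Scope ring_scope.

(** * Curves in charts *)

(** The exponent enters through strict convexity: for [p > 1] and each weight strictly between 0 and
    1, the cost [(1 - w) s^p + w (L - s)^p] has a single interior minimiser, whereas for [p = 1] it
    is linear in [s]. Hence the weight can be solved from a prescribed [t]. Since a coupling with a
    Dirac measure is forced, the Wasserstein distances involved are explicit.

    The distance is an infimum of lengths, so neither its smoothness nor the existence of minimisers
    is given. In a chain of [N] points, the error of each varied step is [O(1/N^2) + O(|v|^2/N)];
    the sum leaves a linear form, a quadratic term and [O(1/N)], which disappears in the limit. The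
    factor [1 / d(o, u)] in the quadratic term is why supports are taken only at points well away
    from both ends of a geodesic.

    Nonbranching compares two implicit Euler schemes for the gradient flow of [d(o, .)]: each
    increment is [h] times the vector dual to [P], up to [O(h^2)]. Started at the same point, they
    end within [O(1/N)] of each other. *)

Lemma cvg_sum_real (R : realType) (T : Type) (F : set_system T) {FF : Filter F}
    m (f : 'I_m -> T -> R) (l : 'I_m -> R) :
  (forall i, f i x @[x --> F] --> l i) ->
  \sum_i f i x @[x --> F] --> \sum_i l i.
Proof.
move=> h; apply: (@cvg_big R _ +%R 0 xpredT _ T F _ f l FF).
- exact: add_continuous.
- by move=> i _; exact: h.
Qed.

Section charts.
Variables (R : realType) (n : nat) (M : topologicalType).
Implicit Types c : chart R n M.

Lemma chart_imageP c u : chart_image c u -> dom c (param c u).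
Proof. by case=> x dx <-; rewrite coordK. Qed.

Lemma paramK c u : chart_image c u -> Defs.coord c (param c u) = u.
Proof. by case=> x dx <-; rewrite coordK. Qed.

Lemma chart_image_coord c x : dom c x -> chart_image c (Defs.coord c x).
Proof. by move=> dx; exists x. Qed.

Lemma near_dom c x : dom c x -> \forall y \near x, dom c y.
Proof. by move=> dx; apply: open_nbhs_nbhs; split=> //; exact: dom_open. Qed.

Lemma near_chart_image c u : chart_image c u -> \forall y \near u, chart_image c y.
Proof. by move=> dx; apply: open_nbhs_nbhs; split=> //; exact: image_open. Qed.

End charts.

Section curves.
Variables (R : realType) (n : nat) (M : topologicalType).
Variables (S : smooth_manifold R n M) (g : riemannian_metric S).
Local Notation phi i := (Defs.coord (atlas i)).
Local Notation psi i := (param (atlas i)).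
Local Notation D i := (dom (atlas i)).

Lemma transition_differentiable (i j : atlas_index S) x : D i x -> D j x ->
  differentiable (transition (atlas i) (atlas j)) (phi i x).
Proof. by move=> di dj; have [+ _] := atlas_smooth i j 1%N; apply; exists x. Qed.

Lemma transition_derive_continuous (i j : atlas_index S) x v : D i x -> D j x ->
  {for (phi i x), continuous (fun u => 'D_v (transition (atlas i) (atlas j)) u)}.
Proof.
by move=> di dj; have [_ /(_ v)+] := atlas_smooth i j 1%N; apply; exists x.
Qed.

Lemma chart_change_is_derive (i j : atlas_index S) (s : R -> M) (t : R) v :
  {for t, continuous s} -> D i (s t) -> D j (s t) ->
  is_derive t 1 (phi i \o s) v ->
  is_derive t 1 (phi j \o s) ('d (transition (atlas i) (atlas j)) (phi i (s t)) v).
Proof.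
move=> cs di dj dv.
set tau := transition _ _.
have dtau : differentiable tau (phi i (s t)) by exact: transition_differentiable.
have df : differentiable (phi i \o s) t by apply/derivable1_diffP.
have near_eq : {near t, tau \o (phi i \o s) =1 phi j \o s}.
  have : \forall t' \near t, D i (s t') by apply: cs; exact: near_dom.
  by apply: filterS => t' dt'; rewrite /tau /transition /= coordK.
apply: near_eq_is_derive near_eq _.
apply: DeriveDef; first exact/derivable1_diffP/differentiable_comp.
rewrite deriveE; last exact: differentiable_comp.
rewrite diff_comp//=; congr ('d _ _ _).
by rewrite -deriveE// derive_val.
Qed.

(** Any chart around the point may replace the one selected by [index_at]: the velocities are
    related by the differential of the transition map, and the Gram forms by [gram_compat]. *)
Lemma speedE (i : atlas_index S) (s : R -> M) (t : R) v :
  {for t, continuous s} -> D i (s t) -> is_derive t 1 (phi i \o s) v ->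
  speed g s t = Num.sqrt (gram_form (gram g i (phi i (s t))) v v).
Proof.
move=> cs di dv; rewrite /speed; set j := index_at S (s t).
have dj : D j (s t) by rewrite /j /index_at; case: cid.
have dw := chart_change_is_derive cs di dj dv.
rewrite derive1E derive_val; congr Num.sqrt.
by rewrite (gram_compat g di dj).
Qed.

Lemma C1_curveP (O : set R) (s : R -> M) : open O -> C1_curve S O s ->
  forall t (i : atlas_index S), O t -> D i (s t) ->
  [/\ {for t, continuous s},
      \forall t' \near t, O t' /\ D i (s t'),
      is_derive t 1 (phi i \o s) (derive1 (phi i \o s) t) &
      {for t, continuous (derive1 (phi i \o s))}].
Proof.
move=> oO Cs t i Ot di; have [cs Cs'] := Cs t Ot; have [ds cds] := Cs' i di.
split; [exact: cs| | |exact: cds].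
- near=> t'; split; near: t'; first exact: open_nbhs_nbhs.
  by apply: cs; exact: near_dom.
- exact: (DeriveDef ds (esym (derive1E _ _))).
Unshelve. all: by end_near. Qed.

Lemma gram_form_sum (G : 'M[R]_n) (v w : 'rV[R]_n) :
  gram_form G v w = \sum_j (\sum_i v ord0 i * G i j) * w ord0 j.
Proof.
rewrite /gram_form mxE; apply: eq_bigr => j _; rewrite !mxE; congr (_ * _).
Qed.

Lemma continuous_gram_form (T : topologicalType) (F : set_system T) {FF : Filter F}
  (G : T -> 'M[R]_n) (v w : T -> 'rV[R]_n) G0 v0 w0 :
  G @ F --> G0 -> v @ F --> v0 -> w @ F --> w0 ->
  (fun x => gram_form (G x) (v x) (w x)) @ F --> gram_form G0 v0 w0.
Proof.
move=> cG cv cw.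
under eq_fun do rewrite gram_form_sum.
rewrite gram_form_sum.
apply: cvg_sum_real => j; apply: cvgM; last first.
  by apply: (@cvg_comp _ _ _ w (fun x : 'rV[R]_n => x ord0 j)) cw _; exact: coord_continuous.
apply: cvg_sum_real => i; apply: cvgM.
  by apply: (@cvg_comp _ _ _ v (fun x : 'rV[R]_n => x ord0 i)) cv _; exact: coord_continuous.
by apply: (@cvg_comp _ _ _ G (fun x : 'M[R]_n => x i j)) cG _; exact: coord_continuous.
Qed.

Lemma gram_continuous (i : atlas_index S) u : chart_image (atlas i) u ->
  {for u, continuous (gram g i)}.
Proof. by move=> iu; have := gram_smooth g i 0%N; apply. Qed.

(** The chart selected in [speed] may jump with the time, so continuity is read off in one chart
    fixed at [t], where [speedE] gives a continuous formula nearby. *)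
Lemma speed_continuous (O : set R) (s : R -> M) : open O -> C1_curve S O s ->
  forall t, O t -> {for t, continuous (speed g s)}.
Proof.
move=> oO Cs t Ot.
have [i di] := atlas_cover S (s t).
have [cs nOD ds cds] := C1_curveP oO Cs Ot di.
pose f t' := Num.sqrt (gram_form (gram g i (phi i (s t')))
  (derive1 (phi i \o s) t') (derive1 (phi i \o s) t')).
have nf : \forall t' \near t, f t' = speed g s t'.
  apply: filterS nOD => t' [Ot' dt'].
  have [cs' _ ds' _] := C1_curveP oO Cs Ot' dt'.
  by rewrite (speedE cs' dt' ds').
suff cf : {for t, continuous f}.
  rewrite /prop_for /continuous_at -(nbhs_singleton nf).
  by apply: cvg_trans cf; exact: near_eq_cvg.
apply: (continuous_comp (f := fun t' => gram_form _ _ _) (g := Num.sqrt)); last first.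
  exact: sqrt_continuous.
apply: continuous_gram_form => //.
have cphi : {for t, continuous (phi i \o s)}.
  by move: ds => [/derivable1_diffP/differentiable_continuous].
apply: (@cvg_comp _ _ _ (phi i \o s) (gram g i)); first exact: cphi.
by apply: gram_continuous; exact: chart_image_coord.
Qed.

End curves.

Section antiderivative.
Variable R : realType.
Implicit Types (f : R -> R) (a b : R) (O : set R).

Lemma open_itv_enlarge O a b : open O -> `[a, b] `<=` O -> a <= b ->
  exists2 e, 0 < e & `[a - e, b + e] `<=` O.
Proof.
move=> oO abO ab.
have aO : O a by apply: abO; rewrite /= in_itv /= lexx.
have bO : O b by apply: abO; rewrite /= in_itv /= lexx ab.
have /nbhs_ballP[e1 /= e10 h1] := open_nbhs_nbhs (conj oO aO).
have /nbhs_ballP[e2 /= e20 h2] := open_nbhs_nbhs (conj oO bO).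
exists (Num.min e1 e2 / 2); first by rewrite divr_gt0// lt_min e10.
have m1 : Num.min e1 e2 <= e1 by rewrite ge_min lexx.
have m2 : Num.min e1 e2 <= e2 by rewrite ge_min lexx orbT.
move=> t /=; rewrite in_itv /= => /andP[t1 t2].
have [ta|at_] := ltP t a.
  by apply: h1; rewrite /ball /= ger0_norm; lra.
have [tb|bt] := leP t b; first by apply: abO; rewrite /= in_itv /= at_.
by apply: h2; rewrite /ball /= ler0_norm; lra.
Qed.

Lemma continuous_within_itv O f a b : `[a, b] `<=` O ->
  (forall t, O t -> {for t, continuous f}) -> {within `[a, b], continuous f}.
Proof.
move=> abO cf; apply: continuous_in_subspaceT => t /set_mem /abO; exact: cf.
Qed.

Lemma continuous_itv_integrable O f a b : `[a, b] `<=` O ->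
  (forall t, O t -> {for t, continuous f}) ->
  lebesgue_measure.-integrable `[a, b] (EFin \o f).
Proof.
move=> abO cf; apply: continuous_compact_integrable; first exact: segment_compact.
exact: continuous_within_itv abO cf.
Qed.

(** Integrating from [a - e], inside an interval that also extends beyond [b], makes the derivative
    two-sided even at [a] and at [b]. *)
Lemma antiderivative_exists O f a b : open O -> `[a, b] `<=` O -> a <= b ->
  (forall t, O t -> {for t, continuous f}) ->
  exists F : R -> R, forall t, t \in `[a, b] -> is_derive t 1 F (f t).
Proof.
move=> oO abO ab cf.
have [e e0 eO] := open_itv_enlarge oO abO ab.
exists (fun x => \int[lebesgue_measure]_(t in `[a - e, x]) f t) => t.
rewrite in_itv /= => /andP[at_ tb].
have Ot : O t by apply: abO; rewrite /= in_itv /= at_.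
have tbe : t < b + e by lra.
have ate : a - e < t by lra.
have := @continuous_FTC1_closed R f (a - e) t (b + e) tbe
  (continuous_itv_integrable eO cf) ate (cf _ Ot).
by rewrite derive1E => -[h1 h2]; exact: DeriveDef.
Qed.

Lemma is_derive_continuous (V : normedModType R) (F : R -> V) (t : R) l :
  is_derive t 1 F l -> {for t, continuous F}.
Proof. by move=> [/derivable1_diffP/differentiable_continuous]. Qed.

Lemma is_derive_within_continuous F f a b :
  (forall t, t \in `[a, b] -> is_derive t 1 F (f t)) ->
  {within `[a, b], continuous F}.
Proof.
move=> dF; apply: continuous_in_subspaceT => t.
by rewrite inE => /dF; exact: is_derive_continuous.
Qed.

Lemma continuous_integral_antiderivative O f F a b : a < b -> `[a, b] `<=` O ->
  (forall t, O t -> {for t, continuous f}) ->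
  (forall t, t \in `[a, b] -> is_derive t 1 F (f t)) ->
  (\int[lebesgue_measure]_(t in `[a, b]) (f t)%:E = (F b - F a)%:E)%E.
Proof.
move=> ab abO cf dF; rewrite EFinB.
apply: (@continuous_FTC2 R f F a b ab).
- exact: continuous_within_itv abO cf.
- split.
  + move=> t tab; have tab' : t \in `[a, b] by apply: subset_itv_oo_cc.
    by have [] := dF t tab'.
  + have /(dF a)/is_derive_continuous ca : a \in `[a, b] by rewrite in_itv /= lexx ltW.
    exact: (cvg_at_right_filter ca).
  + have /(dF b)/is_derive_continuous cb : b \in `[a, b] by rewrite in_itv /= lexx ltW.
    exact: (cvg_at_left_filter cb).
- move=> t tab; have tab' : t \in `[a, b] by apply: subset_itv_oo_cc.
  by rewrite derive1E; have [] := dF t tab'.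
Qed.

Lemma antiderivative_le F f a b : a <= b ->
  (forall t, t \in `[a, b] -> is_derive t 1 F (f t)) ->
  (forall t, t \in `[a, b] -> 0 <= f t) -> F a <= F b.
Proof.
move=> ab dF f0.
have dF' x : x \in `]a, b[ -> is_derive x 1 F (f x).
  by move=> /subset_itv_oo_cc; exact: dF.
have [c /f0 fc0 e] := @MVT_segment R F f a b ab dF' (is_derive_within_continuous dF).
by rewrite -subr_ge0 e mulr_ge0// subr_ge0.
Qed.

Lemma is_derive_affine (V : normedModType R) (F : R -> V) (al be t : R) l :
  is_derive (al * t + be) 1 F l ->
  is_derive t 1 (fun x => F (al * x + be)) (al *: l).
Proof.
move=> [dF dFl].
have dA : is_derive t 1 (fun x : R => al * x + be) al.
  have -> : (fun x : R => al * x + be) = al *: (@id R) + cst be :> (R -> R).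
    by apply/funext => x.
  by apply: is_derive_eq; rewrite /= addr0 /GRing.scale /= mulr1.
have diA : differentiable (fun x : R => al * x + be) t.
  by apply/derivable1_diffP; case: dA.
have diF : differentiable F (al * t + be) by exact/derivable1_diffP.
have diC : differentiable (F \o (fun x : R => al * x + be)) t.
  exact: differentiable_comp.
apply: DeriveDef; first exact/derivable1_diffP.
rewrite deriveE// diff_comp//= -[X in 'd F _ X]deriveE//.
rewrite (@derive_val _ _ _ _ _ _ _ dA).
have -> : 'd F (al * t + be) al = al *: 'd F (al * t + be) 1.
  by rewrite -linearZ /= /GRing.scale /= mulr1.
by rewrite -deriveE// dFl.
Qed.

End antiderivative.

(** * Arcs and chains of arcs *)

Section gram_form.
Variables (R : realType) (n : nat).
Implicit Types (G : 'M[R]_n) (v w : 'rV[R]_n).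

Lemma gram_formDl G v v' w :
  gram_form G (v + v') w = gram_form G v w + gram_form G v' w.
Proof. by rewrite /gram_form !mulmxDl mxE. Qed.

Lemma gram_formDr G v w w' :
  gram_form G v (w + w') = gram_form G v w + gram_form G v w'.
Proof. by rewrite /gram_form linearD /= mulmxDr mxE. Qed.

Lemma gram_formZl G a v w : gram_form G (a *: v) w = a * gram_form G v w.
Proof. by rewrite /gram_form -!scalemxAl mxE. Qed.

Lemma gram_formZr G a v w : gram_form G v (a *: w) = a * gram_form G v w.
Proof. by rewrite /gram_form linearZ /= -!scalemxAr mxE. Qed.

Lemma gram_form0l G w : gram_form G 0 w = 0.
Proof. by rewrite /gram_form !mul0mx mxE. Qed.

Lemma gram_formC G v w : G^T = G -> gram_form G v w = gram_form G w v.
Proof.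
move=> GT; rewrite /gram_form -[in LHS](trmxK (v *m G *m w^T)).
by rewrite [LHS]mxE !trmx_mul trmxK GT mulmxA.
Qed.

End gram_form.

Section segments.
Variables (R : realType) (n : nat) (M : topologicalType).
Variables (S : smooth_manifold R n M) (g : riemannian_metric S).
Local Notation phi i := (Defs.coord (atlas i)).
Local Notation psi i := (param (atlas i)).
Local Notation D i := (dom (atlas i)).

Lemma affine_continuous (al be t : R) : {for t, continuous (fun x : R => al * x + be)}.
Proof.
apply: cvgD; last exact: cvg_cst.
by apply: cvgM; [exact: cvg_cst | exact: cvg_id].
Qed.

Lemma open_affine (O : set R) (al be : R) : open O -> open [set t | O (al * t + be)].
Proof.
by move=> oO; apply: open_comp => // t _; exact: affine_continuous.
Qed.

Lemma C1_curve_affine (O : set R) (s : R -> M) (al be : R) : open O ->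
  C1_curve S O s ->
  C1_curve S [set t | O (al * t + be)] (fun t => s (al * t + be)).
Proof.
move=> oO Cs t /= Ot; have [cs Cs'] := Cs _ Ot.
have cs' : {for t, continuous (fun t => s (al * t + be))}.
  by apply: (@cvg_comp _ _ _ (fun x : R => al * x + be) s _ _ _ _ cs); exact: affine_continuous.
split; first exact: cs'.
move=> i di; have [_ nOD ds cds] := C1_curveP oO Cs Ot di.
have [d1 d2] := is_derive_affine ds.
split; first exact: d1.
pose f t' := al *: derive1 (phi i \o s) (al * t' + be).
have nf : \forall t' \near t, f t' = derive1 (phi i \o (fun t => s (al * t + be))) t'.
  have nOD' : \forall t' \near t, O (al * t' + be) /\ D i (s (al * t' + be)).
    exact: (@affine_continuous al be t _ nOD).
  apply: filterS nOD' => t' [Ot' dt'].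
  have [_ _ ds' _] := C1_curveP oO Cs Ot' dt'.
  rewrite derive1E; have [_ e2] := is_derive_affine ds'.
  by rewrite /f -e2.
suff cf : {for t, continuous f}.
  rewrite /prop_for /continuous_at -(nbhs_singleton nf).
  by apply: cvg_trans cf; exact: near_eq_cvg.
rewrite /prop_for /continuous_at /f; apply: cvgZ; first exact: cvg_cst.
apply: (@cvg_comp _ _ _ (fun x : R => al * x + be) _ _ _ _ _ cds).
exact: affine_continuous.
Qed.

Lemma speed_affine (O : set R) (s : R -> M) (al be t : R) : open O ->
  C1_curve S O s -> O (al * t + be) ->
  speed g (fun t => s (al * t + be)) t = `|al| * speed g s (al * t + be).
Proof.
move=> oO Cs Ot; have [i di] := atlas_cover S (s (al * t + be)).
have [cs _ ds _] := C1_curveP oO Cs Ot di.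
have [cs' _] := @C1_curve_affine O s al be oO Cs t Ot.
rewrite (speedE g cs di ds).
rewrite (@speedE _ _ _ _ g i _ _ _ cs' di (is_derive_affine ds)).
by rewrite gram_formZl gram_formZr mulrA -expr2 sqrtrM ?sqr_ge0// sqrtr_sqr.
Qed.

Lemma speed_ge0 (s : R -> M) t : 0 <= speed g s t.
Proof. exact: sqrtr_ge0. Qed.

(** The length is the increment of an antiderivative [F] of the speed instead of an integral;
    cutting and reparametrising an arc then become algebra on [F]. *)
Definition c1_arc (x y : M) (l a b : R) (s : R -> M) := exists (O : set R) (F : R -> R),
  [/\ open O, `[a, b] `<=` O, C1_curve S O s,
      forall t, t \in `[a, b] -> is_derive t 1 F (speed g s t) &
      [/\ s a = x, s b = y & l = F b - F a]].

Definition seg (x y : M) (l : R) := exists a b s, a < b /\ c1_arc x y l a b s.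

Lemma seg_reparam x y l c d : seg x y l -> c < d -> exists s, c1_arc x y l c d s.
Proof.
move=> [a [b [s [ab [ O [F [oO abO Cs dF [sa sb ->]]]]]]]] cd.
pose al := (b - a) / (d - c); pose be := a - al * c.
have al0 : 0 < al by rewrite divr_gt0 ?subr_gt0.
have Ec : al * c + be = a by rewrite /be; ring.
have Ed : al * d + be = b by rewrite /be /al; field; rewrite subr_eq0 gt_eqF.
have inab t : t \in `[c, d] -> al * t + be \in `[a, b].
  rewrite !in_itv /= => /andP[ct td]; apply/andP; split.
    by rewrite -Ec lerD2r ler_pM2l.
  by rewrite -Ed lerD2r ler_pM2l.
exists (fun t => s (al * t + be)), [set t | O (al * t + be)], (fun t => F (al * t + be)).
split.
- exact: open_affine.
- by move=> t /= /inab; exact: abO.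
- exact: C1_curve_affine.
- move=> t tcd; have Ot := abO _ (inab _ tcd).
  rewrite (speed_affine oO Cs Ot) gtr0_norm//.
  exact: is_derive_affine (dF _ (inab _ tcd)).
- by rewrite Ec Ed.
Qed.

Lemma seg_sym x y l : seg x y l -> seg y x l.
Proof.
move=> [a [b [s [ab [ O [F [oO abO Cs dF [sa sb ->]]]]]]]].
have inab t : t \in `[- b, - a] -> (-1) * t + 0 \in `[a, b].
  by rewrite !in_itv /= addr0 mulN1r => /andP[h1 h2]; apply/andP; split; lra.
have e u : (-1) * (- u) + 0 = u :> R by ring.
exists (- b), (- a), (fun t => s ((-1) * t + 0)); split; first by rewrite ltrN2.
exists [set t | O ((-1) * t + 0)], (fun t => - F ((-1) * t + 0)).
split.
- exact: open_affine.
- by move=> t /= /inab; exact: abO.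
- exact: C1_curve_affine.
- move=> t tcd; have Ot := abO _ (inab _ tcd).
  rewrite (speed_affine oO Cs Ot) normrN1 mul1r.
  have h := is_deriveN (is_derive_affine (dF _ (inab _ tcd))).
  by apply: is_derive_eq h _; rewrite scaleN1r opprK.
- by rewrite !e; split => //; ring.
Qed.

Lemma seg_ge0 x y l : seg x y l -> 0 <= l.
Proof.
move=> [a [b [s [ab [ O [F [oO abO Cs dF [sa sb ->]]]]]]]].
rewrite subr_ge0; apply: (antiderivative_le (ltW ab) dF) => t _; exact: speed_ge0.
Qed.

Lemma c1_arc_cut x y l a b s c : c1_arc x y l a b s -> a < c -> c < b ->
  exists l1 l2, [/\ l1 + l2 = l, seg x (s c) l1 & seg (s c) y l2].
Proof.
move=> [ O [F [oO abO Cs dF [sa sb ->]]]] ac cb.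
exists (F c - F a), (F b - F c); split; first by ring.
- exists a, c, s; split => //; exists O, F; split => //.
    by move=> t /= tac; apply: abO; move: tac; rewrite /= !in_itv /= => /andP[-> h]; lra.
  by move=> t tac; apply: dF; move: tac; rewrite !in_itv /= => /andP[-> h]; lra.
- exists c, b, s; split => //; exists O, F; split => //.
    by move=> t /= tac; apply: abO; move: tac; rewrite /= !in_itv /= => /andP[h ->]; lra.
  by move=> t tac; apply: dF; move: tac; rewrite !in_itv /= => /andP[h ->]; lra.
Qed.

Inductive chain : M -> M -> R -> Prop :=
| chain_nil x : chain x x 0
| chain_cons x y z l m : seg x y l -> chain y z m -> chain x z (l + m).

Lemma chain_seg x y l : seg x y l -> chain x y l.
Proof. by move=> h; rewrite -[l]addr0; apply: chain_cons h (chain_nil _). Qed.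

Lemma chain_cat x y z l m : chain x y l -> chain y z m -> chain x z (l + m).
Proof.
move=> h; elim: h z m => {x y l}[x z m|x y z l m h h' IH w k hk]; first by rewrite add0r.
by rewrite -addrA; apply: chain_cons h (IH _ _ hk).
Qed.

Lemma chain_sym x y l : chain x y l -> chain y x l.
Proof.
elim=> {x y l}[x|x y z l m h _ IH]; first exact: chain_nil.
by rewrite addrC; apply: chain_cat IH _; apply: chain_seg; exact: seg_sym.
Qed.

Lemma chain_ge0 x y l : chain x y l -> 0 <= l.
Proof.
elim=> {x y l}[x|x y z l m h _ IH] //; rewrite addr_ge0//; exact: seg_ge0 h.
Qed.

(** Intermediate values along the first arc that reaches the level [a]. With [f] the distance from
    one end, this cuts a nearly minimal chain at a prescribed distance. *)
Lemma chain_cut (f : M -> R) x y l a : continuous f -> chain x y l ->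
  f x <= a -> a <= f y ->
  exists z l1 l2, [/\ f z = a, l1 + l2 = l, chain x z l1 & chain z y l2].
Proof.
move=> cf; elim=> {x y l}[x|x y z l m h hm IH] fxa afy.
  exists x, 0, 0; split; [by apply/le_anti/andP; split|by rewrite addr0| |]; exact: chain_nil.
have [fya|fya] := ltP (f y) a.
  have [w [l1 [l2 [fw e c1 c2]]]] := IH (ltW fya) afy.
  exists w, (l + l1), l2; split => //; first by rewrite -e addrA.
  exact: chain_cons h c1.
have [p [q [s [pq arc]]]] := h.
have [ O [F [oO abO Cs dF [sa sb el]]]] := arc.
have [c cpq fsc] : exists2 c, c \in `[p, q] & (f \o s) c = a.
  apply: IVT; first exact: ltW.
    apply: (continuous_within_itv abO) => t Ot.
    by apply: continuous_comp; [have [] := Cs t Ot|exact: cf].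
  rewrite /= sa sb; apply/andP; split; first by rewrite ge_min fxa.
  by rewrite le_max fya orbT.
have [cp|cp] := eqVneq c p.
  exists x, 0, (l + m); split; [by rewrite -sa -cp|by rewrite add0r|exact: chain_nil|].
  exact: chain_cons h hm.
have [cq|cq] := eqVneq c q.
  exists y, l, m; split; [by rewrite -sb -cq|by []|exact: chain_seg|by []].
have pc : p < c by rewrite lt_neqAle eq_sym cp; move: cpq; rewrite in_itv /= => /andP[].
have cq' : c < q by rewrite lt_neqAle cq; move: cpq; rewrite in_itv /= => /andP[].
have [l1 [l2 [e s1 s2]]] := c1_arc_cut arc pc cq'.
exists (s c), l1, (l2 + m); split => //; first by rewrite addrA e.
  exact: chain_seg.
exact: chain_cons s2 hm.
Qed.

End segments.

(** * Lengths of curves and of chains *)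

Section lengths.
Variable R : realType.
Local Notation mu := (@lebesgue_measure R).

Lemma ge0_integral_itv_cat (f : R -> R) (a b c : R) : a <= b -> b <= c ->
  (forall t, 0 <= f t) -> measurable_fun `[a, b] f -> measurable_fun `[b, c] f ->
  measurable_fun `[a, c] f /\
  (\int[mu]_(t in `[a, c]) (f t)%:E =
   \int[mu]_(t in `[a, b]) (f t)%:E + \int[mu]_(t in `[b, c]) (f t)%:E)%E.
Proof.
move=> ab bc f0 m1 m2.
have m2' : measurable_fun `]b, c] f by exact: measurable_fun_itv_oc m2.
have e : `[a, c]%classic = `[a, b]%classic `|` `]b, c]%classic.
  apply/seteqP; split=> t /=; rewrite !in_itv /=.
    by move=> /andP[at_ tc]; case: (leP t b) => tb; [left|right]; rewrite ?at_ ?tb ?tc.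
  by case=> /andP[h1 h2]; apply/andP; split; lra.
have m12 : measurable_fun `[a, c] f.
  by rewrite e; apply/measurable_funU => //; split.
split => //; rewrite e ge0_integral_setU//=.
- congr (_ + _)%E; apply: integral_itv_obnd_cbnd.
  exact/measurable_EFinP.
- by rewrite -e; exact/measurable_EFinP.
- by move=> t _; rewrite lee_fin.
- rewrite disj_set2E; apply/eqP/seteqP; split=> t //= [].
  by rewrite !in_itv /= => /andP[_ h1] /andP[h2 _]; lra.
Qed.

Lemma eq_oo_integral (f h : R -> R) (a b : R) : a < b ->
  measurable_fun `[a, b] h -> (forall t, t \in `]a, b[ -> f t = h t) ->
  measurable_fun `[a, b] f /\
  (\int[mu]_(t in `[a, b]) (f t)%:E = \int[mu]_(t in `[a, b]) (h t)%:E)%E.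
Proof.
move=> ab mh fh.
have mh' : measurable_fun `]a, b[ h.
  by apply: measurable_funS mh => //; exact: subset_itv_oo_cc.
have mf' : measurable_fun `]a, b[ f.
  by apply: eq_measurable_fun mh' => t /set_mem /= tab; rewrite fh.
split; first exact: measurable_fun_itv_cc mf'.
rewrite [LHS]integral_itv_bndoo; last exact/measurable_EFinP.
rewrite [RHS]integral_itv_bndoo; last exact/measurable_EFinP.
by apply: eq_integral => t /set_mem /= tab; rewrite fh.
Qed.

Variables (n : nat) (M : topologicalType).
Variables (S : smooth_manifold R n M) (g : riemannian_metric S).

Lemma speed_near_eq (s s' : R -> M) t : (\forall t' \near t, s t' = s' t') ->
  speed g s t = speed g s' t.
Proof.
move=> nss; have e := nbhs_singleton nss.
rewrite /speed -e; set i := index_at _ _.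
suff -> : derive1 (Defs.coord (atlas i) \o s) t = derive1 (Defs.coord (atlas i) \o s') t by [].
by rewrite !derive1E; apply: near_eq_derive; apply: filterS nss => t' /= ->.
Qed.

(** The curve agrees with its C^1 extension [s] on [[a, b]] only, and at the ends its derivative may
    see the neighbouring pieces. The speeds are therefore compared on the open interval, the ends
    having measure zero. *)
Lemma C1_segment_arc (gm : R -> M) a b : a < b -> C1_segment S gm a b ->
  exists l s, [/\ c1_arc g (gm a) (gm b) l a b s, measurable_fun `[a, b] (speed g gm) &
    (\int[mu]_(t in `[a, b]) (speed g gm t)%:E = l%:E)%E].
Proof.
move=> ab [U [s [oU abU Cs gs]]].
have cs := speed_continuous (g := g) oU Cs.
have [F dF] := antiderivative_exists oU abU (ltW ab) cs.
have wc : measurable_fun `[a, b] (speed g s).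
  apply: subspace_continuous_measurable_fun; first exact: measurable_itv.
  exact: continuous_within_itv abU cs.
have eqs t : t \in `]a, b[ -> speed g gm t = speed g s t.
  move=> tab; apply: speed_near_eq.
  have : nbhs t `]a, b[%classic.
    by apply: open_nbhs_nbhs; split => //; exact: interval_open.
  by apply: filterS => t' /= t'ab; apply: gs; exact: subset_itv_oo_cc.
have [m e] := eq_oo_integral ab wc eqs.
exists (F b - F a), s; split; [|exact: m|].
  exists U, F; split; [exact: oU|exact: abU|exact: Cs|exact: dF|].
  have aab : a \in `[a, b] by rewrite in_itv /= lexx ltW.
  have bab : b \in `[a, b] by rewrite in_itv /= lexx ltW.
  by split; [exact: esym (gs _ aab)|exact: esym (gs _ bab)|].
rewrite e; apply: (continuous_integral_antiderivative ab abU cs dF).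
Qed.

Lemma pieces_chain (gm : R -> M) k (t : nat -> R) :
  (forall i, (i < k)%N -> t i < t i.+1 /\ C1_segment S gm (t i) (t i.+1)) ->
  exists l, [/\ t 0%N <= t k, chain g (gm (t 0%N)) (gm (t k)) l,
    measurable_fun `[t 0%N, t k] (speed g gm) &
    (\int[mu]_(u in `[t 0%N, t k]) (speed g gm u)%:E = l%:E)%E].
Proof.
elim: k => [_|k IH h].
  exists 0; split => //; first exact: chain_nil.
    by rewrite set_itv1; exact: measurable_fun_set1.
  by rewrite set_itv1 integral_set1.
have [l [t0k ch m e]] : exists l, [/\ t 0%N <= t k, chain g (gm (t 0%N)) (gm (t k)) l,
    measurable_fun `[t 0%N, t k] (speed g gm) &
    (\int[mu]_(u in `[t 0%N, t k]) (speed g gm u)%:E = l%:E)%E].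
  by apply: IH => i ik; apply: h; exact: ltnW.
have [tk sk] := h k (ltnSn k).
have [l' [s [arc m' e']]] := C1_segment_arc tk sk.
have [mm ee] := ge0_integral_itv_cat t0k (ltW tk) (speed_ge0 g gm) m m'.
exists (l + l'); split; [| |exact: mm|].
- exact: le_trans t0k (ltW tk).
- by apply: chain_cat ch _; apply: chain_seg; exists (t k), (t k.+1), s.
- by rewrite ee e e'.
Qed.

Lemma C1_curve_cst (x : M) : C1_curve S setT (fun=> x).
Proof.
move=> t _; split; first exact: cvg_cst.
move=> i di; have -> : Defs.coord (atlas i) \o (fun=> x) = cst (Defs.coord (atlas i) x) :> (R -> _).
  by [].
split; first exact: derivable_cst.
have -> : (cst (Defs.coord (atlas i) x) : R -> _)^`()%classic = cst 0.
  by apply/funext => u; rewrite derive1E derive_cst.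
exact: cvg_cst.
Qed.

Lemma speed_cst (x : M) t : speed g (fun=> x) t = 0.
Proof.
have [i di] := atlas_cover S x.
have dc : is_derive t 1 (Defs.coord (atlas i) \o (fun=> x) : R -> _) 0.
  exact: is_derive_cst.
have cc : {for t, continuous (fun _ : R => x)} by exact: cvg_cst.
by rewrite (speedE g cc di dc) gram_form0l sqrtr0.
Qed.

(** The first arc is placed on the first half of [[c, d]] and the rest, by induction, on the second
    half. The empty chain becomes one constant piece, since [c < d]. *)
Lemma chain_curve x y l : chain g x y l -> forall c d : R, c < d ->
  exists gm : R -> M, [/\ piecewise_C1 S gm c d, gm c = x, gm d = y,
    measurable_fun `[c, d] (speed g gm) &
    (\int[mu]_(u in `[c, d]) (speed g gm u)%:E = l%:E)%E].
Proof.
elim=> {x y l} [x|x y z l m sg _ IH] c d cd.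
  exists (fun=> x); split => //.
  - exists 1%N, (fun i => if i is 0%N then c else d); split => // -[|]// _; split => //.
    by exists setT, (fun=> x); split => //; [exact: openT|exact: C1_curve_cst].
  - have -> : speed g (fun=> x) = cst 0 by apply/funext => t; rewrite speed_cst.
    exact: measurable_cst.
  - by rewrite integral0_eq// => t _; rewrite speed_cst.
pose c' := (c + d) / 2.
have cc' : c < c' by rewrite /c'; lra.
have c'd : c' < d by rewrite /c'; lra.
have [gm [[k [t [t0 tk ht]]] gc gd mg eg]] := IH c' d c'd.
have [s [U [F [oU cU Cs dF [sc sc' el]]]]] := seg_reparam sg cc'.
pose hm u := if u <= c' then s u else gm u.
have hg u : c' <= u -> hm u = gm u.
  rewrite le_eqVlt => /predU1P[<-|cu]; rewrite /hm ?lexx; first by rewrite sc' gc.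
  by rewrite leNgt cu.
have hs : C1_segment S hm c c'.
  exists U, s; split => // u; rewrite in_itv /= => /andP[_ uc].
  by rewrite /hm uc.
have tge i : (i <= k)%N -> c' <= t i.
  elim: i => [|i IHi] ik; first by rewrite t0.
  by apply: le_trans (IHi (ltnW ik)) _; rewrite ltW//; have [] := ht i ik.
have hm1 := C1_segment_arc cc' hs.
have [l' [s' [arc' m1 e1]]] := hm1.
have e2 : (\int[mu]_(u in `[c, c']) (speed g hm u)%:E = l%:E)%E.
  have wc : measurable_fun `[c, c'] (speed g s).
    apply: subspace_continuous_measurable_fun; first exact: measurable_itv.
    exact: continuous_within_itv cU (speed_continuous (g := g) oU Cs).
  have eqs u : u \in `]c, c'[ -> speed g hm u = speed g s u.
    move=> tab; apply: speed_near_eq.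
    have : nbhs u `]c, c'[%classic.
      by apply: open_nbhs_nbhs; split => //; exact: interval_open.
    apply: filterS => u' /=; rewrite in_itv /= => /andP[_ u'c].
    by rewrite /hm (ltW u'c).
  have [_ ->] := eq_oo_integral cc' wc eqs.
  rewrite el.
  exact: (continuous_integral_antiderivative cc' cU (speed_continuous (g := g) oU Cs) dF).
have eqo u : u \in `]c', d[ -> speed g hm u = speed g gm u.
  move=> tab; apply: speed_near_eq.
  have : nbhs u `]c', d[%classic.
    by apply: open_nbhs_nbhs; split => //; exact: interval_open.
  apply: filterS => u' /=; rewrite in_itv /= => /andP[cu' _].
  by rewrite hg// ltW.
have [mh e3'] := eq_oo_integral c'd mg eqo; have {e3'}e3 := etrans e3' eg.
have [mm ee] := ge0_integral_itv_cat (ltW cc') (ltW c'd) (speed_ge0 g hm) m1 mh.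
exists hm; split => //.
- exists k.+1, (fun i => if i is i'.+1 then t i' else c); split => // -[|i] ik.
    by rewrite t0.
  have [ti [V [r [oV tV Cr gr]]]] := ht i ik.
  split => //; exists V, r; split => // u uti; rewrite -gr// hg//.
  by apply: le_trans (tge i (ltnW ik)) _; move: uti; rewrite in_itv => /andP[].
- by rewrite /hm ltW.
- by rewrite hg// ltW.
- by rewrite ee e2 e3.
Qed.

(** From here on lengths are handled through chains, and integrals no longer occur. *)
Lemma riemannian_distE x y :
  riemannian_dist g x y = inf [set l | chain g x y l].
Proof.
rewrite /riemannian_dist; congr inf; apply/seteqP; split => l /=.
  move=> [gm [[k [t [t0 tk ht]]] g0 g1] <-].
  have [l' [_ + _]] := pieces_chain ht.
  rewrite t0 tk g0 g1 => ch e.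
  by rewrite /curve_length /Rintegral e.
move=> ch; have [gm [pc g0 g1 _ e]] := chain_curve ch (@ltr01 R).
by exists gm => //; rewrite /curve_length /Rintegral e.
Qed.

End lengths.

(** * The Riemannian distance as a metric *)

Section distance.
Variables (R : realType) (n : nat) (M : topologicalType).
Variables (S : smooth_manifold R n M) (g : riemannian_metric S).
Local Notation phi i := (Defs.coord (atlas i)).
Local Notation psi i := (param (atlas i)).
Local Notation D i := (dom (atlas i)).
Local Notation d := (riemannian_dist g).

Lemma line_continuous (u w : 'rV[R]_n) (t : R) : {for t, continuous (fun t : R => u + t *: w)}.
Proof.
apply: cvgD; first exact: cvg_cst.
by apply: cvgZ; [exact: cvg_id|exact: cvg_cst].
Qed.

Lemma is_derive_line (u w : 'rV[R]_n) (t : R) : is_derive t 1 (fun t : R => u + t *: w) w.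
Proof.
have h : is_derive t 1 (fun t : R => t *: w) w.
  have dl : is_diff t ( *:%R ^~ w) ( *:%R ^~ w : R -> _) by exact: is_diff_scalel.
  have df : differentiable ( *:%R ^~ w : R -> _) t by case: dl.
  apply: DeriveDef; first exact/derivable1_diffP.
  by rewrite deriveE// diff_val scale1r.
have -> : (fun t : R => u + t *: w) = cst u + (fun t : R => t *: w) by apply/funext.
by apply: is_derive_eq (is_deriveD (is_derive_cst u t 1) h) _; rewrite add0r.
Qed.

Lemma C1_curve_line (i : atlas_index S) (u w : 'rV[R]_n) :
  C1_curve S [set t | chart_image (atlas i) (u + t *: w)] (fun t : R => psi i (u + t *: w)).
Proof.
move=> t /= Ot.
have dt := chart_imageP Ot.
have cs : {for t, continuous (fun t : R => psi i (u + t *: w))}.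
  apply: (@cvg_comp _ _ _ (fun t : R => u + t *: w) (psi i)); first exact: line_continuous.
  exact: param_continuous.
split; first exact: cs.
move=> j dj; set tau := transition (atlas i) (atlas j).
have dtau t' : chart_image (atlas i) (u + t' *: w) -> D j (psi i (u + t' *: w)) ->
    is_derive t' 1 (phi j \o (fun t : R => psi i (u + t *: w))) ('D_w tau (u + t' *: w)).
  move=> Ot' dj'; have dt' := chart_imageP Ot'.
  have dta : differentiable tau (u + t' *: w).
    by rewrite -(paramK Ot'); exact: transition_differentiable.
  have dl : differentiable (fun t : R => u + t *: w) t'.
    by apply/derivable1_diffP; case: (is_derive_line u w t').
  have dc := differentiable_comp dl dta.
  apply: DeriveDef; first exact/derivable1_diffP.
  rewrite -[LHS]/('D_1 (tau \o (fun t : R => u + t *: w)) t') deriveE//.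
  rewrite diff_comp//= deriveE//; congr ('d _ _ _).
  by rewrite -deriveE// (@derive_val _ _ _ _ _ _ _ (is_derive_line u w t')).
split; first by case: (dtau t Ot dj).
have nf : \forall t' \near t, 'D_w tau (u + t' *: w) =
    derive1 (phi j \o (fun t : R => psi i (u + t *: w))) t'.
  have n1 : \forall t' \near t, D j (psi i (u + t' *: w)) by apply: cs; exact: near_dom.
  have n2 : \forall t' \near t, chart_image (atlas i) (u + t' *: w).
    by exact: (@line_continuous u w t _ (near_chart_image Ot)).
  by apply: filterS2 n1 n2 => t' h1 h2; rewrite derive1E; have [_ ->] := dtau t' h2 h1.
suff cf : {for t, continuous (fun t' : R => 'D_w tau (u + t' *: w))}.
  rewrite /prop_for /continuous_at -(nbhs_singleton nf).
  by apply: cvg_trans cf; exact: near_eq_cvg.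
apply: (@cvg_comp _ _ _ (fun t : R => u + t *: w) (fun u => 'D_w tau u)).
  exact: line_continuous.
have := transition_derive_continuous (v := w) dt dj.
by rewrite paramK.
Qed.

Lemma speed_line (i : atlas_index S) (u w : 'rV[R]_n) t :
  chart_image (atlas i) (u + t *: w) ->
  speed g (fun t : R => psi i (u + t *: w)) t =
  Num.sqrt (gram_form (gram g i (u + t *: w)) w w).
Proof.
move=> Ot; have dt := chart_imageP Ot.
have [cs _] := @C1_curve_line i u w t Ot.
have dl : is_derive t 1 (phi i \o (fun t : R => psi i (u + t *: w))) w.
  have ne : \near t, (fun t : R => u + t *: w) t = (phi i \o (fun t : R => psi i (u + t *: w))) t.
    have n2 : \forall t' \near t, chart_image (atlas i) (u + t' *: w).
      by exact: (@line_continuous u w t _ (near_chart_image Ot)).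
    by apply: filterS n2 => t' h /=; rewrite paramK.
  exact: (near_eq_is_derive ne (is_derive_line u w t)).
by rewrite (speedE g cs dt dl) paramK.
Qed.

(** By the mean value theorem the length equals the speed at some intermediate time, so a uniform
    bound on the speed bounds it. *)
Lemma seg_line (i : atlas_index S) (u w : 'rV[R]_n) :
  (forall t : R, t \in `[0, 1] -> chart_image (atlas i) (u + t *: w)) ->
  exists l, seg g (psi i u) (psi i (u + w)) l /\
    forall b : R,
    (forall t : R, t \in `[0, 1] -> gram_form (gram g i (u + t *: w)) w w <= b ^+ 2) ->
    0 <= b -> l <= b.
Proof.
move=> huw.
pose U := [set t | chart_image (atlas i) (u + t *: w)].
pose s t := psi i (u + t *: w).
have oU : open U.
  apply: open_comp; first by move=> t _; exact: line_continuous.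
  exact: image_open.
have sU : `[0, 1] `<=` U by move=> t /= ht; exact: huw.
have Cs : C1_curve S U s by exact: C1_curve_line.
have [F dF] := antiderivative_exists oU sU ler01 (speed_continuous (g := g) oU Cs).
exists (F 1 - F 0); split.
  exists 0, 1, s; split; first exact: ltr01.
  exists U, F; split; [exact: oU|exact: sU|exact: Cs|exact: dF|].
  by split; rewrite /s ?scale0r ?scale1r ?addr0.
move=> b hb b0.
have dF' (x : R) : x \in `]0, 1[ -> is_derive x 1 F (speed g s x).
  by move=> /subset_itv_oo_cc; exact: dF.
have [c c01 ->] := @MVT_segment R F (speed g s) 0 1 ler01 dF' (is_derive_within_continuous dF).
rewrite subr0 mulr1 speed_line; last exact: huw.
by rewrite -(ger0_norm b0) -sqrtr_sqr ler_wsqrtr// hb.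
Qed.

Lemma ball_line (u0 u u' : 'rV[R]_n) (r t : R) : ball u0 r u -> ball u0 r u' ->
  t \in `[0, 1] -> ball u0 r (u + t *: (u' - u)).
Proof.
rewrite -ball_normE /= => h1 h2; rewrite in_itv /= => /andP[t0 t1].
have -> : u0 - (u + t *: (u' - u)) = (1 - t) *: (u0 - u) + t *: (u0 - u').
  by apply/rowP => k; rewrite !mxE; ring.
apply: le_lt_trans (ler_normD _ _) _.
rewrite !mx_normZ (ger0_norm t0) ger0_norm ?subr_ge0//.
have [->|tn0] := eqVneq t 0; first by rewrite subr0 mul1r mul0r addr0.
have tp : 0 < t by rewrite lt_neqAle eq_sym tn0.
have -> : r = (1 - t) * r + t * r by ring.
apply: ler_ltD; last by rewrite ltr_pM2l.
by rewrite ler_wpM2l ?subr_ge0// ltW.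
Qed.

Lemma near_chain x : \forall y \near x, exists l, chain g x y l.
Proof.
have [i di] := atlas_cover S x.
have /nbhs_ballP[r /= r0 hr] := near_chart_image (chart_image_coord di).
have n1 : \forall y \near x, ball (phi i x) r (phi i y).
  exact: (Defs.coord_continuous di (nbhsx_ballx _ _ r0)).
have n2 := near_dom di.
apply: filterS2 n1 n2 => y hy dy.
have h (t : R) : t \in `[0, 1] -> chart_image (atlas i) (phi i x + t *: (phi i y - phi i x)).
  move=> t01; apply: hr; apply: ball_line => //; exact: ballxx.
have [l [sg _]] := seg_line h.
exists l; apply: chain_seg; move: sg.
by rewrite addrC subrK !coordK.
Qed.

(** The set of points reached from [x] is open and closed, as each point is joined to all nearby
    ones. *)
Lemma chain_exists x y : exists l, chain g x y l.
Proof.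
pose B := [set y | exists l, chain g x y l].
suff BT : B = setT by have : B y by rewrite BT.
apply: (manifold_connected S).
- by exists x; exists 0; exact: chain_nil.
- exists B; last by rewrite setTI.
  rewrite openE => z [l ch].
  by apply: filterS (near_chain z) => w [m cm]; exists (l + m); exact: chain_cat ch cm.
- exists B; last by rewrite setTI.
  rewrite -[B]setCK closedC openE => z nz.
  apply: filterS (near_chain z) => w [m cm] [l ch]; apply: nz.
  by exists (l + m); apply: chain_cat ch _; exact: chain_sym.
Qed.

Lemma chain_set_has_inf x y : has_inf [set l | chain g x y l].
Proof.
split; first exact: chain_exists.
by exists 0 => l; exact: chain_ge0.
Qed.

Lemma dist_le_chain x y l : chain g x y l -> d x y <= l.
Proof.
move=> ch; rewrite riemannian_distE; apply: ge_inf => //.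
by have [] := chain_set_has_inf x y.
Qed.

Lemma dist_chain_approx x y e : 0 < e -> exists2 l, chain g x y l & l < d x y + e.
Proof.
move=> e0; rewrite riemannian_distE.
by have [l ch le] := inf_adherent e0 (chain_set_has_inf x y); exists l.
Qed.

Lemma dist_ge0 x y : 0 <= d x y.
Proof.
rewrite riemannian_distE; apply: lb_le_inf; first by have [] := chain_set_has_inf x y.
by move=> l; exact: chain_ge0.
Qed.

Lemma distxx x : d x x = 0.
Proof.
by apply/le_anti/andP; split; [apply: dist_le_chain; exact: chain_nil|exact: dist_ge0].
Qed.

Lemma dist_tri x y z : d x z <= d x y + d y z.
Proof.
apply/ler_addgt0Pr => e e0.
have e2 : 0 < e / 2 by rewrite divr_gt0.
have [l ch le] := dist_chain_approx x y e2.
have [m cm me] := dist_chain_approx y z e2.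
have := dist_le_chain (chain_cat ch cm); lra.
Qed.

Lemma dist_sym x y : d x y = d y x.
Proof.
have h a b : d a b <= d b a.
  apply/ler_addgt0Pr => e e0.
  have [l ch le] := dist_chain_approx b a e0.
  have := dist_le_chain (chain_sym ch); lra.
by apply/le_anti/andP; split.
Qed.

End distance.

(** * Taylor bounds on the metric tensor *)

Section matrix_bounds.
Variables (R : realType) (n : nat).
Local Notation V := 'rV[R]_n.

Lemma mx_norm_le m k (A : 'M[R]_(m, k)) x : 0 <= x ->
  (forall i j, `|A i j| <= x) -> `|A| <= x.
Proof.
move=> x0 h; have -> : `|A| = mx_norm A by [].
rewrite mx_normrE; by apply: bigmax_le => // -[a b] _ /=.
Qed.

Lemma mx_norm_ge m k (A : 'M[R]_(m, k)) i j : `|A i j| <= `|A|.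
Proof.
have -> : `|A| = mx_norm A by [].
rewrite mx_normrE.
by apply: (le_bigmax_cond _ (fun ij : 'I_m * 'I_k => `|A ij.1 ij.2|) (isT : xpredT (i, j))).
Qed.

Lemma gram_form_norm (G : 'M[R]_n) (v w : V) :
  `|gram_form G v w| <= (n * n)%:R * `|G| * `|v| * `|w|.
Proof.
rewrite gram_form_sum; apply: le_trans (ler_norm_sum _ _ _) _.
have -> : (n * n)%:R * `|G| * `|v| * `|w| = \sum_(j < n) (n%:R * `|G| * `|v| * `|w|).
  by rewrite sumr_const card_ord -[RHS]mulr_natl natrM !mulrA.
apply: ler_sum => j _; rewrite normrM.
apply: ler_pM => //; last exact: mx_norm_ge.
apply: le_trans (ler_norm_sum _ _ _) _.
have -> : n%:R * `|G| * `|v| = \sum_(j < n) (`|G| * `|v|).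
  by rewrite sumr_const card_ord -[RHS]mulr_natl !mulrA.
apply: ler_sum => i _; rewrite normrM mulrC.
by apply: ler_pM => //; exact: mx_norm_ge.
Qed.

Lemma gram_formBm (G G' : 'M[R]_n) (v w : V) :
  gram_form (G - G') v w = gram_form G v w - gram_form G' v w.
Proof. by rewrite /gram_form mulmxBr mulmxBl !mxE. Qed.

Lemma derive_decomp (W : normedModType R) (f : V -> W) u v : differentiable f u ->
  'D_v f u = \sum_k v ord0 k *: 'D_(delta_mx ord0 k) f u.
Proof.
move=> df; rewrite deriveE// {1}(row_sum_delta v) linear_sum.
by apply: eq_bigr => k _; rewrite linearZ /= deriveE.
Qed.

Definition partials_norm (W : normedModType R) (f : V -> W) u :=
  \sum_k `|'D_(delta_mx ord0 k) f u|.

Lemma derive_norm_le (W : normedModType R) (f : V -> W) u v : differentiable f u ->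
  `|'D_v f u| <= `|v| * partials_norm f u.
Proof.
move=> df; rewrite derive_decomp//; apply: le_trans (ler_norm_sum _ _ _) _.
rewrite /partials_norm mulr_sumr; apply: ler_sum => k _.
by rewrite normrZ ler_wpM2r//; exact: mx_norm_ge.
Qed.

(** The mean value theorem holds entry by entry, with [c] depending on the entry. As the norm of a
    matrix is the largest absolute value of an entry, this is enough for Lipschitz and Taylor
    bounds. *)
Lemma mean_value_entry m k (f : V -> 'M[R]_(m, k)) u w i j :
  (forall t : R, t \in `[0, 1] -> differentiable f (u + t *: w)) ->
  exists2 c : R, c \in `[0, 1] & f (u + w) i j - f u i j = ('D_w f (u + c *: w)) i j.
Proof.
move=> df.
pose h (t : R) := f (u + t *: w) i j.
have dh (t : R) : t \in `[0, 1] -> is_derive t 1 h (('D_w f (u + t *: w)) i j).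
  move=> t01; have dft := df t t01.
  have dl : differentiable (fun t : R => u + t *: w) t.
    by apply/derivable1_diffP; case: (is_derive_line u w t).
  have dc := differentiable_comp dl dft.
  have dcd : derivable (f \o (fun t : R => u + t *: w)) t 1 by apply: diff_derivable.
  apply: DeriveDef; first by have /derivable_mxP := dcd; exact.
  have := derive_mx dcd; move=> /matrixP/(_ i j); rewrite [X in _ = X]mxE => <-.
  suff -> : 'D_1 (f \o (fun t : R => u + t *: w)) t = 'D_w f (u + t *: w) by [].
  rewrite deriveE; last exact: dc.
  rewrite diff_comp//= [RHS]deriveE//; congr ('d _ _ _).
  by rewrite -deriveE// (@derive_val _ _ _ _ _ _ _ (is_derive_line u w t)).
have dh' (t : R) : t \in `]0, 1[ -> is_derive t 1 h (('D_w f (u + t *: w)) i j).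
  by move=> /subset_itv_oo_cc; exact: dh.
have [c c01 e] := @MVT_segment R h _ 0 1 ler01 dh' (is_derive_within_continuous dh).
exists c => //; move: e; rewrite /h scale1r scale0r addr0 => ->.
by rewrite subr0 mulr1.
Qed.

End matrix_bounds.

Section tame.
Variables (R : realType) (n : nat).
Local Notation V := 'rV[R]_n.
Implicit Types (G : V -> 'M[R]_n) (DG : V -> V -> 'M[R]_n).

(** The quantitative facts on the metric tensor that later estimates draw on, where [DG u h] stands
    for the derivative of [G] at [u] along [h]. One constant serves for all of them. *)
Record tame G DG (u0 : V) (r C : R) : Prop := Tame {
  tame_sym : forall u, ball u0 r u -> (G u)^T = G u;
  tame_bound : forall u v w, ball u0 r u -> `|gram_form (G u) v w| <= C * `|v| * `|w|;
  tame_coercive : forall u v, ball u0 r u -> `|v| ^+ 2 <= C * gram_form (G u) v v;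
  tame_lipschitz : forall u u' v w, ball u0 r u -> ball u0 r u' ->
    `|gram_form (G u) v w - gram_form (G u') v w| <= C * `|u - u'| * `|v| * `|w|;
  tame_linear : forall u a h h', ball u0 r u -> DG u (a *: h + h') = a *: DG u h + DG u h';
  tame_derive : forall u h v w, ball u0 r u ->
    `|gram_form (DG u h) v w| <= C * `|h| * `|v| * `|w|;
  tame_taylor : forall u h v w, ball u0 r u -> ball u0 r (u + h) ->
    `|gram_form (G (u + h)) v w - gram_form (G u) v w - gram_form (DG u h) v w|
      <= C * `|h| ^+ 2 * `|v| * `|w| }.

Lemma sphere_compact : compact [set v : V | `|v| = 1].
Proof.
apply: bounded_closed_compact.
- exists 1; split; first exact: num_real.
  by move=> x x1 v /= ->; exact: ltW.
- have -> : [set v : V | `|v| = 1] = (fun v => `|v|) @^-1` [set 1] by [].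
  apply: closed_comp; last exact: closed_eq.
  by move=> v _; exact: norm_continuous.
Qed.

(** The constant is the minimum on the compact unit sphere, which is nonempty in positive dimension;
    homogeneity does the rest. *)
Lemma gram_form_coercive (A : 'M[R]_n) : (0 < n)%N ->
  (forall v, v != 0 -> 0 < gram_form A v v) ->
  exists2 c, 0 < c & forall v, c * `|v| ^+ 2 <= gram_form A v v.
Proof.
move=> n0 Apos.
have [v1 v1n] : [set v : V | `|v| = 1] !=set0.
  exists (const_mx 1) => /=; apply/le_anti/andP; split.
    by apply: mx_norm_le => // i j; rewrite mxE normr1.
  by have := mx_norm_ge (const_mx 1 : V) ord0 (Ordinal n0); rewrite mxE normr1.
have [||c c1 hc] := @EVT_min_rV R n (fun v => gram_form A v v) _ _ sphere_compact.
- by exists v1.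
- apply: continuous_subspaceT => v.
  apply: (@continuous_gram_form _ _ _ (nbhs v) _ (fun=> A) id id A v v).
  + exact: cvg_cst.
  + exact: cvg_id.
  + exact: cvg_id.
have cn : `|c| = 1 by move: c1; rewrite inE.
have cn0 : c != 0 by rewrite -normr_eq0 cn oner_eq0.
exists (gram_form A c c); first exact: Apos.
move=> v; have [->|v0] := eqVneq v 0.
  by rewrite normr0 expr0n /= mulr0 gram_form0l.
have nv : 0 < `|v| by rewrite normr_gt0.
have := hc (`|v|^-1 *: v); rewrite inE /= normrZ normfV normr_id mulVf ?gt_eqF//.
move=> /(_ erefl); rewrite gram_formZl gram_formZr mulrA -expr2 => h.
by rewrite -ler_pdivlMr ?exprn_gt0// mulrC -exprVn.
Qed.

Lemma continuous_near_le (T : topologicalType) (f : T -> R) x : {for x, continuous f} ->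
  \forall y \near x, f y <= f x + 1.
Proof.
move=> cf; have h : \forall y \near x, ball (f x) 1 (f y) by exact: cf (nbhsx_ballx (f x) 1 ltr01).
by apply: filterS h => y; rewrite /ball /= => /ltr_distlCDr /ltW.
Qed.

Lemma continuous_norm_sum (f : 'I_n -> V -> 'M[R]_n) u : (forall k, {for u, continuous (f k)}) ->
  {for u, continuous (fun u => \sum_k `|f k u|)}.
Proof.
move=> cf; apply: (@cvg_sum_real _ _ (nbhs u) _ n (fun k u => `|f k u|) (fun k => `|f k u|)).
by move=> k; apply: cvg_norm; exact: cf.
Qed.

(** Continuity bounds [G] and its partial derivatives of order one and two near [u0]; the mean value
    theorem turns this into Lipschitz and Taylor bounds, and coercivity at [u0] persists on a small
    ball. *)
Lemma smooth_tame (U : set V) G (u0 : V) : open U -> smooth U G -> U u0 -> (0 < n)%N ->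
  (forall u, U u -> (G u)^T = G u) ->
  (forall u v, U u -> v != 0 -> 0 < gram_form (G u) v v) ->
  exists r C, [/\ 0 < r, 1 <= C, ball u0 r `<=` U & tame G (fun u h => 'D_h G u) u0 r C].
Proof.
move=> oU sG Uu0 n0 Gsym Gpos.
have cG u : U u -> {for u, continuous G} by move=> Uu; have := sG 0%N; apply.
have dG u : U u -> differentiable G u by move=> Uu; have [+ _] := sG 1%N; apply.
have cDG v u : U u -> {for u, continuous (fun u => 'D_v G u)}.
  by move=> Uu; have [_ /(_ v)+] := sG 1%N; apply.
have dDG v u : U u -> differentiable (fun u => 'D_v G u) u.
  by move=> Uu; have [_ /(_ v)[+ _]] := sG 2%N; apply.
have cDDG v w u : U u -> {for u, continuous (fun u => 'D_w (fun u => 'D_v G u) u)}.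
  by move=> Uu; have [_ /(_ v)[_ /(_ w)+]] := sG 2%N; apply.
pose e k : V := delta_mx ord0 k.
pose S2 u := \sum_k partials_norm (fun u => 'D_(e k) G u) u.
have n1 : \forall u \near u0, `|G u| <= `|G u0| + 1.
  apply: (continuous_near_le (f := fun u => `|G u|)).
  exact: (continuous_comp (cG _ Uu0) (@norm_continuous _ _ _)).
have n2 : \forall u \near u0, partials_norm G u <= partials_norm G u0 + 1.
  by apply: continuous_near_le; apply: continuous_norm_sum => k; exact: (cDG _ _ Uu0).
have n3 : \forall u \near u0, S2 u <= S2 u0 + 1.
  apply: continuous_near_le; apply: (@cvg_sum_real _ _ (nbhs u0) _ n
    (fun k => partials_norm (fun u => 'D_(e k) G u))) => l.
  by apply: continuous_norm_sum => k; exact: (cDDG _ _ _ Uu0).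
have n4 : nbhs u0 U by exact: open_nbhs_nbhs.
have n5 : nbhs u0 [set u | ((`|G u| <= `|G u0| + 1) /\
    (partials_norm G u <= partials_norm G u0 + 1)) /\ (S2 u <= S2 u0 + 1 /\ U u)].
  exact: (filterI (filterI n1 n2) (filterI n3 n4)).
have [r1 r10 hr1] := (nbhs_ballP _ _).1 n5.
move: r10 => /= r10.
have pn0 (W : normedModType R) (f : V -> W) u : 0 <= partials_norm f u.
  by apply: sumr_ge0.
have S20 u : 0 <= S2 u by apply: sumr_ge0.
pose K := (`|G u0| + 1) + (partials_norm G u0 + 1) + (S2 u0 + 1).
have K0 : 0 <= K.
  by rewrite /K; have h1 := normr_ge0 (G u0); have h2 := pn0 _ G u0; have h3 := S20 u0; lra.
have bU u : ball u0 r1 u -> U u by move=> /hr1[_ []].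
have bG u : ball u0 r1 u -> `|G u| <= K.
  move=> /hr1[[h _] _]; apply: le_trans h _.
  by rewrite /K; have h2 := pn0 _ G u0; have h3 := S20 u0; lra.
have bD u : ball u0 r1 u -> partials_norm G u <= K.
  move=> /hr1[[_ h] _]; apply: le_trans h _.
  have h1 := normr_ge0 (G u0); have h2 := S20 u0; rewrite /K; lra.
have bS u k : ball u0 r1 u -> partials_norm (fun u => 'D_(e k) G u) u <= K.
  move=> /hr1[_ [h _]]; apply: (@le_trans _ _ (S2 u)).
    by rewrite /S2 (bigD1 k)//= lerDl sumr_ge0.
  apply: le_trans h _.
  have h1 := normr_ge0 (G u0); have h2 := pn0 _ G u0; rewrite /K; lra.
have inb u w (t : R) : ball u0 r1 u -> ball u0 r1 (u + w) -> t \in `[0, 1] ->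
    ball u0 r1 (u + t *: w).
  move=> bu buw t01; have := ball_line bu buw t01.
  by have -> : u + w - u = w by rewrite addrAC subrr add0r.
have lipG u w : ball u0 r1 u -> ball u0 r1 (u + w) -> `|G (u + w) - G u| <= K * `|w|.
  move=> bu buw; apply: mx_norm_le; first by rewrite mulr_ge0.
  move=> i j; rewrite !mxE.
  have df (t : R) : t \in `[0, 1] -> differentiable G (u + t *: w).
    by move=> t01; apply: dG; apply: bU; exact: inb.
  have [c c01 ->] := mean_value_entry i j df.
  apply: le_trans (mx_norm_ge _ _ _) _.
  have bc := inb _ _ _ bu buw c01.
  apply: le_trans (derive_norm_le _ (dG _ (bU _ bc))) _.
  by rewrite mulrC ler_wpM2r// bD.
have lipD u w k : ball u0 r1 u -> ball u0 r1 (u + w) ->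
    `|'D_(e k) G (u + w) - 'D_(e k) G u| <= K * `|w|.
  move=> bu buw; apply: mx_norm_le; first by rewrite mulr_ge0.
  move=> i j; rewrite !mxE.
  have df (t : R) : t \in `[0, 1] -> differentiable (fun u => 'D_(e k) G u) (u + t *: w).
    by move=> t01; apply: dDG; apply: bU; exact: inb.
  have [c c01 ->] := mean_value_entry i j df.
  apply: le_trans (mx_norm_ge _ _ _) _.
  have bc := inb _ _ _ bu buw c01.
  apply: le_trans (derive_norm_le _ (dDG _ _ (bU _ bc))) _.
  by rewrite mulrC ler_wpM2r// bS.
have lipDh u w h : ball u0 r1 u -> ball u0 r1 (u + w) ->
    `|'D_h G (u + w) - 'D_h G u| <= n%:R * K * `|h| * `|w|.
  move=> bu buw.
  rewrite (derive_decomp _ (dG _ (bU _ bu))) (derive_decomp _ (dG _ (bU _ buw))) -sumrB.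
  apply: le_trans (ler_norm_sum _ _ _) _.
  have -> : n%:R * K * `|h| * `|w| = \sum_(j < n) (`|h| * (K * `|w|)).
    by rewrite sumr_const card_ord -[RHS]mulr_natl; ring.
  apply: ler_sum => k _; rewrite -scalerBr normrZ.
  by apply: ler_pM => //; [exact: mx_norm_ge|exact: lipD].
have taylG u h : ball u0 r1 u -> ball u0 r1 (u + h) ->
    `|G (u + h) - G u - 'D_h G u| <= n%:R * K * `|h| ^+ 2.
  move=> bu buw; apply: mx_norm_le; first by rewrite !mulr_ge0// ?ler0n ?exprn_ge0.
  move=> i j.
  have df (t : R) : t \in `[0, 1] -> differentiable G (u + t *: h).
    by move=> t01; apply: dG; apply: bU; exact: inb.
  have [c c01 ec] := mean_value_entry i j df.
  have -> : (G (u + h) - G u - 'D_h G u) i j = ('D_h G (u + c *: h) - 'D_h G u) i j.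
    by rewrite [RHS]mxE -ec !mxE.
  apply: le_trans (mx_norm_ge _ _ _) _.
  have bc := inb _ _ _ bu buw c01.
  apply: le_trans (lipDh _ _ _ bu bc) _.
  have -> : n%:R * K * `|h| ^+ 2 = n%:R * K * `|h| * `|h| by ring.
  rewrite normrZ ler_wpM2l// ?mulr_ge0//.
  move: c01; rewrite in_itv /= => /andP[c0 c1].
  by rewrite ger0_norm// ler_piMl.
have [c0 c00 hc0] := gram_form_coercive n0 (fun v => Gpos _ v Uu0).
pose N : R := (n * n)%:R.
have N0 : 1 <= N by rewrite /N ler1n muln_gt0 n0.
have n1R : 1 <= n%:R :> R by rewrite ler1n.
pose C := 1 + N * (n%:R * K) + 2 / c0.
have c2 : 0 < 2 / c0 by rewrite divr_gt0.
have NK0 : 0 <= N * (n%:R * K) by rewrite !mulr_ge0// ?(le_trans ler01).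
have NKC : N * (n%:R * K) <= C by rewrite /C; lra.
have NKC' : N * K <= C.
  apply: le_trans NKC; rewrite ler_wpM2l ?(le_trans ler01)//.
  by rewrite ler_peMl.
(* Within [c0 / (2 * q)] of [u0] the Gram form varies by at most half of its coercivity constant
   [c0]; the summand 1 keeps [q] positive. *)
pose q := 1 + N * K.
have q0 : 0 < q by rewrite /q ltr_pwDl// mulr_ge0// (le_trans ler01).
pose r := Num.min r1 (c0 / (2 * q)).
have r0 : 0 < r by rewrite lt_min r10 divr_gt0// mulr_gt0.
have rr1 u : ball u0 r u -> ball u0 r1 u.
  by apply: le_ball; rewrite ge_min lexx.
have gfb (A : 'M[R]_n) v w a : `|A| <= a -> `|gram_form A v w| <= N * a * `|v| * `|w|.
  move=> Aa; apply: le_trans (gram_form_norm _ _ _) _.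
  by rewrite !ler_wpM2r// ler_wpM2l// ler0n.
have lipgf u u' v w : ball u0 r1 u -> ball u0 r1 u' ->
    `|gram_form (G u) v w - gram_form (G u') v w| <= N * K * `|u - u'| * `|v| * `|w|.
  move=> bu bu'; rewrite -gram_formBm; rewrite -!(mulrA N) (mulrA N).
  apply: le_trans (gfb _ _ _ (K * `|u - u'|) _) _; last by rewrite !mulrA.
  have {1}-> : u = u' + (u - u') by rewrite addrC subrK.
  by apply: lipG => //; rewrite addrC subrK.
exists r, C; split => //.
- by rewrite /C; lra.
- by move=> u /rr1 /bU.
- split.
  + by move=> u /rr1 /bU; exact: Gsym.
  + move=> u v w /rr1 bu; apply: le_trans (gfb _ _ _ _ (bG _ bu)) _.
    by rewrite !ler_wpM2r.
  + move=> u v bu; have bu1 := rr1 _ bu.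
    have b0 : ball u0 r1 u0 by exact: ballxx.
    have h1 := lipgf _ _ v v b0 bu1.
    have h2 := hc0 v.
    have h3 : `|u0 - u| <= c0 / (2 * q).
      move: bu; rewrite -ball_normE /= lt_min => /andP[_ /ltW]; exact: le_trans.
    have h4 : N * K * `|u0 - u| <= c0 / 2.
      apply: (@le_trans _ _ (q * (c0 / (2 * q)))); last first.
        by rewrite le_eqVlt; apply/orP; left; apply/eqP; field; rewrite gt_eqF.
      apply: ler_pM => //; first by rewrite mulr_ge0// (le_trans ler01).
      by rewrite /q lerDr.
    have h5 : c0 / 2 * `|v| ^+ 2 <= gram_form (G u) v v.
      have h6 : N * K * `|u0 - u| * `|v| * `|v| <= c0 / 2 * `|v| ^+ 2.
        by rewrite -mulrA -expr2 ler_wpM2r// exprn_ge0.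
      have h7 := ler_norm (gram_form (G u0) v v - gram_form (G u) v v).
      lra.
    have h8 : `|v| ^+ 2 <= 2 / c0 * gram_form (G u) v v.
      have -> : `|v| ^+ 2 = 2 / c0 * (c0 / 2 * `|v| ^+ 2).
        by field; rewrite gt_eqF.
      by rewrite ler_wpM2l// ltW.
    apply: le_trans h8 _; rewrite ler_wpM2r//; last by rewrite /C; lra.
    by apply: le_trans h5; rewrite mulr_ge0// ?exprn_ge0// ltW// divr_gt0.
  + move=> u u' v w /rr1 bu /rr1 bu'; apply: le_trans (lipgf _ _ _ _ bu bu') _.
    by rewrite !ler_wpM2r.
  + move=> u a h h' /rr1 /bU /dG du.
    by rewrite !deriveE// linearP.
  + move=> u h v w /rr1 bu; have := derive_norm_le h (dG _ (bU _ bu)) => hd.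
    have hd' : `|'D_h G u| <= K * `|h|.
      by apply: le_trans hd _; rewrite mulrC ler_wpM2r// bD.
    apply: le_trans (gfb _ _ _ _ hd') _.
    by rewrite mulrA !ler_wpM2r.
  + move=> u h v w /rr1 bu /rr1 buh; rewrite -!gram_formBm.
    apply: le_trans (gfb _ _ _ _ (taylG _ _ bu buh)) _.
    by rewrite mulrA !ler_wpM2r// exprn_ge0.
Qed.

End tame.

(** * Comparison of the distance with the metric tensor *)

Section local_monotonicity.
Variable R : realType.

Lemma is_derive_near_le (V : normedModType R) (f : R -> V) (t : R) v (e : R) : 0 < e ->
  is_derive t 1 f v ->
  \forall t' \near t, `|f t' - f t - (t' - t) *: v| <= e * `|t' - t|.
Proof.
move=> e0 dv.
have df : differentiable f t by apply/derivable1_diffP; case: dv.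
have E : (fun h => f (h + t)) = (fun h => f t + 'd f t h) +o_ (0 : R) id.
  apply/eqaddoE; rewrite funeqE => h; exact: (diff_locallyx df h).
have /eqaddoP /(_ _ e0) h := E.
have h2 : \forall t' \near t, `|f ((t' - t) + t) - (f t + 'd f t (t' - t))| <= e * `|t' - t|.
  have c : (fun t' : R => t' - t) @ t --> (0 : R).
    by rewrite -(subrr t); apply: cvgB; [exact: cvg_id|exact: cvg_cst].
  exact: c _ h.
apply: filterS h2 => t'; rewrite subrK opprD addrA.
suff -> : 'd f t (t' - t) = (t' - t) *: v by [].
rewrite -{1}[t' - t]mulr1 -[(t' - t) * 1]/((t' - t) *: (1 : R)) linearZ /=; congr (_ *: _).
by rewrite -deriveE//; case: dv.
Qed.

(** The set of [t] with [H a <= H t] contains its supremum, by the comparison to the left of it, and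
    the comparison to the right forbids the supremum to lie before [b]. *)
Lemma locally_monotone_le (H : R -> R) (a b : R) : a <= b ->
  (forall t, t \in `[a, b] -> \forall t' \near t,
    (t <= t' -> H t <= H t') /\ (t' <= t -> H t' <= H t)) ->
  H a <= H b.
Proof.
move=> ab hH.
pose A := [set t | t \in `[a, b] /\ H a <= H t].
have Aa : A a by split => //; rewrite in_itv /= lexx.
have sA : has_sup A.
  by split; [exists a|exists b => t [+ _]; rewrite in_itv /= => /andP[]].
set c := sup A.
have ac : a <= c by apply: sup_upper_bound.
have cb : c <= b by apply: sup_le_ub; [exists a|move=> t [+ _]; rewrite in_itv /= => /andP[]].
have cab : c \in `[a, b] by rewrite in_itv /= ac.
have /nbhs_ballP[e /= e0 he] := hH _ cab.
have Ac : H a <= H c.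
  have [t At ct] := sup_adherent e0 sA.
  have tc : t <= c by apply: sup_upper_bound.
  have [|_ /(_ tc)] := he t.
    by rewrite /ball /= ger0_norm ?subr_ge0//; rewrite -/c in ct; lra.
  by apply: le_trans; case: At.
have [bc|cb'] := leP b c; first by have -> : b = c by apply/le_anti/andP.
pose t := Num.min b (c + e / 2).
have tb : t <= b by rewrite ge_min lexx.
have tc : c < t by rewrite lt_min cb' ltrDl divr_gt0.
have te : t <= c + e / 2 by rewrite ge_min lexx orbT.
have At : A t.
  split; first by rewrite in_itv /= tb andbT (le_trans ac)// ltW.
  apply: le_trans Ac _; have [|+ _] := he t.
    by rewrite /ball /= ltr0_norm; lra.
  by apply; exact: ltW.
have : t <= c by apply: sup_upper_bound.
by rewrite leNgt tc.
Qed.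

(** [K] need not be differentiable, as is the case for a truncated norm along a curve. Adding a
    small linear term to [F - K] makes it locally monotone. *)
Lemma dini_mean_value (K F f : R -> R) (a b : R) : a <= b ->
  (forall t, t \in `[a, b] -> is_derive t 1 F (f t)) ->
  (forall t e, t \in `[a, b] -> 0 < e ->
     \forall t' \near t, `|K t' - K t| <= (f t + e) * `|t' - t|) ->
  K b - K a <= F b - F a.
Proof.
move=> ab dF hK; apply/ler_addgt0Pr => e e0.
pose e1 := e / (b - a + 1).
have ba0 : 0 < b - a + 1 by lra.
have e10 : 0 < e1 by rewrite divr_gt0.
pose H t := F t + e1 * t - K t.
suff HH : H a <= H b.
  have h1 : e1 * (b - a) <= e.
    rewrite /e1 mulrAC ler_pdivrMr// ler_pM2l//; lra.
  move: HH; rewrite /H; lra.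
apply: locally_monotone_le ab _ => t tab.
have e20 : 0 < e1 / 2 by rewrite divr_gt0.
apply: filterS2 (hK t _ tab e20) (is_derive_near_le e20 (dF t tab)) => t' h1 h2.
have := h1; rewrite ler_norml => /andP[h3 h4].
have := h2; rewrite ler_norml => /andP[h5 h6].
rewrite /GRing.scale /= in h5 h6.
rewrite /H; split => tt.
  have en : `|t' - t| = t' - t by rewrite ger0_norm// subr_ge0.
  by rewrite en in h3 h4 h5 h6; nra.
have en : `|t' - t| = t - t' by rewrite ler0_norm ?opprB// subr_le0.
by rewrite en in h3 h4 h5 h6; nra.
Qed.

End local_monotonicity.

Section truncated_norm.
Variables (R : realType) (n : nat) (M : topologicalType).
Variables (S : smooth_manifold R n M) (g : riemannian_metric S).
Local Notation phi i := (Defs.coord (atlas i)).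
Local Notation psi i := (param (atlas i)).
Local Notation D i := (dom (atlas i)).
Local Notation V := 'rV[R]_n.
Local Notation d := (riemannian_dist g).

Variables (i : atlas_index S) (u : V) (N : V -> R) (c s : R).
Hypothesis ND : forall v w : V, N (v + w) <= N v + N w.
Hypothesis NZ : forall a (v : V), N (a *: v) = `|a| * N v.
Hypothesis Nle : forall v, N v <= c * `|v|.
Hypothesis c0 : 0 < c.
Let Y := [set y : V | N (y - u) <= s].
Hypothesis Ybounded : bounded_set Y.
Hypothesis Ysub : Y `<=` chart_image (atlas i).
Hypothesis Nspeed : forall y w : V, Y y -> N w <= Num.sqrt (gram_form (gram g i y) w w).

(** A function on all of [M] that grows at most as fast as the distance, used to bound the distance
    from below: by the cut-off at [s], a chain that leaves the chart has already paid [s]. *)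
Definition trunc (z : M) := if `[< D i z >] then Num.min s (N (phi i z - u)) else s.

Lemma N_lip v w : `|N v - N w| <= N (v - w).
Proof.
have NN x : N (- x) = N x by rewrite -scaleN1r NZ normrN1 mul1r.
have h1 := ND (v - w) w; rewrite subrK in h1.
have h2 := ND (w - v) v; rewrite subrK -(NN (w - v)) opprB in h2.
by rewrite ler_norml; apply/andP; split; lra.
Qed.

Lemma N_continuous : continuous (fun y : V => N (y - u)).
Proof.
move=> y A /nbhs_ballP[e /= e0 hA].
apply/nbhs_ballP; exists (e / c); first by rewrite /= divr_gt0.
move=> y'; rewrite -ball_normE /= => yy'; apply: hA.
apply: le_lt_trans (N_lip _ _) _.
have -> : y - u - (y' - u) = y - y' by rewrite opprB addrA subrK.
apply: le_lt_trans (Nle _) _.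
by rewrite mulrC -ltr_pdivlMr.
Qed.

(** Being compact in a Hausdorff space, the region where the norm is at most [s] is closed in [M],
    not only in the chart. Near any point off it the truncated norm is thus constant, so it cannot
    jump at the boundary of the chart. *)
Lemma trunc_image_closed : closed (psi i @` Y).
Proof.
apply: compact_closed; first exact: (manifold_hausdorff S).
apply: continuous_compact.
  apply: continuous_in_subspaceT => y /set_mem /Ysub; exact: param_continuous.
apply: bounded_closed_compact => //.
have -> : Y = (fun y : V => N (y - u)) @^-1` [set x | x <= s] by [].
by apply: closed_comp; [move=> y _; exact: N_continuous|exact: closed_le].
Qed.

Lemma trunc_local (U : set R) (r : R -> M) t e : open U -> C1_curve S U r -> U t -> 0 < e ->
  \forall t' \near t, `|trunc (r t') - trunc (r t)| <= (speed g r t + e) * `|t' - t|.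
Proof.
move=> oU Cr Ut e0.
have [cr _] := Cr t Ut.
have [[dz Yz]|nYz] := pselect (D i (r t) /\ Y (phi i (r t))).
  have [_ nOD dr _] := C1_curveP oU Cr Ut dz.
  set v := derive1 _ _ in dr.
  have e10 : 0 < e / c by rewrite divr_gt0.
  apply: filterS2 nOD (is_derive_near_le e10 dr) => t' [Ut' dt'] h.
  rewrite /trunc !asboolT//.
  have minl (a b : R) : `|Num.min s a - Num.min s b| <= `|a - b|.
    rewrite /Num.min; case: ifP => h1; case: ifP => h2; move: (h1) (h2);
    rewrite ?ltNge => {}h1 {}h2; rewrite ?subrr ?normr0//.
      by move/negbFE: h2; move: h1; rewrite -ltNge => h1 h2; rewrite !ger0_norm; lra.
    by move/negbFE: h1; move: h2; rewrite -ltNge => h1 h2; rewrite !ler0_norm; lra.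
  apply: le_trans (minl _ _) _; apply: le_trans (N_lip _ _) _.
  have -> : phi i (r t') - u - (phi i (r t) - u) = phi i (r t') - phi i (r t).
    by rewrite opprB addrA subrK.
  have -> : phi i (r t') - phi i (r t) = (t' - t) *: v +
      (phi i (r t') - phi i (r t) - (t' - t) *: v).
    by rewrite [RHS]addrC subrK.
  apply: le_trans (ND _ _) _; rewrite NZ.
  have h1 : N v <= speed g r t by rewrite (speedE g cr dz dr); exact: Nspeed.
  have h2 := Nle (phi i (r t') - phi i (r t) - (t' - t) *: v).
  have h3 : c * `|phi i (r t') - phi i (r t) - (t' - t) *: v| <= e * `|t' - t|.
    rewrite mulrC -ler_pdivlMr//; apply: le_trans h _.
    by rewrite mulrAC.
  have h4 : `|t' - t| * N v <= `|t' - t| * speed g r t by rewrite ler_wpM2l.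
  lra.
have ts z : ~ (D i z /\ Y (phi i z)) -> trunc z = s.
  move=> nz; rewrite /trunc; case: asboolP => // dz.
  by apply/min_idPl; rewrite leNgt; apply/negP => /ltW h; apply: nz.
have nE : ~ (psi i @` Y) (r t).
  move=> [y Yy ey]; apply: nYz; rewrite -ey; split; first exact: chart_imageP (Ysub Yy).
  by rewrite paramK//; exact: Ysub.
have : \forall z \near r t, ~ (psi i @` Y) z.
  by apply: open_nbhs_nbhs; split => //; exact: closed_openC trunc_image_closed.
move=> nz; have nt' : \forall t' \near t, ~ (psi i @` Y) (r t') by exact: cr nz.
apply: filterS nt' => t' nEt'.
rewrite (ts _ nYz) ts ?subrr ?normr0.
  by rewrite mulr_ge0// addr_ge0 ?speed_ge0// ltW.
by move=> [dt' Yt']; apply: nEt'; exists (phi i (r t')) => //; rewrite coordK.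
Qed.

Lemma trunc_seg x y l : seg g x y l -> trunc y - trunc x <= l.
Proof.
move=> [a [b [r [ab [ U [F [oU abU Cr dF [ra rb ->]]]]]]]].
rewrite -ra -rb.
apply: (@dini_mean_value R (trunc \o r) F (speed g r) a b (ltW ab) dF) => t e tab e0.
by apply: trunc_local oU Cr _ e0; exact: abU.
Qed.

Lemma trunc_chain x y l : chain g x y l -> trunc y - trunc x <= l.
Proof.
elim=> {x y l}[x|x y z l m sg _ IH]; first by rewrite subrr.
have := trunc_seg sg; lra.
Qed.

Lemma trunc_dist x y : trunc y - trunc x <= d x y.
Proof.
apply/ler_addgt0Pr => e e0; have [l ch le] := dist_chain_approx g x y e0.
have := trunc_chain ch; lra.
Qed.

End truncated_norm.

(** * Norms given by Gram matrices *)

Section gram_norm.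
Variables (R : realType) (n : nat).
Local Notation V := 'rV[R]_n.
Implicit Types (A : 'M[R]_n) (v w : V).

Definition gram_norm A v := Num.sqrt (gram_form A v v).

Lemma gram_norm_ge0 A v : 0 <= gram_norm A v.
Proof. exact: sqrtr_ge0. Qed.

Lemma gram_normZ A a v : gram_norm A (a *: v) = `|a| * gram_norm A v.
Proof.
by rewrite /gram_norm gram_formZl gram_formZr mulrA -expr2 sqrtrM ?sqr_ge0// sqrtr_sqr.
Qed.

Section psd.
Variable A : 'M[R]_n.
Hypothesis Asym : A^T = A.
Hypothesis Apos : forall v, v != 0 -> 0 < gram_form A v v.

Lemma gram_form_ge0 v : 0 <= gram_form A v v.
Proof.
by have [->|/Apos/ltW//] := eqVneq v 0; rewrite gram_form0l.
Qed.

Lemma sqr_gram_norm v : gram_norm A v ^+ 2 = gram_form A v v.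
Proof. by rewrite sqr_sqrtr// gram_form_ge0. Qed.

Lemma gram_form_cs v w : gram_form A v w <= gram_norm A v * gram_norm A w.
Proof.
have [->|w0] := eqVneq w 0.
  by rewrite (gram_formC _ _ Asym) gram_form0l mulr_ge0// gram_norm_ge0.
have pw := Apos w0.
set a := gram_form A v w; set b := gram_form A w w in pw *.
have h : 0 <= gram_form A (v + (- (a / b)) *: w) (v + (- (a / b)) *: w).
  exact: gram_form_ge0.
have e : gram_form A (v + (- (a / b)) *: w) (v + (- (a / b)) *: w) =
    gram_form A v v - a ^+ 2 / b.
  rewrite gram_formDl !gram_formDr !gram_formZl !gram_formZr (gram_formC w v Asym).
  by rewrite -/a -/b; field; rewrite gt_eqF.
rewrite e subr_ge0 ler_pdivrMr// in h.
have [a0|a0] := ltP a 0.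
  by apply: (@le_trans _ _ 0); [exact: ltW|rewrite mulr_ge0// gram_norm_ge0].
rewrite -(@ler_pXn2r _ 2)// ?nnegrE// ?mulr_ge0 ?gram_norm_ge0//.
by rewrite exprMn !sqr_gram_norm.
Qed.

Lemma gram_normD v w : gram_norm A (v + w) <= gram_norm A v + gram_norm A w.
Proof.
rewrite -(@ler_pXn2r _ 2)// ?nnegrE// ?addr_ge0 ?gram_norm_ge0//.
rewrite sqr_gram_norm gram_formDl !gram_formDr (gram_formC w v Asym).
have := gram_form_cs v w; rewrite -!sqr_gram_norm => h.
nra.
Qed.

End psd.
End gram_norm.

Section tame_facts.
Variables (R : realType) (n : nat).
Local Notation V := 'rV[R]_n.
Variables (G : V -> 'M[R]_n) (DG : V -> V -> 'M[R]_n) (u0 : V) (r C : R).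
Hypothesis C1 : 1 <= C.
Hypothesis T : tame G DG u0 r C.

Lemma tame_pos u v : ball u0 r u -> v != 0 -> 0 < gram_form (G u) v v.
Proof.
move=> bu v0; have := tame_coercive T v bu.
have : 0 < `|v| ^+ 2 by rewrite exprn_gt0// normr_gt0.
have C0 : 0 < C by exact: lt_le_trans ltr01 C1.
by move=> h /(lt_le_trans h); rewrite pmulr_rgt0.
Qed.

Lemma tame_norm_ge u v : ball u0 r u -> `|v| <= C * gram_norm (G u) v.
Proof.
move=> bu; have C0 : 0 <= C by exact: le_trans ler01 C1.
rewrite -(@ler_pXn2r _ 2)// ?nnegrE// ?mulr_ge0 ?gram_norm_ge0//.
rewrite exprMn sqr_gram_norm; last by move=> w; exact: tame_pos.
apply: le_trans (tame_coercive T v bu) _.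
rewrite ler_wpM2r// ?(gram_form_ge0 (fun w => tame_pos bu))//.
by rewrite expr2 ler_peMl.
Qed.

Lemma tame_norm_le u v : ball u0 r u -> gram_norm (G u) v <= C * `|v|.
Proof.
move=> bu; have C0 : 0 <= C by exact: le_trans ler01 C1.
rewrite -(@ler_pXn2r _ 2)// ?nnegrE// ?mulr_ge0 ?gram_norm_ge0//.
rewrite exprMn sqr_gram_norm; last by move=> w; exact: tame_pos.
have := tame_bound T v v bu; rewrite -mulrA -expr2 => h.
apply: le_trans (le_trans (ler_norm _) h) _.
by rewrite ler_wpM2r ?exprn_ge0// expr2 ler_peMl.
Qed.

Lemma tame_weaken r' C' : r' <= r -> C <= C' -> tame G DG u0 r' C'.
Proof.
move=> rr CC; have sb u : ball u0 r' u -> ball u0 r u by apply: le_ball.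
split.
- by move=> u /sb bu; exact: (tame_sym T bu).
- move=> u v w /sb bu; apply: le_trans (tame_bound T v w bu) _.
  by rewrite !ler_wpM2r.
- move=> u v /sb bu; apply: le_trans (tame_coercive T v bu) _.
  by rewrite ler_wpM2r// (gram_form_ge0 (fun w => tame_pos bu)).
- move=> u u' v w /sb bu /sb bu'; apply: le_trans (tame_lipschitz T v w bu bu') _.
  by rewrite !ler_wpM2r.
- by move=> u a h h' /sb bu; exact: (tame_linear T a h h' bu).
- move=> u h v w /sb bu; apply: le_trans (tame_derive T h v w bu) _.
  by rewrite !ler_wpM2r.
- move=> u h v w /sb bu /sb bu'; apply: le_trans (tame_taylor T v w bu bu') _.
  by rewrite !ler_wpM2r// exprn_ge0.
Qed.

End tame_facts.

(** The interface to the metric arguments, in which [d] is an abstract distance. The distance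
    matches the Gram norm at one of the two points up to a quadratic error, so that over [N] steps
    of size [O(1/N)] the total error tends to 0. *)
Record riemannian_chart (R : realType) (n : nat) (M : Type) (d : M -> M -> R) (q : M)
    (phi : M -> 'rV[R]_n) (psi : 'rV[R]_n -> M) (G : 'rV[R]_n -> 'M[R]_n)
    (DG : 'rV[R]_n -> 'rV[R]_n -> 'M[R]_n) (r C : R) : Prop := RiemannianChart {
  rc_radius : 0 < r;
  rc_const : 1 <= C;
  rc_tame : tame G DG (phi q) r C;
  rc_psiK : psi (phi q) = q;
  rc_phiK : forall u, ball (phi q) r u -> phi (psi u) = u;
  rc_upper : forall u u', ball (phi q) r u -> ball (phi q) r u' ->
    d (psi u) (psi u') <= gram_norm (G u) (u' - u) + C * `|u' - u| ^+ 2;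
  rc_lower : forall u u', ball (phi q) r u -> ball (phi q) r u' ->
    gram_norm (G u) (u' - u) <= d (psi u) (psi u') + C * `|u' - u| ^+ 2;
  rc_norm : forall u u', ball (phi q) r u -> ball (phi q) r u' ->
    `|u' - u| <= C * d (psi u) (psi u');
  rc_near : forall z, d q z < r -> psi (phi z) = z /\ `|phi z - phi q| <= C * d q z }.

Section riemannian_charts.
Variables (R : realType) (n : nat) (M : topologicalType).
Variables (S : smooth_manifold R n M) (g : riemannian_metric S).
Local Notation phi i := (Defs.coord (atlas i)).
Local Notation psi i := (param (atlas i)).
Local Notation D i := (dom (atlas i)).
Local Notation V := 'rV[R]_n.
Local Notation d := (riemannian_dist g).

Lemma trunc_norm_dist (i : atlas_index S) (u : V) (N : V -> R) (c s : R) z :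
  (forall v w, N (v + w) <= N v + N w) -> (forall a v, N (a *: v) = `|a| * N v) ->
  (forall v, N v <= c * `|v|) -> 0 < c -> 0 <= s ->
  bounded_set [set y | N (y - u) <= s] ->
  [set y | N (y - u) <= s] `<=` chart_image (atlas i) ->
  (forall y w, N (y - u) <= s -> N w <= gram_norm (gram g i y) w) ->
  (if `[< D i z >] then Num.min s (N (phi i z - u)) else s) <= d (psi i u) z.
Proof.
move=> ND NZ Nle c0 s0 bY sY Nsp.
have N0 : N 0 = 0 by rewrite -(scale0r (0 : V)) NZ normr0 mul0r.
have := @trunc_dist R n M S g i u N c s ND NZ Nle c0 bY sY Nsp (psi i u) z.
rewrite {2}/trunc.
have uY : chart_image (atlas i) u by apply: sY => /=; rewrite subrr N0.
rewrite asboolT; last exact: chart_imageP.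
by rewrite paramK// subrr N0 (min_idPr s0) subr0.
Qed.

(** The upper bound is the length of a coordinate line. The lower bounds come from truncated norms:
    [|v| / C] for the Lipschitz bound, and a slightly shrunk [gram_norm (G u)] for the bound with
    quadratic error. *)
Lemma riemannian_chart_exists q : exists phi psi G DG r C,
  [/\ @riemannian_chart R n M d q phi psi G DG r C,
      {for q, continuous phi} & \forall z \near q, psi (phi z) = z].
Proof.
have [i dq] := atlas_cover S q.
have iq := chart_image_coord dq; set u0 := phi i q in iq.
have [r0 [C [r00 C1 bU T]]] := smooth_tame (@image_open _ _ _ (atlas i))
  (@gram_smooth _ _ _ _ g i) iq (manifold_dim_gt0 S) (fun u => @gram_sym _ _ _ _ g i u)
  (fun u v => @gram_pos _ _ _ _ g i u v).
have C0 : 0 < C by lra.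
pose G := gram g i.
have C4 : 1 <= C ^+ 4 by rewrite exprn_ege1.
have C40 : 0 < C ^+ 4 by lra.
have C2 : 1 <= C ^+ 2 by rewrite exprn_ege1.
have C24 : C ^+ 2 <= C ^+ 4 by apply: ler_weXn2l.
pose m := Num.min r0 1.
have m0 : 0 < m by rewrite lt_min r00 ltr01.
have mr : m <= r0 by rewrite ge_min lexx.
have m1 : m <= 1 by rewrite ge_min lexx orbT.
(* Any difference [w] of two points of the ball satisfies [C ^+ 4 * |w| <= 1 / 4], and the regions
   [N (y - u) <= N w] used below stay in the ball of radius [r0]. *)
pose r := m / (8 * C ^+ 4).
have rE : r * C ^+ 4 = m / 8 by rewrite /r; field; rewrite gt_eqF.
have r_gt0 : 0 < r by rewrite divr_gt0// mulr_gt0.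
have rm : r <= m / 8 by nra.
have rr0 : r <= r0 by lra.
have sb u : ball u0 r u -> ball u0 r0 u by apply: le_ball.
have pos u := fun bu => @tame_pos _ _ _ _ _ _ _ C1 T u ^~ bu.
have tri (u u' : V) : ball u0 r u -> ball u0 r u' -> `|u' - u| < 2 * r.
  rewrite -ball_normE /= => h1 h2.
  have -> : u' - u = (u0 - u) - (u0 - u') by apply/rowP => k; rewrite !mxE; ring.
  apply: le_lt_trans (ler_normB _ _) _; lra.
have inball (u y : V) a : ball u0 r u -> `|y - u| <= a -> a <= 3 / 8 * r0 -> ball u0 r0 y.
  rewrite -ball_normE /= => h1 h2 h3.
  have -> : u0 - y = (u0 - u) - (y - u) by apply/rowP => k; rewrite !mxE; ring.
  apply: le_lt_trans (ler_normB _ _) _; lra.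
have normN (v : V) : `|v| / C <= `|v| by rewrite ler_pdivrMr// ler_peMr.
have bounded_ball (u : V) (N : V -> R) s b : (forall y, N (y - u) <= s -> `|y - u| <= b) ->
    bounded_set [set y | N (y - u) <= s].
  move=> h; exists (`|u| + b); split; first exact: num_real.
  move=> x xb y /= /h yb; apply: ltW; apply: le_lt_trans xb.
  have {1}-> : y = u + (y - u) by rewrite addrC subrK.
  by apply: le_trans (ler_normD _ _) _; rewrite lerD2l.
have flat u s z : ball u0 r u -> 0 <= s -> C * s <= 3 / 8 * r0 ->
    (if `[< D i z >] then Num.min s (`|phi i z - u| / C) else s) <= d (psi i u) z.
  move=> bu s0 Cs.
  have h y : `|y - u| / C <= s -> `|y - u| <= C * s by rewrite ler_pdivrMr// mulrC.
  apply: (@trunc_norm_dist i u (fun v => `|v| / C) 1 s z) => //.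
  - move=> v w /=; rewrite -mulrDl; apply: ler_wpM2r; [by rewrite invr_ge0 ltW|exact: ler_normD].
  - by move=> a v; rewrite normrZ mulrA.
  - by move=> v; rewrite mul1r.
  - exact: (bounded_ball u (fun v => `|v| / C) s (C * s) h).
  - by move=> y /= /h hy; apply: bU; exact: inball bu hy Cs.
  - move=> y w /h hy; rewrite ler_pdivrMr// mulrC.
    by apply: (tame_norm_ge C1 T); exact: inball bu hy Cs.
have normle u u' : ball u0 r u -> ball u0 r u' -> `|u' - u| <= C * d (psi i u) (psi i u').
  move=> bu bu'; have tt := tri _ _ bu bu'.
  have h := @flat u (`|u' - u| / C) (psi i u') bu.
  have Iu' : chart_image (atlas i) u' by apply: bU; exact: sb.
  rewrite asboolT in h; last exact: chart_imageP.
  rewrite paramK// minxx in h.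
  rewrite mulrC -ler_pdivrMr//; apply: h; first by rewrite divr_ge0// ltW.
  rewrite mulrC divfK ?gt_eqF//; lra.
exists (phi i), (psi i), G, (fun u h => 'D_h G u), r, (C ^+ 5).
have C5 : C <= C ^+ 5 by apply: ler_eXnr.
split; [|exact: Defs.coord_continuous|]; last first.
  by apply: filterS (near_dom dq) => z dz; exact: coordK.
split => //.
- by rewrite exprn_ege1.
- exact: (tame_weaken C1 T rr0 C5).
- exact: coordK.
- by move=> u bu; rewrite paramK//; apply: bU; exact: sb.
- move=> u u' bu bu'; have tt := tri _ _ bu bu'.
  have hI (t : R) : t \in `[0, 1] -> ball u0 r (u + t *: (u' - u)) by exact: ball_line.
  have hI' (t : R) : t \in `[0, 1] -> chart_image (atlas i) (u + t *: (u' - u)).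
    by move=> /hI /sb; exact: bU.
  have [l [sg hl]] := seg_line g hI'.
  have := dist_le_chain (chain_seg sg); rewrite addrC subrK => dl.
  apply: le_trans dl _; apply: hl; last first.
    by rewrite addr_ge0 ?gram_norm_ge0// mulr_ge0 ?exprn_ge0// ltW.
  move=> t t01; have := t01; rewrite in_itv /= => /andP[t0 t1].
  have h1 := tame_lipschitz T (u' - u) (u' - u) (sb _ (hI t t01)) (sb _ bu).
  have h2 : u + t *: (u' - u) - u = t *: (u' - u) by rewrite addrAC subrr add0r.
  rewrite h2 in h1.
  have h3 := tame_norm_ge C1 T (u' - u) (sb _ bu).
  have h4 := sqr_gram_norm (fun v => @tame_pos _ _ _ _ _ _ _ C1 T u v (sb _ bu)) (u' - u).
  have h5 := le_trans (ler_norm _) h1.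
  have h6 := gram_norm_ge0 (gram g i u) (u' - u).
  rewrite normrZ ger0_norm// in h5.
  rewrite -/G in h3 h4 h5 h6 *.
  move: h5 h3 h4 h6 => {h1 h2}; set a := `|u' - u|; set X := gram_norm _ _ => h5 h3 h4 h6.
  have a0 : 0 <= a by rewrite normr_ge0.
  have h7 : C * (t * a) * a * a <= C * a * a * a.
    have -> : C * (t * a) * a * a = (C * a * a) * (t * a) by ring.
    have Caa : 0 <= C * a * a by rewrite !mulr_ge0// ltW.
    by rewrite ler_wpM2l// ler_piMl.
  have h8 : gram_form (G (u + t *: (u' - u))) (u' - u) (u' - u) <= X ^+ 2 + C * a * a * a by lra.
  apply: le_trans h8 _.
  have h9 : C * a * a * a <= 2 * X * (C ^+ 5 * a ^+ 2).
    have h10 : C * a * a * a <= (C * X) * (C * a ^+ 2).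
      have -> : C * a * a * a = a * (C * a ^+ 2) by ring.
      by rewrite ler_wpM2r// mulr_ge0 ?exprn_ge0// ltW.
    apply: le_trans h10 _.
    have -> : C * X * (C * a ^+ 2) = (X * a ^+ 2) * C ^+ 2 by ring.
    have -> : 2 * X * (C ^+ 5 * a ^+ 2) = (X * a ^+ 2) * (2 * C ^+ 5) by ring.
    rewrite ler_wpM2l ?mulr_ge0 ?exprn_ge0//.
    apply: (@le_trans _ _ (C ^+ 5)); first by apply: ler_weXn2l.
    have C50 : 0 <= C ^+ 5 by rewrite exprn_ge0// ltW.
    lra.
  have h11 : 0 <= (C ^+ 5 * a ^+ 2) ^+ 2 by rewrite exprn_ge0// mulr_ge0 ?exprn_ge0// ltW.
  have -> : (X + C ^+ 5 * a ^+ 2) ^+ 2 =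
    X ^+ 2 + 2 * X * (C ^+ 5 * a ^+ 2) + (C ^+ 5 * a ^+ 2) ^+ 2.
    by ring.
  lra.
- move=> u u' bu bu'; have tt := tri _ _ bu bu'.
  (* Where [N (y - u) <= N w], the Gram form at [y] is at least [a] times the one at [u], because
     [|y - u| <= C ^+ 2 * |w|] there. The factor [a] thus keeps [N] below the metric on this region,
     and costs only a quadratic error. *)
  set w := u' - u; pose a := 1 - C ^+ 4 * `|w|.
  have wC : C ^+ 4 * `|w| <= 1 / 4.
    have : C ^+ 4 * `|w| <= C ^+ 4 * (2 * r) by rewrite ler_wpM2l// ltW.
    have -> : C ^+ 4 * (2 * r) = 2 * (r * C ^+ 4) by ring.
    rewrite rE; lra.
  have w0 : 0 <= `|w| by [].
  have Cw0 : 0 <= C ^+ 4 * `|w| by rewrite mulr_ge0// ltW.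
  have a0 : 0 < a by rewrite /a; lra.
  have a1 : a <= 1 by rewrite /a; lra.
  have posu v := @tame_pos _ _ _ _ _ _ _ C1 T u v (sb _ bu).
  have symu := tame_sym T (sb _ bu).
  pose N v := a * gram_norm (G u) v.
  have h y : N (y - u) <= N w -> `|y - u| <= C ^+ 2 * `|w|.
    rewrite ler_pM2l// => h; apply: le_trans (tame_norm_ge C1 T _ (sb _ bu)) _.
    rewrite expr2 -mulrA ler_wpM2l ?(ltW C0)//; apply: le_trans h _.
    exact: (tame_norm_le C1 T _ (sb _ bu)).
  have C2w : C ^+ 2 * `|w| <= 3 / 8 * r0.
    apply: (@le_trans _ _ (C ^+ 4 * (2 * r))).
      by apply: ler_pM => //; [rewrite exprn_ge0// ltW|exact: ltW].
    have -> : C ^+ 4 * (2 * r) = 2 * (r * C ^+ 4) by ring.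
    rewrite rE; lra.
  have hb y : N (y - u) <= N w -> ball u0 r0 y.
    by move=> /h hy; exact: inball bu hy C2w.
  have dl : N w <= d (psi i u) (psi i u').
    have := @trunc_norm_dist i u N C (N w) (psi i u').
    have Iu' : chart_image (atlas i) u' by apply: bU; exact: sb.
    rewrite asboolT; last exact: chart_imageP.
    rewrite paramK// -/w minxx; apply => //.
    + by move=> v v'; rewrite /N -mulrDr ler_wpM2l ?(ltW a0)// gram_normD.
    + by move=> b v; rewrite /N gram_normZ mulrCA.
    + move=> v; apply: le_trans (tame_norm_le C1 T _ (sb _ bu)).
      by rewrite /N ler_piMl// gram_norm_ge0.
    + by rewrite /N mulr_ge0 ?gram_norm_ge0// ltW.
    + exact: bounded_ball h.
    + by move=> y /= /hb; exact: bU.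
    + move=> y v Ny; have by0 := hb _ Ny; have yw := h _ Ny.
      rewrite -(@ler_pXn2r _ 2)// ?nnegrE ?gram_norm_ge0//; last first.
        by rewrite /N mulr_ge0 ?gram_norm_ge0// ltW.
      rewrite /N exprMn sqr_gram_norm// sqr_gram_norm; last first.
        by move=> v'; exact: (tame_pos C1 T by0).
      have h1 := tame_lipschitz T v v (sb _ bu) by0.
      have h2 := le_trans (ler_norm _) h1.
      rewrite distrC in h2.
      have gpos := gram_form_ge0 posu v.
      have h3 : C * `|y - u| * `|v| * `|v| <= (C ^+ 4 * `|w|) * gram_form (G u) v v.
        have -> : C * `|y - u| * `|v| * `|v| = (C * `|y - u|) * `|v| ^+ 2 by ring.
        have -> : (C ^+ 4 * `|w|) * gram_form (G u) v v =
           (C * (C ^+ 2 * `|w|)) * (C * gram_form (G u) v v) by ring.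
        apply: ler_pM => //; [by rewrite mulr_ge0// ltW| |].
          by rewrite ler_wpM2l// ltW.
        exact: (tame_coercive T v (sb _ bu)).
      have h4 : a ^+ 2 * gram_form (G u) v v <= a * gram_form (G u) v v.
        by rewrite ler_wpM2r// expr2 ler_piMl// ltW.
      have h5 : a * gram_form (G u) v v =
          gram_form (G u) v v - (C ^+ 4 * `|w|) * gram_form (G u) v v.
        by rewrite /a; ring.
      rewrite -/G in h2; lra.
  have h6 : C ^+ 4 * `|w| * gram_norm (G u) w <= C ^+ 5 * `|w| ^+ 2.
    have -> : C ^+ 5 * `|w| ^+ 2 = C ^+ 4 * `|w| * (C * `|w|) by ring.
    by rewrite ler_wpM2l// (tame_norm_le C1 T _ (sb _ bu)).
  have h7 : N w = gram_norm (G u) w - C ^+ 4 * `|w| * gram_norm (G u) w by rewrite /N /a; ring.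
  lra.
- move=> u u' bu bu'; apply: le_trans (normle _ _ bu bu') _.
  by rewrite ler_wpM2r// dist_ge0.
- move=> z dz.
  (* This truncation level exceeds [r], so a point at distance less than [r] from [q] cannot lie
     outside the chart. *)
  have s0 : 0 <= 3 / 8 * r0 / C by rewrite !mulr_ge0// ?invr_ge0 ltW.
  have := @flat u0 (3 / 8 * r0 / C) z (ballxx _ r_gt0) s0.
  rewrite mulrC divfK ?gt_eqF// => /(_ (lexx _)).
  have rs : r < 3 / 8 * r0 / C.
    rewrite ltr_pdivlMr//; apply: (@le_lt_trans _ _ (r * C ^+ 4)).
      by rewrite ler_wpM2l ?(ltW r_gt0)// ler_eXnr.
    rewrite rE; lra.
  rewrite (_ : psi i u0 = q); last exact: coordK.
  case: asboolP => [dz'|_ h]; last by lra.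
  rewrite ge_min => /orP[h|h]; first by lra.
  split; first exact: coordK.
  rewrite ler_pdivrMr// in h; apply: le_trans h _.
  by rewrite mulrC ler_wpM2r// dist_ge0.
Qed.

End riemannian_charts.

(** * First variation *)

Lemma ler_sqr_nneg (R : realDomainType) (x y : R) : 0 <= x -> x <= y -> x ^+ 2 <= y ^+ 2.
Proof. by move=> x0 xy; rewrite ler_pXn2r// nnegrE// (le_trans x0). Qed.

Section first_variation.
Variables (R : realType) (n : nat) (M : Type) (d : M -> M -> R).
Local Notation V := 'rV[R]_n.
Hypothesis dxx : forall x, d x x = 0.
Hypothesis dsym : forall x y, d x y = d y x.
Hypothesis dtri : forall x y z, d x z <= d x y + d y z.
(** Minimal geodesics in the form in which they are used: points at every intermediate distance. *)
Hypothesis dmid : forall x y a, 0 <= a -> a <= d x y ->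
  exists z, d x z = a /\ d z y = d x y - a.

Lemma metric_ge0 x y : 0 <= d x y.
Proof. by have := dtri x y x; rewrite dxx (dsym y x); lra. Qed.

(** Pieces of length [h] are cut off one at a time, and the triangle inequality from both ends fixes
    all the distances. *)
Lemma geodesic_points (N : nat) (h : R) x y : 0 <= h -> d x y = N%:R * h ->
  (0 < N)%N -> exists f : nat -> M, [/\ f 0%N = x, f N = y,
    forall i, (i < N)%N -> d (f i) (f i.+1) = h &
    forall i, (i <= N)%N -> d x (f i) = i%:R * h /\ d (f i) y = (N%:R - i%:R) * h].
Proof.
move=> h0; elim: N x y => // N IH x y dxy _.
have [N0|N0] := posnP N.
  rewrite N0 mul1r in dxy; exists (fun i => if i is 0%N then x else y); rewrite N0; split => //.
    by case.
  by case=> [|[|]]//= _; rewrite ?dxx ?dxy; split; ring.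
have [||z [dxz dzy]] := @dmid x y h => //.
  by rewrite dxy -natr1 mulrDl mul1r lerDr mulr_ge0.
have dzy' : d z y = N%:R * h by rewrite dzy dxy -natr1; ring.
have [f [f0 fN fh fd]] := IH z y dzy' N0.
exists (fun i => if i is i'.+1 then f i' else x); split => //.
- by case=> [|i] iN; [rewrite f0|exact: fh].
- case=> [|i] iN; first by rewrite dxx dxy; split; ring.
  have [d1 d2] := fd i iN.
  have t1 := dtri x z (f i); have t2 := dtri x (f i) y.
  rewrite dxz d1 in t1; rewrite dxy d2 in t2.
  have e1 : N.+1%:R = N%:R + 1 :> R by rewrite natr1.
  have e2 : i.+1%:R = i%:R + 1 :> R by rewrite natr1.
  rewrite e1 in t2; rewrite e1 e2; split; last by rewrite d2; ring.
  by apply/le_anti/andP; split; lra.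
Qed.

Lemma dist_sum (f : nat -> M) N : d (f 0%N) (f N) <= \sum_(i < N) d (f i) (f i.+1).
Proof.
elim: N => [|N IH]; first by rewrite dxx big_ord0.
by rewrite big_ord_recr /=; apply: le_trans (dtri _ (f N) _) _; rewrite lerD2r.
Qed.

Variables (q : M) (phi : M -> V) (psi : V -> M) (G : V -> 'M[R]_n)
  (DG : V -> V -> 'M[R]_n) (r C : R).
Hypothesis H : riemannian_chart d q phi psi G DG r C.
Let C1 : 1 <= C := rc_const H.
Let C0 : 0 < C := lt_le_trans ltr01 C1.
Let r0 : 0 < r := rc_radius H.
Let T := rc_tame H.

Definition linear_form (P : V -> R) := forall a v w, P (a *: v + w) = a * P v + P w.

Lemma rc_inner z e : d q z < r -> C * d q z + e <= r -> forall v, `|v| < e ->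
  ball (phi q) r (phi z + v).
Proof.
move=> dz h v ve; rewrite -ball_normE /=.
have -> : phi q - (phi z + v) = (- v) - (phi z - phi q) by apply/rowP => k; rewrite !mxE; ring.
have [_ hz] := rc_near H dz.
apply: le_lt_trans (ler_normB _ _) _; rewrite normrN; lra.
Qed.

Lemma gram_formZm a (A : 'M[R]_n) (v w : V) : gram_form (a *: A) v w = a * gram_form A v w.
Proof. by rewrite /gram_form -scalemxAr -scalemxAl mxE. Qed.

Lemma gram_formDm (A B : 'M[R]_n) (v w : V) :
  gram_form (A + B) v w = gram_form A v w + gram_form B v w.
Proof. by rewrite /gram_form mulmxDr mulmxDl mxE. Qed.

(* AM-GM linearises the length of one varied step: [sqrt A <= A / (2 h) + h / 2]. *)
Lemma varied_step (u u' v : V) (eta h N : R) : 0 < h -> 0 < N -> 0 <= eta -> eta <= 1 ->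
  ball (phi q) r u -> ball (phi q) r u' -> ball (phi q) r (u + eta *: v) ->
  ball (phi q) r (u' + (eta + N^-1) *: v) -> d (psi u) (psi u') = h ->
  d (psi (u + eta *: v)) (psi (u' + (eta + N^-1) *: v)) <=
    h + (2 * gram_form (G u) (u' - u) (N^-1 *: v)
         + gram_form (DG u (eta *: v)) (u' - u) (u' - u)) / (2 * h)
    + (C ^+ 3 * h ^+ 2 + C ^+ 6 * h ^+ 3 / 2 + C ^+ 3 * `|v| ^+ 2 * h / 2
       + C ^+ 2 * `|v| ^+ 2 / N + C * `|v| ^+ 2 / (2 * N ^+ 2 * h)
       + C * (C * h + `|v| / N) ^+ 2).
Proof.
move=> h0 N0 eta0 eta1 bu bu' bx bx' dh.
set w := u' - u; set x := u + eta *: v in bx *; set v' := N^-1 *: v; set b := `|v|.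
have b0 : 0 <= b by exact: normr_ge0.
have xx : u' + (eta + N^-1) *: v - x = w + v'.
  by apply/rowP => k; rewrite /x /w /v' !mxE; ring.
have up := rc_upper H bx bx'; rewrite xx in up.
apply: le_trans up _.
have wC : `|w| <= C * h by rewrite -dh; exact: (rc_norm H bu bu').
have w0 : 0 <= `|w| by [].
have v'E : `|v'| = b / N by rewrite /v' normrZ gtr0_norm ?invr_gt0// mulrC.
have low := rc_lower H bu bu'; rewrite -/w dh in low.
have posu v1 := @tame_pos _ _ _ _ _ _ _ C1 T u v1 bu.
have posx v1 := @tame_pos _ _ _ _ _ _ _ C1 T x v1 bx.
have sw := sqr_gram_norm posu w.
have gw0 := gram_norm_ge0 (G u) w.
have sx := sqr_gram_norm posx (w + v').
set A := gram_norm (G x) (w + v') in sx *.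
have amgm : A <= A ^+ 2 / (2 * h) + h / 2.
  rewrite -subr_ge0.
  have -> : A ^+ 2 / (2 * h) + h / 2 - A = (A - h) ^+ 2 / (2 * h).
    by field; rewrite gt_eqF.
  by rewrite divr_ge0 ?sqr_ge0// mulr_ge0// ltW.
have sq : `|w + v'| ^+ 2 <= (C * h + b / N) ^+ 2.
  apply: ler_sqr_nneg => //.
  by apply: le_trans (ler_normD _ _) _; rewrite v'E lerD2r.
have sq' : C * `|w + v'| ^+ 2 <= C * (C * h + b / N) ^+ 2 by rewrite ler_wpM2l// ltW.
suff A2 : A ^+ 2 <= h ^+ 2 + (2 * gram_form (G u) w v' + gram_form (DG u (eta *: v)) w w)
   + (2 * h) * (C ^+ 3 * h ^+ 2 + C ^+ 6 * h ^+ 3 / 2 + C ^+ 3 * b ^+ 2 * h / 2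
       + C ^+ 2 * b ^+ 2 / N + C * b ^+ 2 / (2 * N ^+ 2 * h)).
  have A3 : A ^+ 2 / (2 * h) <=
   (h ^+ 2 + (2 * gram_form (G u) w v' + gram_form (DG u (eta *: v)) w w)
   + (2 * h) * (C ^+ 3 * h ^+ 2 + C ^+ 6 * h ^+ 3 / 2 + C ^+ 3 * b ^+ 2 * h / 2
       + C ^+ 2 * b ^+ 2 / N + C * b ^+ 2 / (2 * N ^+ 2 * h))) / (2 * h).
    by rewrite ler_wpM2r// invr_ge0 mulr_ge0// ltW.
  set X := (2 * gram_form (G u) w v' + gram_form (DG u (eta *: v)) w w) in A3 *.
  set Y := (C ^+ 3 * h ^+ 2 + C ^+ 6 * h ^+ 3 / 2 + C ^+ 3 * b ^+ 2 * h / 2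
       + C ^+ 2 * b ^+ 2 / N + C * b ^+ 2 / (2 * N ^+ 2 * h)) in A3 *.
  have e : (h ^+ 2 + X + 2 * h * Y) / (2 * h) = h / 2 + X / (2 * h) + Y.
    by field; rewrite gt_eqF.
  rewrite e in A3; lra.
clearbody w.
(* The [(w, w)] part is treated by the Taylor bound and the mixed part by the Lipschitz bound, both
   to move the Gram matrix from [x] to [u]; for the [(v', v')] part the plain bound suffices. *)
rewrite sx gram_formDl !gram_formDr (gram_formC v' w (tame_sym T bx)).
have etav : `|eta *: v| <= b by rewrite normrZ ger0_norm// ler_piMl.
have t1 := le_trans (ler_norm _) (tame_taylor T w w bu bx).
have t2 := le_trans (ler_norm _) (tame_lipschitz T w v' bx bu).
have t3 := le_trans (ler_norm _) (tame_bound T v' v' bx).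
rewrite v'E in t2 t3; rewrite (_ : x - u = eta *: v) in t2; last by rewrite /x addrC addKr.
have m1 : C * `|eta *: v| ^+ 2 * `|w| * `|w| <= C * b ^+ 2 * (C * h) * (C * h).
  have Cb : C * `|eta *: v| ^+ 2 <= C * b ^+ 2.
    by rewrite ler_wpM2l ?(ltW C0)// ler_sqr_nneg.
  have p1 : 0 <= C * `|eta *: v| ^+ 2 by rewrite mulr_ge0 ?exprn_ge0// ltW.
  apply: ler_pM => //; first by rewrite mulr_ge0.
  exact: ler_pM.
have m2 : C * `|eta *: v| * `|w| * (b / N) <= C * b * (C * h) * (b / N).
  have bN : 0 <= b / N by rewrite divr_ge0// ltW.
  rewrite ler_wpM2r//; apply: ler_pM => //; first by rewrite mulr_ge0// ltW.
  by rewrite ler_wpM2l// ltW.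
(* By [rc_lower] the Gram norm of the unvaried step exceeds its length [h] by at most
   [C ^+ 3 * h ^+ 2]. *)
have m3 : gram_form (G u) w w <= h ^+ 2 + 2 * h * (C ^+ 3 * h ^+ 2) + C ^+ 6 * h ^+ 4.
  rewrite -sw.
  have w2 : C * `|w| ^+ 2 <= C ^+ 3 * h ^+ 2.
    have -> : C ^+ 3 * h ^+ 2 = C * (C * h) ^+ 2 by ring.
    by rewrite ler_wpM2l ?(ltW C0)// ler_sqr_nneg.
  have gl : gram_norm (G u) w <= h + C ^+ 3 * h ^+ 2 by lra.
  have gl2 : gram_norm (G u) w ^+ 2 <= (h + C ^+ 3 * h ^+ 2) ^+ 2.
    exact: ler_sqr_nneg.
  have e : (h + C ^+ 3 * h ^+ 2) ^+ 2 =
    h ^+ 2 + 2 * h * (C ^+ 3 * h ^+ 2) + C ^+ 6 * h ^+ 4 by ring.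
  by rewrite e in gl2.
have e : (2 * h) * (C ^+ 3 * h ^+ 2 + C ^+ 6 * h ^+ 3 / 2 + C ^+ 3 * b ^+ 2 * h / 2
       + C ^+ 2 * b ^+ 2 / N + C * b ^+ 2 / (2 * N ^+ 2 * h)) =
  2 * h * (C ^+ 3 * h ^+ 2) + C ^+ 6 * h ^+ 4 + C * b ^+ 2 * (C * h) * (C * h)
  + 2 * (C * b * (C * h) * (b / N)) + C * (b / N) * (b / N).
  by field; rewrite !gt_eqF.
rewrite e; lra.
Qed.

Lemma sum_cst (N : nat) (a : R) : \sum_(i < N) a = N%:R * a.
Proof. by rewrite sumr_const card_ord mulr_natl. Qed.

(** Dominates the error coefficients left after adding up [N] varied steps, as well as those in the
    comparison of the linear form with the Gram form. *)
Definition fv_const := 3 * C ^+ 6 + C * (C + 1) ^+ 2 + 2 * C ^+ 3 + C ^+ 2 + C.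

(** A minimal geodesic between two points within [fv_radius] of [q] stays within [3 * fv_radius].
    The factor [8 * C] keeps its coordinates and their variations inside the chart ball, and the
    minimum with 1 keeps its length below 1. *)
Definition fv_radius := Num.min 1 r / (8 * C).

Lemma fv_radius_gt0 : 0 < fv_radius.
Proof. by rewrite divr_gt0 ?mulr_gt0// lt_min ltr01. Qed.

(** The [i]-th of the points is moved by [(i / N) v], so the start stays fixed and the end moves by
    [v]; [P] is the sum of the linear parts of the steps. The increments telescope to
    [phi z - phi o], and replacing the Gram matrices along the chain by the one at [z] costs an
    error proportional to [d o z]. *)
Lemma first_variation_approx (o z : M) (N : nat) : (0 < N)%N ->
  d q o < fv_radius -> d q z < fv_radius -> 0 < d o z ->
  exists P, [/\ linear_form P,
    forall v, `|v| < fv_radius -> d o (psi (phi z + v)) <=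
      d o z + P v + fv_const * `|v| ^+ 2 / d o z + fv_const / N%:R &
    forall v, `|P v - gram_form (G (phi z)) (phi z - phi o) v / d o z|
      <= fv_const * d o z * `|v|].
Proof.
move=> N0 dqo dqz l0; set l := d o z in l0 *.
have NR0 : 0 < N%:R :> R by rewrite ltr0n.
pose h := l / N%:R.
have h0 : 0 < h by rewrite divr_gt0.
have lNh : l = N%:R * h by rewrite /h mulrC divfK// gt_eqF.
have [f [f0 fN fh fd]] := geodesic_points (ltW h0) lNh N0.
have rhoE : 8 * C * fv_radius = Num.min 1 r by rewrite /fv_radius mulrC divfK// gt_eqF// mulr_gt0.
have m1 : Num.min 1 r <= 1 by rewrite ge_min lexx.
have mr : Num.min 1 r <= r by rewrite ge_min lexx orbT.
have rho0 := fv_radius_gt0.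
have rhoC : fv_radius <= C * fv_radius by rewrite ler_peMl// ltW.
have l2 : l < 2 * fv_radius.
  by have := dtri o q z; rewrite (dsym o q) -/l; lra.
have l1 : l <= 1 by lra.
have near3 i : (i <= N)%N -> d q (f i) < 3 * fv_radius.
  move=> iN; have [d1 d2] := fd i iN.
  have : d o (f i) <= l.
    by rewrite d1 lNh ler_wpM2r ?ler_nat// ltW.
  have := dtri q o (f i); lra.
have nearr i : (i <= N)%N -> d q (f i) < r by move=> /near3; lra.
have psif i : (i <= N)%N -> psi (phi (f i)) = f i.
  by move=> iN; have [] := rc_near H (nearr i iN).
have inb i v : (i <= N)%N -> `|v| < fv_radius -> ball (phi q) r (phi (f i) + v).
  move=> iN vr; apply: (@rc_inner (f i) fv_radius (nearr i iN)) => //.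
  have : C * d q (f i) <= C * (3 * fv_radius) by rewrite ler_wpM2l ?(ltW C0)// ltW// near3.
  lra.
have inb0 i : (i <= N)%N -> ball (phi q) r (phi (f i)).
  by move=> iN; have := inb i 0 iN; rewrite normr0 addr0; apply.
pose w i := phi (f i.+1) - phi (f i).
pose L i v := (2 * gram_form (G (phi (f i))) (w i) (N%:R^-1 *: v)
         + gram_form (DG (phi (f i)) ((i%:R / N%:R) *: v)) (w i) (w i)) / (2 * h).
pose P v := \sum_(i < N) L i v.
have wC i : (i < N)%N -> `|w i| <= C * h.
  move=> iN; have := rc_norm H (inb0 _ (ltnW iN)) (inb0 _ iN).
  by rewrite !psif ?fh// ltnW.
exists P; split.
- move=> a v v'; rewrite /P mulr_sumr -big_split; apply: eq_bigr => i _ /=.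
  have bi := inb0 i (ltnW (ltn_ord i)).
  have e1 : N%:R^-1 *: (a *: v + v') = a *: (N%:R^-1 *: v) + N%:R^-1 *: v'.
    by rewrite scalerDr !scalerA mulrC.
  rewrite /L e1 gram_formDr [in LHS]gram_formZr.
  have -> : (i%:R / N%:R) *: (a *: v + v') = a *: ((i%:R / N%:R) *: v) + (i%:R / N%:R) *: v'.
    by rewrite scalerDr !scalerA mulrC.
  rewrite (tame_linear T _ _ _ bi) gram_formDm gram_formZm; field.
  by rewrite gt_eqF.
- move=> v vr.
  pose x i := psi (phi (f i) + (i%:R / N%:R) *: v).
  have x0 : x 0%N = o by rewrite /x mul0r scale0r addr0 psif// f0.
  have xN : x N = psi (phi z + v) by rewrite /x divff ?gt_eqF// scale1r fN.
  have eta01 i : (i <= N)%N -> 0 <= i%:R / N%:R :> R /\ i%:R / N%:R <= 1 :> R.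
    move=> iN; split; first by rewrite divr_ge0.
    by rewrite ler_pdivrMr// mul1r ler_nat.
  have etav i : (i <= N)%N -> `|(i%:R / N%:R) *: v| < fv_radius.
    move=> iN; have [e0 e1] := eta01 i iN; rewrite normrZ ger0_norm//.
    by apply: le_lt_trans vr; rewrite ler_piMl.
  rewrite -x0 -xN; apply: le_trans (dist_sum x N) _.
  set Q := (C ^+ 3 * h ^+ 2 + C ^+ 6 * h ^+ 3 / 2 + C ^+ 3 * `|v| ^+ 2 * h / 2
       + C ^+ 2 * `|v| ^+ 2 / N%:R + C * `|v| ^+ 2 / (2 * N%:R ^+ 2 * h)
       + C * (C * h + `|v| / N%:R) ^+ 2).
  have step (i : 'I_N) : d (x i) (x i.+1) <= h + L i v + Q.
    have iN := ltnW (ltn_ord i); have [e0 e1] := eta01 i iN.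
    have ei : i.+1%:R / N%:R = i%:R / N%:R + N%:R^-1 :> R.
      by rewrite -natr1 mulrDl mul1r.
    rewrite /x ei; apply: varied_step => //.
    + exact: inb0.
    + exact: inb0.
    + by apply: inb => //; exact: etav.
    + by rewrite -ei; apply: inb => //; exact: etav.
    + by rewrite !psif// fh.
  apply: le_trans (ler_sum _ (fun i _ => step i)) _.
  rewrite big_split /= big_split /= !sum_cst -lNh -/(P v).
  suff QQ : N%:R * Q <= fv_const * `|v| ^+ 2 / l + fv_const / N%:R by lra.
  set b := `|v|; have b0 : 0 <= b by exact: normr_ge0.
  have b1 : b <= 1 by rewrite /b; lra.
  have -> : N%:R * Q = C ^+ 3 * l ^+ 2 / N%:R + C ^+ 6 * l ^+ 3 / (2 * N%:R) / N%:R
    + b ^+ 2 * (C ^+ 3 * l / 2 + C ^+ 2 + C / (2 * l)) + C * (C * l + b) ^+ 2 / N%:R.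
    by rewrite /Q /h -/b; field; rewrite !gt_eqF.
  have N1 : 1 <= N%:R :> R by rewrite ler1n.
  have Cn k : 0 <= C ^+ k by rewrite exprn_ge0// ltW.
  have ll2 : l ^+ 2 <= 1 by rewrite expr_le1// ltW.
  have ll3 : l ^+ 3 <= 1 by rewrite expr_le1// ltW.
  have i1 : C ^+ 3 * l ^+ 2 / N%:R <= C ^+ 3 / N%:R.
    by rewrite ler_wpM2r ?invr_ge0 ?(ltW NR0)// ler_piMr.
  have i2 : C ^+ 6 * l ^+ 3 / (2 * N%:R) / N%:R <= C ^+ 6 / N%:R.
    rewrite ler_wpM2r ?invr_ge0 ?(ltW NR0)// ler_pdivrMr ?mulr_gt0//.
    rewrite ler_wpM2l ?Cn//; lra.
  have i3 : C * (C * l + b) ^+ 2 / N%:R <= C * (C + 1) ^+ 2 / N%:R.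
    rewrite ler_wpM2r ?invr_ge0 ?(ltW NR0)// ler_wpM2l ?(ltW C0)//.
    have Cl : C * l <= C by rewrite ler_piMr// ltW.
    have Cl0 : 0 <= C * l by rewrite mulr_ge0// ltW.
    by apply: ler_sqr_nneg; lra.
  have i4 : C ^+ 3 * l / 2 + C ^+ 2 + C / (2 * l) <= (C ^+ 3 + C ^+ 2 + C) / l.
    rewrite ler_pdivlMr//.
    have -> : (C ^+ 3 * l / 2 + C ^+ 2 + C / (2 * l)) * l =
      C ^+ 3 * l ^+ 2 / 2 + C ^+ 2 * l + C / 2.
      by field; rewrite gt_eqF.
    have j1 : C ^+ 3 * l ^+ 2 <= C ^+ 3 by rewrite ler_piMr.
    have j2 : C ^+ 2 * l <= C ^+ 2 by rewrite ler_piMr.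
    have j3 := Cn 3%N; have j4 := C0; lra.
  have i5 : b ^+ 2 * (C ^+ 3 * l / 2 + C ^+ 2 + C / (2 * l)) <= fv_const * b ^+ 2 / l.
    have -> : fv_const * b ^+ 2 / l = b ^+ 2 * (fv_const / l) by rewrite mulrAC mulrC.
    rewrite ler_wpM2l ?exprn_ge0//; apply: le_trans i4 _.
    rewrite ler_wpM2r ?invr_ge0 ?(ltW l0)// /fv_const.
    have j1 := Cn 6%N; have j2 := Cn 3%N.
    have j3 : 0 <= C * (C + 1) ^+ 2 by rewrite mulr_ge0 ?sqr_ge0// ltW.
    lra.
  have i6 : C ^+ 3 / N%:R + C ^+ 6 / N%:R + C * (C + 1) ^+ 2 / N%:R <= fv_const / N%:R.
    rewrite -!mulrDl ler_wpM2r ?invr_ge0 ?(ltW NR0)// /fv_const.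
    have j1 := Cn 6%N; have j2 := Cn 3%N; have j4 := Cn 2%N; have j5 := C0; lra.
  lra.
- move=> v; set b := `|v|; have b0 : 0 <= b by exact: normr_ge0.
  have bz := inb0 N (leqnn N); rewrite fN in bz.
  have -> : P v = \sum_(i < N) (gram_form (G (phi (f i))) (w i) v / l +
     gram_form (DG (phi (f i)) ((i%:R / N%:R) *: v)) (w i) (w i) / (2 * h)).
    apply: eq_bigr => i _; rewrite /L mulrDl gram_formZr; congr (_ + _).
    by rewrite /h; field; rewrite !gt_eqF.
  have -> : phi z - phi o = \sum_(i < N) w i.
    rewrite -fN -f0 /w.
    have := telescope_sumr (fun i => phi (f i)) (leq0n N).
    by rewrite big_mkord => <-.
  have gsum (A : 'M[R]_n) (m : nat) :
      gram_form A (\sum_(i < m) w i) v = \sum_(i < m) gram_form A (w i) v.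
    elim: m => [|m IH]; first by rewrite !big_ord0 gram_form0l.
    by rewrite !big_ord_recr /= gram_formDl IH.
  rewrite gsum mulr_suml -sumrB.
  apply: le_trans (ler_norm_sum _ _ _) _.
  have -> : fv_const * l * b = \sum_(i < N) (fv_const * h * b).
    by rewrite sum_cst lNh; ring.
  apply: ler_sum => i _.
  have iN := ltnW (ltn_ord i); have bi := inb0 i iN.
  have -> : gram_form (G (phi (f i))) (w i) v / l +
     gram_form (DG (phi (f i)) ((i%:R / N%:R) *: v)) (w i) (w i) / (2 * h) -
     gram_form (G (phi z)) (w i) v / l =
     (gram_form (G (phi (f i))) (w i) v - gram_form (G (phi z)) (w i) v) / l +
     gram_form (DG (phi (f i)) ((i%:R / N%:R) *: v)) (w i) (w i) / (2 * h) by ring.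
  apply: le_trans (ler_normD _ _) _.
  rewrite !normrM !normfV (gtr0_norm l0) (gtr0_norm (mulr_gt0 (@ltr0n R 2) h0)).
  have Cn k : 0 <= C ^+ k by rewrite exprn_ge0// ltW.
  have k1 :
      `|gram_form (G (phi (f i))) (w i) v - gram_form (G (phi z)) (w i) v| <= C ^+ 3 * l * h * b.
    apply: le_trans (tame_lipschitz T (w i) v bi bz) _.
    have uz : `|phi (f i) - phi z| <= C * l.
      have := rc_norm H bz bi; rewrite psif//.
      have -> : psi (phi z) = z by rewrite -fN psif.
      move/le_trans; apply; rewrite ler_wpM2l ?(ltW C0)//.
      rewrite dsym; have [_ ->] := fd i iN.
      by rewrite lNh ler_wpM2r ?(ltW h0)// gerBl.
    have -> : C ^+ 3 * l * h * b = C * (C * l) * (C * h) * b by ring.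
    rewrite ler_wpM2r//; apply: ler_pM => //; first by rewrite mulr_ge0// ltW.
      by rewrite ler_wpM2l// ltW.
    exact: wC.
  have k2 : `|gram_form (DG (phi (f i)) ((i%:R / N%:R) *: v)) (w i) (w i)| <= C ^+ 3 * b * h ^+ 2.
    apply: le_trans (tame_derive T _ _ _ bi) _.
    have eb : `|(i%:R / N%:R) *: v| <= b.
      rewrite normrZ ger0_norm ?divr_ge0// ler_piMl//.
      by rewrite ler_pdivrMr// mul1r ler_nat.
    have -> : C ^+ 3 * b * h ^+ 2 = C * b * (C * h) * (C * h) by ring.
    have p0 : 0 <= C * `|(i%:R / N%:R) *: v| by rewrite mulr_ge0// ltW.
    apply: ler_pM => //; [by rewrite mulr_ge0| |exact: wC].
    apply: ler_pM => //; last exact: wC.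
    by rewrite ler_wpM2l// ltW.
  have k3 :
      `|gram_form (G (phi (f i))) (w i) v - gram_form (G (phi z)) (w i) v| / l <= C ^+ 3 * h * b.
    rewrite ler_pdivrMr//; apply: le_trans k1 _.
    by rewrite le_eqVlt; apply/orP; left; apply/eqP; ring.
  have k4 :
      `|gram_form (DG (phi (f i)) ((i%:R / N%:R) *: v)) (w i) (w i)| / (2 * h) <= C ^+ 3 * h * b.
    have h20 : 0 < 2 * h by rewrite mulr_gt0.
    rewrite ler_pdivrMr//; apply: le_trans k2 _.
    have -> : C ^+ 3 * h * b * (2 * h) = C ^+ 3 * b * h ^+ 2 + C ^+ 3 * b * h ^+ 2 by ring.
    by rewrite lerDl !mulr_ge0// ?exprn_ge0// ltW.
  have k5 : C ^+ 3 * h * b + C ^+ 3 * h * b <= fv_const * h * b.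
    rewrite -!mulrDl !ler_wpM2r// ?(ltW h0)// /fv_const.
    have j1 := Cn 6%N; have j3 := Cn 2%N.
    have j4 : 0 <= C * (C + 1) ^+ 2 by rewrite mulr_ge0 ?sqr_ge0// ltW.
    have j5 := C0; lra.
  lra.
Qed.

End first_variation.

Section first_variation_limit.
Variables (R : realType) (n : nat).
Local Notation V := 'rV[R]_n.

Lemma linear_form0 (P : V -> R) : linear_form P -> P 0 = 0.
Proof.
move=> hP; have := hP 1 0 0; rewrite scaler0 add0r mul1r => h.
by apply: (addrI (P 0)); rewrite -h addr0.
Qed.

Lemma linear_formZ (P : V -> R) a v : linear_form P -> P (a *: v) = a * P v.
Proof. by move=> hP; have := hP a v 0; rewrite linear_form0// !addr0. Qed.

Lemma linear_formD (P : V -> R) v w : linear_form P -> P (v + w) = P v + P w.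
Proof. by move=> hP; have := hP 1 v w; rewrite scale1r mul1r. Qed.

Lemma linear_formN (P : V -> R) v : linear_form P -> P (- v) = - P v.
Proof. by move=> hP; rewrite -scaleN1r linear_formZ// mulN1r. Qed.

Definition row_pairing (p v : V) : R := \sum_k v ord0 k * p ord0 k.

Lemma row_pairing_linear p : linear_form (row_pairing p).
Proof.
move=> a v w; rewrite /row_pairing mulr_sumr -big_split; apply: eq_bigr => k _ /=.
by rewrite !mxE; ring.
Qed.

Lemma row_pairing_le p v : `|row_pairing p v| <= n%:R * `|p| * `|v|.
Proof.
rewrite /row_pairing; apply: le_trans (ler_norm_sum _ _ _) _.
rewrite -mulrA -sum_cst; apply: ler_sum => k _; rewrite normrM mulrC.
by apply: ler_pM => //; exact: mx_norm_ge.
Qed.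

Lemma row_pairingB p p' v : row_pairing (p - p') v = row_pairing p v - row_pairing p' v.
Proof.
by rewrite /row_pairing -sumrB; apply: eq_bigr => k _; rewrite !mxE; ring.
Qed.

Lemma linear_form_pairing (P : V -> R) : linear_form P ->
  P = row_pairing (\row_k P (delta_mx ord0 k)).
Proof.
move=> hP; apply/funext => v; rewrite {1}(row_sum_delta v) /row_pairing.
have Psum (m : nat) (f : 'I_m -> V) : P (\sum_k f k) = \sum_k P (f k).
  elim: m f => [|m IH] f; first by rewrite !big_ord0 linear_form0.
  by rewrite !big_ord_recr /= linear_formD// IH.
by rewrite Psum; apply: eq_bigr => k _; rewrite linear_formZ// mxE.
Qed.

(** The coefficient rows are bounded, and [Q] is given by a cluster point of them. It is approached
    by arbitrarily late terms, hence the index past any given [N0]. *)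
Lemma linear_form_limit (P : nat -> V -> R) (c : V -> R) :
  (forall N, linear_form (P N)) -> (forall N v, `|P N v| <= c v) ->
  exists Q, linear_form Q /\ forall v e (N0 : nat), 0 < e ->
    exists N, (N0 <= N)%N /\ `|P N v - Q v| <= e.
Proof.
move=> lP bP.
pose p N : V := \row_k P N (delta_mx ord0 k).
pose B := \sum_k c (delta_mx ord0 k).
have c0 v : 0 <= c v by apply: le_trans (bP 0%N v).
have B0 : 0 <= B by apply: sumr_ge0.
have pB N : `|p N| <= B.
  apply: mx_norm_le => // i j; rewrite mxE; apply: le_trans (bP _ _) _.
  by rewrite /B (bigD1 j)//= lerDl sumr_ge0.
have cA : compact [set x : V | `|x| <= B].
  apply: bounded_closed_compact.
  - by exists B; split; [exact: num_real|move=> x Bx y /= yB; apply: le_trans yB (ltW Bx)].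
  - have -> : [set x : V | `|x| <= B] = (fun x : V => `|x|) @^-1` [set x | x <= B] by [].
    by apply: closed_comp; [move=> x _; exact: norm_continuous|exact: closed_le].
have FA : (p @ \oo) [set x : V | `|x| <= B].
  by exists 0%N => // N _; exact: pB.
have [x [_ clx]] := cA (p @ \oo) _ FA.
exists (row_pairing x); split; first exact: row_pairing_linear.
move=> v e N0 e0.
pose e' := e / (n%:R * `|v| + 1).
have nv0 : 0 <= n%:R * `|v| by rewrite mulr_ge0.
have nv : 0 < n%:R * `|v| + 1 by lra.
have e'0 : 0 < e' by rewrite divr_gt0.
have F1 : (p @ \oo) [set y | exists2 N, (N0 <= N)%N & y = p N].
  by exists N0 => // N /= hN; exists N.
have [y [[N hN ->] ye]] := clx _ _ F1 (nbhsx_ballx x e' e'0).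
exists N; split => //.
rewrite (linear_form_pairing (lP N)) -/(p N) -row_pairingB.
apply: le_trans (row_pairing_le _ _) _.
have xp : `|p N - x| <= e' by rewrite distrC ltW//; move: ye; rewrite -ball_normE.
have -> : n%:R * `|p N - x| * `|v| = (n%:R * `|v|) * `|p N - x| by ring.
apply: (@le_trans _ _ ((n%:R * `|v|) * e')); first by rewrite ler_wpM2l.
rewrite /e' mulrA ler_pdivrMr// mulrC ler_wpM2l ?(ltW e0)//; lra.
Qed.

Variables (M : Type) (d : M -> M -> R).
Hypothesis dxx : forall x, d x x = 0.
Hypothesis dsym : forall x y, d x y = d y x.
Hypothesis dtri : forall x y z, d x z <= d x y + d y z.
Hypothesis dmid : forall x y a, 0 <= a -> a <= d x y ->
  exists z, d x z = a /\ d z y = d x y - a.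
Variables (q : M) (phi : M -> V) (psi : V -> M) (G : V -> 'M[R]_n)
  (DG : V -> V -> 'M[R]_n) (r C : R).
Hypothesis H : riemannian_chart d q phi psi G DG r C.
Local Notation rho := (fv_radius r C).
Local Notation K := (fv_const C).

(** With ever finer chains the error [K / N] disappears, all other bounds being uniform in [N]. *)
Lemma first_variation (o z : M) : d q o < rho -> d q z < rho -> 0 < d o z ->
  exists P, [/\ linear_form P,
    forall v, `|v| < rho ->
      d o (psi (phi z + v)) <= d o z + P v + K * `|v| ^+ 2 / d o z &
    forall v, `|P v - gram_form (G (phi z)) (phi z - phi o) v / d o z|
      <= K * d o z * `|v|].
Proof.
move=> qo qz l0.
pose F N := cid (first_variation_approx dxx dsym dtri dmid H (ltn0Sn N) qo qz l0).
pose P N := projT1 (F N).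
have PL N : linear_form (P N) by rewrite /P; case: (F N) => ? [].
have P1 N v : `|v| < rho -> d o (psi (phi z + v)) <=
      d o z + P N v + K * `|v| ^+ 2 / d o z + K / N.+1%:R.
  by rewrite /P; case: (F N) => ? [_ + _] /=; apply.
have P2 N v : `|P N v - gram_form (G (phi z)) (phi z - phi o) v / d o z|
      <= K * d o z * `|v|.
  by rewrite /P; case: (F N) => ? [_ _ +] /=; apply.
have PB N v : `|P N v| <= `|gram_form (G (phi z)) (phi z - phi o) v / d o z| + K * d o z * `|v|.
  have := P2 N v; rewrite !ler_norml => /andP[h1 h2].
  have := ler_norm (gram_form (G (phi z)) (phi z - phi o) v / d o z).
  have := lerNnormlW (lexx `|gram_form (G (phi z)) (phi z - phi o) v / d o z|).
  by move=> h3 h4; apply/andP; split; lra.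
have [Q [QL hQ]] := linear_form_limit PL PB.
exists Q; split => //.
- move=> v vr; apply/ler_addgt0Pr => e e0.
  have e20 : 0 < e / 2 by lra.
  have [N0 hN0] : exists N0 : nat, K / (e / 2) < N0%:R.
    by exists (Num.trunc (K / (e / 2))).+1; exact: truncnS_gt.
  have [N [NN0 hN]] := hQ v (e / 2) N0 e20.
  have h1 := P1 N v vr.
  have h2 : K / N.+1%:R <= e / 2.
    rewrite ler_pdivrMr ?ltr0n// mulrC -ler_pdivrMr//.
    by apply: le_trans (ltW hN0) _; rewrite ler_nat ltnW.
  move: hN h1 h2; rewrite ler_norml => /andP[h3 h4].
  set y := K / N.+1%:R; set y' := K * _ / _; set y'' := d _ _ => h1 h2.
  lra.
- move=> v; apply/ler_addgt0Pr => e e0.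
  have [N [_ hN]] := hQ v e 0%N e0.
  have h1 := P2 N v.
  move: hN h1; rewrite !ler_norml => /andP[h1 h2] /andP[h3 h4]; apply/andP; split; lra.
Qed.

End first_variation_limit.

(** * Nonbranching *)

Section nonbranching.
Variables (R : realType) (n : nat).
Local Notation V := 'rV[R]_n.

(** At [t *: v] with small [t] the quadratic bound is of lower order than [L], which gives one sign;
    [- v] gives the other. *)
Lemma linear_form_ge_quadratic (L : V -> R) (rho c : R) : linear_form L -> 0 < rho ->
  (forall v, `|v| < rho -> - (c * `|v| ^+ 2) <= L v) -> forall v, L v = 0.
Proof.
move=> lL rho0 hL.
suff h v : 0 <= L v.
  move=> v; apply/le_anti/andP; split; last exact: h.
  by have := h (- v); rewrite linear_formN// oppr_ge0.
apply/ler_addgt0Pr => e e0; rewrite -lerBlDr sub0r.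
pose t1 := rho / (2 * (`|v| + 1)); pose t2 := e / (`|c| * `|v| ^+ 2 + 1).
have v0 : 0 <= `|v| by [].
have cv0 : 0 <= `|c| * `|v| ^+ 2 by rewrite mulr_ge0// exprn_ge0.
pose t := Num.min t1 t2.
have t0 : 0 < t.
  rewrite lt_min; apply/andP; split; apply: divr_gt0; lra.
have tt1 : t <= t1 by rewrite ge_min lexx.
have tt2 : t <= t2 by rewrite ge_min lexx orbT.
have b1 : t * `|v| < rho.
  apply: (@le_lt_trans _ _ (t1 * `|v|)); first by rewrite ler_wpM2r.
  rewrite /t1 mulrAC ltr_pdivrMr; last by lra.
  rewrite ltr_pM2l//; lra.
have b2 : t * (`|c| * `|v| ^+ 2) <= e.
  apply: (@le_trans _ _ (t2 * (`|c| * `|v| ^+ 2))); first by rewrite ler_wpM2r.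
  rewrite /t2 mulrAC ler_pdivrMr; last by lra.
  rewrite ler_pM2l//; lra.
have := hL (t *: v); rewrite normrZ (gtr0_norm t0) => /(_ b1).
rewrite linear_formZ// => h.
have h2 : - (c * (t * `|v| ^+ 2)) <= L v.
  rewrite -(ler_pM2l t0); apply: le_trans h.
  by rewrite le_eqVlt; apply/orP; left; apply/eqP; ring.
apply: le_trans h2; rewrite lerN2; apply: le_trans b2.
rewrite mulrCA ler_wpM2l ?(ltW t0)// ler_wpM2r ?exprn_ge0//; exact: ler_norm.
Qed.

Variables (M : Type) (d : M -> M -> R).
Hypothesis dxx : forall x, d x x = 0.
Hypothesis dsym : forall x y, d x y = d y x.
Hypothesis dtri : forall x y z, d x z <= d x y + d y z.
Hypothesis dmid : forall x y a, 0 <= a -> a <= d x y ->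
  exists z, d x z = a /\ d z y = d x y - a.
Variables (q : M) (phi : M -> V) (psi : V -> M) (G : V -> 'M[R]_n)
  (DG : V -> V -> 'M[R]_n) (r C : R).
Hypothesis H : riemannian_chart d q phi psi G DG r C.
Local Notation rho := (fv_radius r C).
Local Notation K := (fv_const C).

Lemma fv_const_ge1 : 1 <= K.
Proof.
have C1 := rc_const H; have C0 := le_trans ler01 C1.
have Cn k : 0 <= C ^+ k by exact: exprn_ge0.
have j1 := Cn 6%N; have j2 := Cn 3%N; have j3 := Cn 2%N.
have j4 : 0 <= C * (C + 1) ^+ 2 by rewrite mulr_ge0 ?sqr_ge0.
rewrite /fv_const; lra.
Qed.

Lemma fv_radius_le : rho <= r / 8 /\ rho <= 1 / 8.
Proof.
have C1 := rc_const H.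
have C0 : 0 < C := lt_le_trans ltr01 C1.
have m0 : 0 <= Num.min 1 r by rewrite le_min ler01 (ltW (rc_radius H)).
have m1 : Num.min 1 r <= 1 by rewrite ge_min lexx.
have mr : Num.min 1 r <= r by rewrite ge_min lexx orbT.
have h : rho <= Num.min 1 r / 8.
  rewrite /fv_radius ler_wpM2l// lef_pV2 ?posrE ?mulr_gt0//; lra.
by split; lra.
Qed.

(** [P] plays the part of the differential of [f] at [z], with a quadratic remainder whose constant
    is recorded. *)
Definition supported (f : M -> R) (c : R) (z : M) (P : V -> R) := forall v, `|v| < rho ->
  f (psi (phi z + v)) <= f z + P v + c * `|v| ^+ 2 /\
  f z + P v - c * `|v| ^+ 2 <= f (psi (phi z + v)).

(* At an interior point of a geodesic the distances to both ends have quadratic upper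
   supports, and these squeeze the distance to one end between two paraboloids. *)
Lemma interior_support (o z e : M) (c : R) :
  d q o < rho -> d q z < rho -> d q e < rho -> 0 < d o z -> 0 < d z e ->
  d o z + d z e = d o e -> K <= c * d o z -> K <= c * d z e ->
  exists P, [/\ linear_form P, supported (d o) c z P &
    forall o', d q o' < rho -> d o o' + d o' z = d o z -> 0 < d o' z -> forall v,
      `|P v - gram_form (G (phi z)) (phi z - phi o') v / d o' z| <= K * d o' z * `|v|].
Proof.
move=> qo qz qe oz ze oze Ko Ke.
have rho0 := fv_radius_gt0 H.
have [P [PL PU _]] := first_variation dxx dsym dtri dmid H qo qz oz.
have ez : 0 < d e z by rewrite dsym.
have [Q [QL QU _]] := first_variation dxx dsym dtri dmid H qe qz ez.
have div s v : 0 < s -> K <= c * s -> K * `|v : V| ^+ 2 / s <= c * `|v| ^+ 2.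
  move=> s0 Ks; rewrite ler_pdivrMr// mulrAC ler_wpM2r// exprn_ge0//.
have Qlow v : `|v| < rho -> d o z - Q v - c * `|v| ^+ 2 <= d o (psi (phi z + v)).
  move=> vr; have h1 := QU v vr; have h2 := dtri o (psi (phi z + v)) e.
  rewrite (dsym (psi _) e) in h2.
  have h3 := div (d e z) v ez; rewrite (dsym e z) in h3 h1.
  have h4 := h3 Ke; lra.
(* Any linear form that supports [d o] from above at [z] also lies above the lower paraboloid, and
   so equals [- Q]. *)
have up P' s (o' : M) : linear_form P' -> 0 < s ->
    (forall v, `|v| < rho -> d o (psi (phi z + v)) <= d o z + P' v + K * `|v| ^+ 2 / s) ->
    forall v, P' v = - Q v.
  move=> P'L s0 hP' v; apply/eqP; rewrite -subr_eq0 opprK; apply/eqP.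
  apply: (@linear_form_ge_quadratic (fun v => P' v + Q v) rho (c + K / s)) => //.
    by move=> a v1 v2; rewrite P'L QL; ring.
  move=> w wr; have h1 := hP' w wr; have h2 := Qlow w wr.
  have e1 : (c + K / s) * `|w| ^+ 2 = c * `|w| ^+ 2 + K * `|w| ^+ 2 / s by ring.
  rewrite e1; lra.
have PQ := up P (d o z) o PL oz PU.
exists P; split => //.
- move=> v vr; split; last by rewrite PQ; exact: Qlow.
  by apply: le_trans (PU v vr) _; rewrite lerD2l; exact: div.
(* A nearer point [o'] of the geodesic gives the same form, since [d o] is at most [d o o' + d o'],
   with equality at [z]. Its error [K * d o' z] can be made small, which ties [P] to the direction
   of the geodesic at [z]. *)
- move=> o' qo' oo' o'z v.
  have [P' [P'L P'U P'G]] := first_variation dxx dsym dtri dmid H qo' qz o'z.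
  have -> : P v = P' v; last exact: P'G.
  rewrite PQ (up P' (d o' z) o' P'L o'z)// => w wr.
  have h1 := P'U w wr; have h2 := dtri o o' (psi (phi z + w)); lra.
Qed.

(** At [phi z + v] the lower paraboloid of [z'] lies below the upper one of [z]. When [|v|] equals
    the distance [dl] of the base points the errors sum to [6 * c * dl ^+ 2], and homogeneity
    extends the bound to every [v]. *)
Lemma supported_lipschitz (f : M -> R) c z z' P P' : 0 <= c ->
  psi (phi z) = z -> psi (phi z') = z' ->
  linear_form P -> linear_form P' -> supported f c z P -> supported f c z' P' ->
  2 * `|phi z - phi z'| < rho -> forall v, `|P v - P' v| <= 6 * c * `|phi z - phi z'| * `|v|.
Proof.
move=> c0 zK z'K PL P'L sP sP' del.
have rho0 := fv_radius_gt0 H.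
set dl := `|phi z - phi z'| in del *.
have dl0 : 0 <= dl by exact: normr_ge0.
have main v : `|v| < rho -> dl + `|v| < rho ->
    P' v - P v <= c * (dl + `|v|) ^+ 2 + c * `|v| ^+ 2 + c * dl ^+ 2.
  move=> vr dvr.
  have [u1 _] := sP v vr.
  have nb : `|phi z - phi z' + v| <= dl + `|v| by exact: ler_normD.
  have nb' : `|phi z - phi z' + v| < rho by exact: le_lt_trans nb dvr.
  have [_ l1] := sP' _ nb'.
  have e1 : phi z' + (phi z - phi z' + v) = phi z + v.
    by rewrite addrA [phi z' + _]addrC subrK.
  rewrite e1 (linear_formD _ _ P'L) in l1.
  have dlr : `|phi z - phi z'| < rho by rewrite -/dl; have v0 := normr_ge0 v; lra.
  have [u2 _] := sP' _ dlr.
  have e2 : phi z' + (phi z - phi z') = phi z by rewrite addrC subrK.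
  rewrite e2 zK -/dl in u2.
  have h : c * `|phi z - phi z' + v| ^+ 2 <= c * (dl + `|v|) ^+ 2.
    by rewrite ler_wpM2l// ler_sqr_nneg.
  lra.
(* For [dl = 0] there is no scale to choose [v] by; two forms supporting [f] at the same point
   coincide. *)
have [dlE|dlN] := eqVneq dl 0.
  move=> v; rewrite dlE mulr0 mul0r.
  have -> : P v - P' v = 0; last by rewrite normr0.
  apply: (@linear_form_ge_quadratic (fun v => P v - P' v) rho (2 * c)) => //.
    by move=> a v1 v2; rewrite PL P'L; ring.
  move=> w wr; have := main w wr; rewrite dlE add0r => /(_ wr).
  have -> : c * 0 ^+ 2 = 0 by rewrite expr0n mulr0.
  lra.
have dlp : 0 < dl by rewrite lt_neqAle eq_sym dlN.
have half v : P' v - P v <= 6 * c * dl * `|v|.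
  have [->|v0] := eqVneq v 0.
    by rewrite (linear_form0 PL) (linear_form0 P'L) subrr normr0 mulr0.
  have nv : 0 < `|v| by rewrite normr_gt0.
  pose t := dl / `|v|.
  have t0 : 0 < t by rewrite divr_gt0.
  have tv : `|t *: v| = dl by rewrite normrZ gtr0_norm// /t divfK// gt_eqF.
  have d1 : dl < rho by lra.
  have d2 : dl + dl < rho by lra.
  have := main (t *: v); rewrite tv !linear_formZ// => /(_ d1 d2) h.
  have h2 : t * (P' v - P v) <= t * (6 * c * dl * `|v|).
    have -> : t * (6 * c * dl * `|v|) = 6 * c * dl ^+ 2.
      by rewrite /t; field; rewrite gt_eqF.
    rewrite mulrBr; apply: le_trans h _; rewrite le_eqVlt; apply/orP; left; apply/eqP; ring.
  by rewrite ler_pM2l in h2.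
move=> v; rewrite ler_norml; apply/andP; split; last first.
  have := half (- v); rewrite (linear_formN _ PL) (linear_formN _ P'L) normrN; lra.
have := half v; lra.
Qed.

(** The forms are tested on [D1 - D2] itself, and coercivity bounds its square. So the increment of
    a subdivided geodesic depends on its point in a Lipschitz way, up to [O(h ^+ 2)]. *)
Lemma difference_step (u1 u2 D1 D2 : V) (P P' : V -> R) (c h : R) : 0 <= c -> 0 < h ->
  ball (phi q) r u1 -> ball (phi q) r u2 -> `|D2| <= C * h ->
  (forall v, `|P v - gram_form (G u1) D1 v / h| <= K * h * `|v|) ->
  (forall v, `|P' v - gram_form (G u2) D2 v / h| <= K * h * `|v|) ->
  (forall v, `|P v - P' v| <= 6 * c * `|u1 - u2| * `|v|) ->
  `|D1 - D2| <= C * (6 * c + C ^+ 2) * h * `|u1 - u2| + 2 * C * K * h ^+ 2.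
Proof.
move=> c0 h0 b1 b2 D2n PG1 PG2 lip.
have C0 : 0 < C := lt_le_trans ltr01 (rc_const H).
have K0 : 0 <= K := le_trans ler01 fv_const_ge1.
have T := rc_tame H.
set dl := `|u1 - u2| in lip *; have dl0 : 0 <= dl by exact: normr_ge0.
set w := D1 - D2.
have [->|w0] := eqVneq w 0.
  by rewrite normr0 addr_ge0// !mulr_ge0// ?addr_ge0// ?mulr_ge0// ?exprn_ge0// ltW.
have wp : 0 < `|w| by rewrite normr_gt0.
rewrite -(ler_pM2r wp) -expr2.
apply: le_trans (tame_coercive T w b1) _.
set g1 := gram_form (G u1); set g2 := gram_form (G u2).
have g1E : g1 w w = g1 D1 w - g2 D2 w + (g2 D2 w - g1 D2 w).
  rewrite {1}/g1 {1}/w gram_formDl -scaleN1r gram_formZl -/g1; ring.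
have x1 : g1 D1 w - h * P w <= K * h ^+ 2 * `|w|.
  have := PG1 w; rewrite ler_norml -/g1 => /andP[y1 y2].
  have : h * (g1 D1 w / h - P w) <= h * (K * h * `|w|).
    by rewrite ler_pM2l//; rewrite lerNl opprB in y1.
  have -> : h * (g1 D1 w / h - P w) = g1 D1 w - h * P w by field; rewrite gt_eqF.
  by have -> : h * (K * h * `|w|) = K * h ^+ 2 * `|w| by ring.
have x2 : h * P' w - g2 D2 w <= K * h ^+ 2 * `|w|.
  have := PG2 w; rewrite ler_norml -/g2 => /andP[y1 y2].
  have : h * (P' w - g2 D2 w / h) <= h * (K * h * `|w|) by rewrite ler_pM2l.
  have -> : h * (P' w - g2 D2 w / h) = h * P' w - g2 D2 w by field; rewrite gt_eqF.
  by have -> : h * (K * h * `|w|) = K * h ^+ 2 * `|w| by ring.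
have x3 : h * P w - h * P' w <= 6 * c * h * dl * `|w|.
  rewrite -mulrBr; have := le_trans (ler_norm _) (lip w) => y.
  have -> : 6 * c * h * dl * `|w| = h * (6 * c * dl * `|w|) by ring.
  by rewrite ler_pM2l.
have x4 : g2 D2 w - g1 D2 w <= C ^+ 2 * h * dl * `|w|.
  apply: le_trans (le_trans (ler_norm _) (tame_lipschitz T D2 w b2 b1)) _.
  rewrite distrC -/dl.
  have -> : C ^+ 2 * h * dl * `|w| = C * dl * (C * h) * `|w| by ring.
  by rewrite ler_wpM2r// ler_wpM2l// mulr_ge0// ltW.
have -> : (C * (6 * c + C ^+ 2) * h * dl + 2 * C * K * h ^+ 2) * `|w| =
   C * (6 * c * h * dl * `|w| + C ^+ 2 * h * dl * `|w| + 2 * (K * h ^+ 2 * `|w|)) by ring.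
rewrite ler_wpM2l ?(ltW C0)// g1E.
move: x1 x2 x3 x4; lra.
Qed.

(** The recursion is implicit in [m]. While [(k + 1) * h] is small against [1 / A1], the loss from
    solving it is absorbed by the factor 2, and the bound grows only linearly in [k]. *)
Lemma discrete_gronwall_step (A1 A2 h m m' k : R) : 0 <= A1 -> 0 <= A2 -> 0 < h -> 0 <= k ->
  m <= m' + A1 * h * m + A2 * h ^+ 2 -> m' <= 2 * A2 * h ^+ 2 * k ->
  2 * (k + 1) * A1 * h <= 1 -> m <= 2 * A2 * h ^+ 2 * (k + 1).
Proof.
move=> A10 A20 h0 k0 hm hm' Akh.
have A1h0 : 0 <= A1 * h by rewrite mulr_ge0// ltW.
have A1h : A1 * h < 1.
  have : 0 <= k * (A1 * h) by rewrite mulr_ge0.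
  move: Akh A1h0; have -> : 2 * (k + 1) * A1 * h = 2 * (k * (A1 * h)) + 2 * (A1 * h) by ring.
  lra.
rewrite -(@ler_pM2r _ (1 - A1 * h)); last by rewrite subr_gt0.
have A2h : 0 <= A2 * h ^+ 2 by rewrite mulr_ge0 ?exprn_ge0// ltW.
apply: (@le_trans _ _ (2 * A2 * h ^+ 2 * k + A2 * h ^+ 2)).
  have -> : m * (1 - A1 * h) = m - A1 * h * m by ring.
  lra.
have -> : 2 * A2 * h ^+ 2 * (k + 1) * (1 - A1 * h) =
  2 * A2 * h ^+ 2 * k + A2 * h ^+ 2 + (A2 * h ^+ 2) * (1 - 2 * (k + 1) * A1 * h) by ring.
by rewrite lerDl mulr_ge0// subr_ge0.
Qed.

(** The distances along [o], [q], [f k], [a], [e] add up to [d o e], so every triangle inequality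
    among these points is an equality. *)
Lemma geodesic_interior_dists (s tau h : R) (N : nat) (o e a : M) (f : nat -> M) :
  0 <= h -> tau = N%:R * h -> d o q = s -> d o e = 2 * s -> d a e = s - tau ->
  (forall i, (i <= N)%N -> d q (f i) = i%:R * h /\ d (f i) a = (N%:R - i%:R) * h) ->
  forall k, (k <= N)%N -> [/\ d q (f k) = k%:R * h, k%:R * h <= tau,
    d o (f k) = s + k%:R * h & d (f k) e = s - k%:R * h].
Proof.
move=> h0 tNh oq oe ae fd k kN; have [d1 d2] := fd k kN.
have kt : k%:R * h <= tau by rewrite tNh ler_wpM2r// ler_nat.
have t1 := dtri o q (f k); have t2 := dtri (f k) a e; have t3 := dtri o (f k) e.
rewrite d1 oq in t1; rewrite d2 ae mulrBl -tNh in t2; rewrite oe in t3.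
by split => //; apply/le_anti/andP; move: t1 t2 t3; split; lra.
Qed.

Lemma fv_ball z : d q z < rho -> ball (phi q) r (phi z).
Proof.
have C1 := rc_const H; have C0 : 0 < C := lt_le_trans ltr01 C1.
have rho0 := fv_radius_gt0 H; have [rr8 r18] := fv_radius_le.
move=> zr; rewrite -[phi z]addr0; apply: (@rc_inner R n M d q phi psi G DG r C H z rho) => //;
  rewrite ?normr0//; first by lra.
have : C * d q z <= C * rho by rewrite ler_wpM2l// ltW.
have rhoE : 8 * C * rho = Num.min 1 r by rewrite /fv_radius mulrC divfK// gt_eqF// mulr_gt0.
have mr : Num.min 1 r <= r by rewrite ge_min lexx orbT.
have rhoC : rho <= C * rho by rewrite ler_peMl// ltW.
lra.
Qed.

(** Makes [2 * A1 * tau <= 1] follow from [4 * nb_const * tau <= s] in [nonbranching], [A1] being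
    the Lipschitz rate of the recursion there. *)
Definition nb_const := C * (12 * C * K + C ^+ 3).

(** Two geodesics from [o] through [q], ending at [e] and [e'], are subdivided beyond [q] into [N]
    steps. Their increments are determined up to [O(h ^+ 2)] by the differential of [d o], which is
    Lipschitz in the point, so the coordinates of [a] and [a'] differ by [O(1 / N)] for every
    [N]. *)
Lemma nonbranching (s tau : R) (o e e' a a' : M) :
  0 < s -> 4 * C * s < rho -> 0 <= tau -> 4 * nb_const * tau <= s ->
  d o q = s -> d q e = s -> d q e' = s -> d o e = 2 * s -> d o e' = 2 * s ->
  d q a = tau -> d a e = s - tau -> d q a' = tau -> d a' e' = s - tau -> a = a'.
Proof.
move=> s0 sr tau0 taus oq qe qe' oe oe' qa ae qa' ae'.
have C1 := rc_const H.
have C0 : 0 < C := lt_le_trans ltr01 C1.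
have K1 := fv_const_ge1.
have rho0 := fv_radius_gt0 H.
have [rr8 r18] := fv_radius_le.
have sC : s <= C * s by rewrite ler_peMl// ltW.
have s1 : s <= 1 by lra.
have T := rc_tame H.
have C3 : 1 <= C ^+ 3 by rewrite exprn_ege1.
have CK : 1 <= C * K by rewrite -[1]mulr1 ler_pM.
have B1 : 1 <= nb_const.
  have e12 : 12 * C * K = 12 * (C * K) by ring.
  have h : 1 <= 12 * C * K + C ^+ 3 by lra.
  rewrite /nb_const; apply: le_trans h _; rewrite ler_peMl//; lra.
have taus4 : 4 * tau <= s.
  apply: le_trans taus; rewrite ler_wpM2r//; lra.
have qo : d q o < rho by rewrite dsym oq; lra.
have qer : d q e < rho by rewrite qe; lra.
have qer' : d q e' < rho by rewrite qe'; lra.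
have arho : d q a < r by rewrite qa; lra.
have arho' : d q a' < r by rewrite qa'; lra.
have [aK _] := rc_near H arho; have [aK' _] := rc_near H arho'.
(* For [tau = 0] the step [h] would vanish; both points are then [q]. *)
have [tau00|taup] := eqVneq tau 0.
  have ball0 : ball (phi q) r (phi q) by apply: ballxx; exact: rc_radius H.
  have eq_q b : d q b = tau -> psi (phi b) = b -> d q b < r -> b = q.
    move=> qb bK br; have [_] := rc_near H br.
    rewrite qb tau00 mulr0 normr_le0 subr_eq0 => /eqP pb.
    by rewrite -bK pb (rc_psiK H).
  by rewrite (eq_q a)// (eq_q a').
have tp : 0 < tau by rewrite lt_neqAle eq_sym taup.
have tau_half : tau <= s / 2 by lra.
have s_half : s / 2 <= s by lra.
have half_pos : 0 < s / 2 by rewrite divr_gt0.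
(* The points of the subdivisions keep a distance of at least [s / 2] from both ends of their
   geodesics, and [K = c * (s / 2)]. *)
pose c := 2 * K / s.
have c0 : 0 <= c by rewrite divr_ge0 ?mulr_ge0//; lra.
pose A1 := C * (6 * c + C ^+ 2); pose A2 := 2 * C * K.
have A1tau : 2 * A1 * tau <= 1.
  have : 4 * nb_const * tau / s <= 1 by rewrite ler_pdivrMr// mul1r.
  apply: le_trans; rewrite ler_pdivlMr//.
  have -> : 2 * A1 * tau * s = (C * (24 * K + 2 * C ^+ 2 * s)) * tau.
    by rewrite /A1 /c; field; rewrite gt_eqF.
  rewrite ler_wpM2r// /nb_const.
  have -> : 4 * (C * (12 * C * K + C ^+ 3)) = C * (48 * (C * K) + 4 * C ^+ 3) by ring.
  rewrite ler_wpM2l ?(ltW C0)//.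
  have j1 : K <= C * K by rewrite ler_peMl//; lra.
  have j2 : 2 * C ^+ 2 * s <= 2 * C ^+ 3.
    have -> : 2 * C ^+ 3 = 2 * C ^+ 2 * C by ring.
    have C20 : 0 <= 2 * C ^+ 2 by rewrite mulr_ge0// exprn_ge0// ltW.
    rewrite ler_wpM2l//; lra.
  lra.
have A20 : 0 <= A2 by rewrite /A2 !mulr_ge0//; lra.
have A10 : 0 <= A1.
  rewrite /A1 mulr_ge0 ?(ltW C0)// addr_ge0 ?exprn_ge0 ?(ltW C0)//; lra.
suff bound N : (0 < N)%N -> `|phi a - phi a'| <= 2 * A2 * tau ^+ 2 / N%:R.
  have pp : phi a = phi a'.
    apply/eqP; rewrite -subr_eq0 -normr_le0; apply/ler_addgt0Pr => x x0; rewrite add0r.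
    pose y := 2 * A2 * tau ^+ 2 / x.
    have yN : y < (Num.trunc y).+1%:R by exact: truncnS_gt.
    apply: le_trans (bound _ (ltn0Sn (Num.trunc y))) _.
    by rewrite ler_pdivrMr ?ltr0n// [x * _]mulrC -ler_pdivrMr// ltW.
  by rewrite -aK -aK' pp.
move=> N0; have NR0 : 0 < N%:R :> R by rewrite ltr0n.
pose h := tau / N%:R.
have h0 : 0 < h by rewrite divr_gt0.
have tNh : tau = N%:R * h by rewrite /h mulrC divfK// gt_eqF.
have qaN : d q a = N%:R * h by rewrite qa.
have qaN' : d q a' = N%:R * h by rewrite qa'.
have [f [f0 fN fh fd]] := geodesic_points dxx dtri dmid (ltW h0) qaN N0.
have [f' [f0' fN' fh' fd']] := geodesic_points dxx dtri dmid (ltW h0) qaN' N0.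
have kh k : (k <= N)%N -> k%:R * h <= tau.
  by move=> kN; rewrite tNh ler_wpM2r ?(ltW h0)// ler_nat.
have facts (b ee : M) (F : nat -> M) := @geodesic_interior_dists s tau h N o ee b F (ltW h0) tNh oq.
have taur : tau < rho.
  by move: taus4 sC sr s0; lra.
have F1 k : (k <= N)%N -> [/\ d q (f k) < rho, d o (f k) = s + k%:R * h &
    d (f k) e = s - k%:R * h].
  move=> kN; have [x1 x2 x3 x4] := facts a e f oe ae fd k kN.
  by rewrite x1 (le_lt_trans x2).
have F2 k : (k <= N)%N -> [/\ d q (f' k) < rho, d o (f' k) = s + k%:R * h &
    d (f' k) e' = s - k%:R * h].
  move=> kN; have [x1 x2 x3 x4] := facts a' e' f' oe' ae' fd' k kN.
  by rewrite x1 (le_lt_trans x2).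
have sup (ee : M) (z : M) (k : nat) : (k <= N)%N -> d q ee < rho -> d q z < rho -> d o ee = 2 * s ->
    d o z = s + k%:R * h -> d z ee = s - k%:R * h ->
    exists P, [/\ linear_form P, supported (d o) c z P &
      forall o', d q o' < rho -> d o o' + d o' z = d o z -> 0 < d o' z -> forall v,
      `|P v - gram_form (G (phi z)) (phi z - phi o') v / d o' z| <= K * d o' z * `|v|].
  move=> kN qee qz oee oz ze.
  have kt := kh k kN; have kh0 : 0 <= k%:R * h by rewrite mulr_ge0// ltW.
  have cs : K = c * (s / 2) by rewrite /c; field; rewrite gt_eqF.
  have zh : s / 2 <= d z ee.
    rewrite ze lerBrDr -lerBrDl; have -> : s - s / 2 = s / 2 by field.
    exact: le_trans kt tau_half.
  apply: interior_support qo qz qee _ _ _ _ _.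
  - by rewrite oz ltr_wpDr.
  - exact: lt_le_trans half_pos zh.
  - by rewrite oz ze oee; ring.
  - by rewrite oz {1}cs ler_wpM2l// (le_trans s_half)// lerDl.
  - by rewrite {1}cs ler_wpM2l.
have near (F : nat -> M) k : d q (F k) < rho ->
    psi (phi (F k)) = F k /\ `|phi (F k) - phi q| <= C * d q (F k).
  by move=> Fr; apply: (rc_near H); lra.
have stepn F k : (k < N)%N -> d q (F k) < rho -> d q (F k.+1) < rho -> d (F k) (F k.+1) = h ->
   `|phi (F k.+1) - phi (F k)| <= C * h.
  move=> kN r1 r2 <-; have := rc_norm H (fv_ball r1) (fv_ball r2).
  by have [-> _] := near F k r1; have [-> _] := near F k.+1 r2.
pose dl k := `|phi (f k) - phi (f' k)|.
suff main k : (k <= N)%N -> dl k <= 2 * A2 * h ^+ 2 * k%:R.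
  have := main N (leqnn N); rewrite /dl fN fN' => /le_trans; apply.
  by rewrite le_eqVlt; apply/orP; left; apply/eqP; rewrite /h; field; rewrite gt_eqF.
elim: k => [|k IH] kN; first by rewrite /dl f0 f0' subrr normr0 mulr0.
have {}IH := IH (ltnW kN).
have [r1 o1 e1] := F1 _ (ltnW kN); have [r1' o1' e1'] := F1 _ kN.
have [r2 o2 e2] := F2 _ (ltnW kN); have [r2' o2' e2'] := F2 _ kN.
have [P [PL PS PG]] := sup e (f k.+1) k.+1 kN qer r1' oe o1' e1'.
have [P' [PL' PS' PG']] := sup e' (f' k.+1) k.+1 kN qer' r2' oe' o2' e2'.
have ek : k.+1%:R = k%:R + 1 :> R by rewrite natr1.
have fhk := fh k kN; have fhk' := fh' k kN.
have PG1 v :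
    `|P v - gram_form (G (phi (f k.+1))) (phi (f k.+1) - phi (f k)) v / h| <= K * h * `|v|.
  by rewrite -fhk; apply: PG => //; rewrite fhk// o1 o1' ek; ring.
have PG2 v :
    `|P' v - gram_form (G (phi (f' k.+1))) (phi (f' k.+1) - phi (f' k)) v / h| <= K * h * `|v|.
  by rewrite -fhk'; apply: PG' => //; rewrite fhk'// o2 o2' ek; ring.
have [K1k n1] := near f k.+1 r1'; have [K2k n2] := near f' k.+1 r2'.
have dlr : 2 * dl k.+1 < rho.
  have -> : dl k.+1 = `|(phi (f k.+1) - phi q) - (phi (f' k.+1) - phi q)|.
    by rewrite /dl; congr `|_|; apply/rowP => j; rewrite !mxE; ring.
  have h1 := ler_normB (phi (f k.+1) - phi q) (phi (f' k.+1) - phi q).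
  have [q1 _] := fd _ kN; have [q2 _] := fd' _ kN.
  rewrite q1 in n1; rewrite q2 in n2.
  have h2 : C * (k.+1%:R * h) <= C * tau by rewrite ler_wpM2l ?kh// ltW.
  have h3 : C * (4 * tau) <= C * s by rewrite ler_wpM2l// ltW.
  apply: (@le_lt_trans _ _ (C * (4 * tau))).
    have -> : C * (4 * tau) = 2 * (C * tau + C * tau) by ring.
    rewrite ler_pM2l//; apply: le_trans h1 _.
    by apply: lerD; [exact: le_trans n1 h2|exact: le_trans n2 h2].
  apply: le_lt_trans h3 _; apply: le_lt_trans sr.
  by rewrite -mulrA ler_peMl ?ler1n// (le_trans (ltW s0)).
have lip := supported_lipschitz c0 K1k K2k PL PL' PS PS' dlr.
set D1 := phi (f k.+1) - phi (f k) in PG1.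
set D2 := phi (f' k.+1) - phi (f' k) in PG2.
pose w := D1 - D2.
have b1 := fv_ball r1'; have b2 := fv_ball r2'.
have D2n : `|D2| <= C * h by exact: (stepn f' k).
have dlE : dl k.+1 <= dl k + `|w|.
  have -> : dl k.+1 = `|(phi (f k) - phi (f' k)) + w|.
    by rewrite /dl /w /D1 /D2; congr `|_|; apply/rowP => j; rewrite !mxE; ring.
  exact: ler_normD.
have dl0 : 0 <= dl k.+1 by exact: normr_ge0.
have wn := difference_step c0 h0 b1 b2 D2n PG1 PG2 lip.
rewrite -/w -/(dl k.+1) -/A1 -/A2 in wn.
have rec : dl k.+1 <= dl k + A1 * h * dl k.+1 + A2 * h ^+ 2.
  by apply: le_trans dlE _; rewrite -addrA lerD2l.
have Akh : 2 * (k%:R + 1) * A1 * h <= 1.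
  have := kh _ kN; rewrite ek => /(ler_wpM2l A10) => y.
  apply: le_trans A1tau.
  have -> : 2 * (k%:R + 1) * A1 * h = 2 * (A1 * ((k%:R + 1) * h)) by ring.
  by rewrite -mulrA ler_pM2l.
rewrite ek.
exact: (discrete_gronwall_step A10 A20 h0 (ler0n R k) rec IH Akh).
Qed.

End nonbranching.

(** * Geodesics to a farthest point *)

Section constants.
Variables (R : realType) (C K ka s sg : R).
Hypotheses (C1 : 1 <= C) (K1 : 1 <= K) (ka0 : 0 < ka) (sg0 : 0 < sg).

Let C0 : 0 < C := lt_le_trans ltr01 C1.
Let K0 : 0 < K := lt_le_trans ltr01 K1.

(** Later [sg] is the coordinate distance of two points at distance [s], and [ka * sg] the size of
    the displacement of the farthest point, which must be small against [s] and against the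
    tolerance [eta]. *)
Lemma displacement_le eta : sg <= 1 -> sg <= C * s ->
  16 * C ^+ 3 * K * ka <= 1 -> 8 * C * ka <= eta ->
  [/\ ka * sg <= 2 * C * (ka * sg), 2 * C * (ka * sg) <= s / 8,
    2 * C * (ka * sg) <= eta / 2 & ka * sg <= 1].
Proof.
move=> sg_le1 sgs ka1 ka2.
have ks0 : 0 < ka * sg by rewrite mulr_gt0.
have c20 : 0 < C ^+ 2 by rewrite exprn_gt0.
have ka3 : 16 * C ^+ 2 * ka <= 1.
  apply: le_trans ka1; rewrite ler_wpM2r ?(ltW ka0)//.
  have -> : 16 * C ^+ 3 * K = 16 * C ^+ 2 * (C * K) by ring.
  apply: ler_peMr; first by rewrite mulr_ge0// ltW.
  by apply: le_trans C1 _; rewrite ler_peMr// ltW.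
have s0 : 0 < s by rewrite -(pmulr_rgt0 _ C0) (lt_le_trans sg0).
have h0 : ka * sg <= C * (ka * sg) by rewrite ler_peMl// ltW.
have h1 : ka * sg <= ka * (C * s) by rewrite ler_wpM2l// ltW.
have h2 : 2 * C * (ka * sg) <= 2 * C * (ka * (C * s)) by rewrite ler_wpM2l// mulr_ge0// ltW.
have h3 : 2 * C * (ka * (C * s)) = (16 * C ^+ 2 * ka) * (s / 8) by field.
have h4 : (16 * C ^+ 2 * ka) * (s / 8) <= s / 8 by rewrite ler_piMl// divr_ge0// ltW.
have h5 : 8 * C * ka * sg <= eta.
  by apply: le_trans ka2; rewrite ler_piMr// !mulr_ge0// ltW.
have c21 : 1 <= C ^+ 2 by rewrite exprn_ege1.
have h6 : ka <= C ^+ 2 * ka by rewrite ler_peMl// ltW.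
have h7 : ka * sg <= ka by rewrite ler_piMr// ltW.
have h8 : 2 * C * (ka * sg) = (8 * C * ka * sg) / 4 by field.
split; first by move: h0 ks0; lra.
- by apply: le_trans h2 _; rewrite h3.
- rewrite h8; have x0 : 0 < 8 * C * ka * sg by rewrite !mulr_gt0.
  by move: h5 x0; lra.
- by lra.
Qed.

(** The gain is at least [sg ^+ 2 / C], and the choices of [ep], [s] and [ka] make each of the three
    errors at most an eighth of that. *)
Lemma variation_contradiction g g' :
  let ep := s / (16 * C ^+ 4) in 0 < s -> s <= 2 * C * sg -> 16 * C ^+ 2 * K * s <= 1 ->
  16 * C ^+ 3 * K * ka <= 1 -> sg ^+ 2 / C <= g -> g' <= C ^+ 2 * ep * sg ->
  ~ 0 <= ka * (- (1 + ka) * g + g') / s + K * s * (ka * sg) + K * (ka * sg) ^+ 2 / s.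
Proof.
move=> ep s0 sg_s sK ka1 ge gz2 q1.
have q2 : 0 <= - (1 + ka) * g + g' + K * s ^+ 2 * sg + K * ka * sg ^+ 2.
  have kas0 : 0 < ka / s by rewrite divr_gt0.
  rewrite -(pmulr_rge0 _ kas0); apply: le_trans q1 _.
  by rewrite le_eqVlt; apply/orP; left; apply/eqP; field; rewrite gt_eqF.
have gee0 : 0 <= g by apply: le_trans ge; rewrite divr_ge0 ?exprn_ge0// ltW.
have q3 : 0 <= sg * (- (sg / C) + C ^+ 2 * ep + K * s ^+ 2 + K * ka * sg).
  have -> : sg * (- (sg / C) + C ^+ 2 * ep + K * s ^+ 2 + K * ka * sg) =
    - (sg ^+ 2 / C) + C ^+ 2 * ep * sg + K * s ^+ 2 * sg + K * ka * sg ^+ 2.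
    by field; rewrite gt_eqF.
  have : 0 <= ka * g by rewrite mulr_ge0// ltW.
  lra.
rewrite pmulr_rge0// in q3.
have sgC0 : 0 < sg / C by rewrite divr_gt0.
have C20 : 0 < C ^+ 2 by rewrite exprn_gt0.
have r1 : s / (16 * C ^+ 2) <= sg / C / 8.
  rewrite ler_pdivrMr ?mulr_gt0//.
  by have -> : sg / C / 8 * (16 * C ^+ 2) = 2 * C * sg by field; rewrite gt_eqF.
have r2 : C ^+ 2 * ep = s / (16 * C ^+ 2) by rewrite /ep; field; rewrite gt_eqF.
have r3 : K * s ^+ 2 <= s / (16 * C ^+ 2).
  rewrite ler_pdivlMr ?mulr_gt0//.
  have -> : K * s ^+ 2 * (16 * C ^+ 2) = (16 * C ^+ 2 * K * s) * s by ring.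
  by rewrite ler_piMl// ltW.
have r4 : K * ka * sg <= sg / C / 16.
  rewrite ler_pdivlMr// ler_pdivlMr//.
  have -> : K * ka * sg * 16 * C = (16 * C * K * ka) * sg by ring.
  rewrite ler_piMl ?(ltW sg0)//; apply: le_trans ka1.
  rewrite ler_wpM2r ?(ltW ka0)// ler_wpM2r ?(ltW K0)// ler_wpM2l// ler_eXnr//.
lra.
Qed.

End constants.

Section cut_locus.
Variables (R : realType) (n : nat) (M : topologicalType) (d : M -> M -> R).
Local Notation V := 'rV[R]_n.
Hypothesis dxx : forall x, d x x = 0.
Hypothesis dsym : forall x y, d x y = d y x.
Hypothesis dtri : forall x y z, d x z <= d x y + d y z.
Hypothesis dmid : forall x y a, 0 <= a -> a <= d x y ->
  exists z, d x z = a /\ d z y = d x y - a.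
Hypothesis Mcompact : compact [set: M].
Hypothesis dcont : forall x, continuous (d x).
Hypothesis charts : forall q, exists phi psi G DG r C,
  @riemannian_chart R n M d q phi psi G DG r C.

Let d0 := metric_ge0 dxx dsym dtri.

Lemma metric_eq x y : d x y = 0 -> x = y.
Proof.
have [phi [psi [G [DG [r [C H]]]]]] := charts x => dxy.
have [|yK] := rc_near H (z := y); first by rewrite dxy; exact: rc_radius H.
rewrite dxy mulr0 normr_le0 subr_eq0 => /eqP pxy.
by rewrite -yK pxy (rc_psiK H).
Qed.

Definition on_geodesic (x y : M) (t : R) (z : M) := d x z = t /\ d z y = d x y - t.

Definition unique_at x y t := forall z z', on_geodesic x y t z -> on_geodesic x y t z' -> z = z'.

(** Off the ball around [z] the total deviation [F] from the two prescribed distances is positive by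
    uniqueness, hence has a positive minimum by compactness. *)
Lemma geodesic_point_stable x y t z : on_geodesic x y t z -> unique_at x y t ->
  forall e, 0 < e -> exists2 eta, 0 < eta & forall w,
    `|d x w - t| < eta -> `|d y w - (d x y - t)| < eta -> d z w < e.
Proof.
move=> [xz zy] U e e0.
pose A := [set w | e <= d z w].
have [A0|/set0P A0] := eqVneq A set0.
  exists 1 => // w _ _; rewrite ltNge; apply/negP => h.
  by have : A w by []; rewrite A0.
pose F w := `|d x w - t| + `|d y w - (d x y - t)|.
have cF : continuous F.
  move=> w; apply: cvgD; apply: cvg_norm; apply: cvgB;
    [exact: dcont|exact: cvg_cst|exact: dcont|exact: cvg_cst].
have cA : compact A.
  apply: (subclosed_compact _ Mcompact) => //.
  have -> : A = (d z) @^-1` [set u | e <= u] by [].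
  by apply: closed_comp; [move=> w _; exact: dcont|exact: closed_ge].
have [c cinA cmin] := compact_EVT_min A0 cA (continuous_subspaceT cF).
have Fc : 0 < F c.
  rewrite lt_neqAle addr_ge0// andbT; apply/negP => /eqP Fc0.
  have h1 : `|d x c - t| = 0.
    by apply/le_anti/andP; split => //; rewrite Fc0 lerDl.
  have h2 : `|d y c - (d x y - t)| = 0.
    by apply/le_anti/andP; split => //; rewrite Fc0 lerDr.
  have zc : z = c.
    apply: U; first by split.
    move/eqP: h1; rewrite normr_eq0 subr_eq0 => /eqP h1.
    move/eqP: h2; rewrite normr_eq0 subr_eq0 => /eqP h2.
    by split => //; rewrite dsym.
  by move: cinA; rewrite inE /A /= -zc dxx leNgt e0.
exists (F c / 2); first by rewrite divr_gt0.
move=> w w1 w2; rewrite ltNge; apply/negP => h.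
have : F c <= F w by apply: cmin; rewrite inE.
rewrite {2}/F; lra.
Qed.

Lemma displaced_dists x y y' w s eta : (forall z, d x z <= d x y) -> 0 < eta ->
  d y y' <= eta / 2 -> d y' w = s -> d w x = d y' x - s ->
  [/\ `|d x w - (d x y - s)| < eta, `|d y w - (d x y - (d x y - s))| < eta &
    d y w <= d y y' + s].
Proof.
move=> far eta0 yy' y'w wx; have f := far y'; have h0 := dtri x y' y.
have h1 := dtri y y' w; have h2 := dtri y' y w.
rewrite (dsym x y') in f h0; rewrite (dsym y' y) in h0 h2; rewrite (dsym x w) wx.
by split; rewrite ?ltr_norml; try (apply/andP; split); lra.
Qed.

(** Moving [y'] by [v] leads back to [y]. The first variation from [w] bounds [d w y] above, while
    [d x w + d w y] is at least [d x y], which is at least [d x y' = d x w + d w y']. *)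
Lemma displaced_variation x y w phi psi G DG r C (v : V) :
  @riemannian_chart R n M d y phi psi G DG r C -> (forall z, d x z <= d x y) ->
  let uy := phi y - v in let y' := psi uy in
  ball (phi y) r uy -> `|v| < fv_radius r C -> d y w < fv_radius r C ->
  d y y' < fv_radius r C -> 0 < d w y' -> d w x = d y' x - d w y' ->
  0 <= gram_form (G uy) (uy - phi w) v / d w y' + fv_const C * d w y' * `|v|
    + fv_const C * `|v| ^+ 2 / d w y'.
Proof.
move=> H far uy y' buy vr yw yy' wy' wx.
have y'K : phi y' = uy by exact: (rc_phiK H).
have [P [_ PU PG]] := first_variation dxx dsym dtri dmid H yw yy' wy'.
have := PU v vr; rewrite y'K /uy subrK (rc_psiK H) => h1.
have := PG v; rewrite y'K => /ler_normlW h2.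
have h3 := dtri x w y; have h4 := far y'; rewrite (dsym x w) wx (dsym y' x) in h3.
lra.
Qed.

Lemma chart_dist_le y phi psi G DG r C u : @riemannian_chart R n M d y phi psi G DG r C ->
  ball (phi y) r u -> `|u - phi y| <= 1 -> d y (psi u) <= 2 * C * `|u - phi y|.
Proof.
move=> H bu u1; have C1 := rc_const H; have C0 : 0 < C := lt_le_trans ltr01 C1.
have b0 : ball (phi y) r (phi y) by apply: ballxx; exact: rc_radius H.
have := rc_upper H b0 bu; rewrite (rc_psiK H) => h1.
have h2 := tame_norm_le C1 (rc_tame H) (u - phi y) b0.
have h3 : C * `|u - phi y| ^+ 2 <= C * `|u - phi y|.
  by rewrite ler_wpM2l ?(ltW C0)// expr2 ler_piMl.
lra.
Qed.

(* Berger's lemma: at a point [y] farthest from [x], minimal geodesics to [x] leave in every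
   closed half-space, so that a single one cannot suffice. *)
Lemma farthest_not_unique x y : 0 < d x y -> (forall z, d x z <= d x y) ->
  ~ (forall t, 0 <= t -> t <= d x y -> unique_at x y t).
Proof.
move=> L0 far U; set L := d x y in L0 U.
have [phi [psi [G [DG [r [C H]]]]]] := charts y.
have C1 := rc_const H; have C0 : 0 < C := lt_le_trans ltr01 C1.
have rho0 := fv_radius_gt0 H.
have [rr8 r18] := fv_radius_le H.
have K1 := fv_const_ge1 H.
set K := fv_const C in K1; set rho := fv_radius r C in rho0 rr8 r18.
have T := rc_tame H; have r0 := rc_radius H.
have rhoC : 8 * (C * rho) <= 1.
  by rewrite mulrA /rho /fv_radius mulrC divfK ?gt_eqF ?mulr_gt0// ge_min lexx.
(* The three bounds keep [z] between [x] and [y], keep it in the chart, and make the error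
   [K * s ^+ 2] small against the gain. *)
pose s := Num.min (L / 2) (Num.min (rho / 8) (1 / (16 * C ^+ 2 * K))).
have C20 : 0 < C ^+ 2 by rewrite exprn_gt0.
have K0 : 0 < K by apply: lt_le_trans K1.
have den0 : 0 < 16 * C ^+ 2 * K by rewrite !mulr_gt0.
have s0 : 0 < s by rewrite !lt_min; apply/and3P; split; apply: divr_gt0.
have sL : s <= L / 2 by rewrite ge_min lexx.
have srho : s <= rho / 8 by rewrite !ge_min lexx orbT.
have sK : 16 * C ^+ 2 * K * s <= 1.
  have : s <= 1 / (16 * C ^+ 2 * K) by rewrite !ge_min lexx !orbT.
  by rewrite ler_pdivlMr ?mulr_gt0// mulrC.
have dyx : d y x = L by rewrite dsym.
have [||z [yz zx]] := @dmid y x s; [exact: ltW|rewrite dyx; lra|].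
rewrite dyx in zx.
have gz : on_geodesic x y (L - s) z by split; [rewrite dsym|rewrite dsym yz -/L; ring].
have Us : unique_at x y (L - s) by apply: U; lra.
have srho1 : s / 8 + s < rho by lra.
have yz_rho : d y z < rho by rewrite yz; lra.
have [|zK zn] := rc_near H (z := z); first by lra.
have bz := fv_ball H yz_rho.
pose e := phi z - phi y; rewrite -/e yz in zn.
have Csr : C * s <= C * (rho / 8) by rewrite ler_wpM2l// ltW.
pose sg := `|e|; rewrite -/sg in zn.
have sg1 : sg <= 1 / 64 by lra.
have sg_le1 : sg <= 1 by lra.
have sg00 : 0 <= sg by exact: normr_ge0.
have sg_s : s <= 2 * C * sg by have := chart_dist_le H bz sg_le1; rewrite zK yz.
have sg0 : 0 < sg.
  rewrite lt_neqAle sg00 andbT; apply/negP => /eqP h.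
  by move: sg_s; rewrite -h mulr0 leNgt s0.
pose ep := s / (16 * C ^+ 4).
have ep0 : 0 < ep by rewrite divr_gt0// mulr_gt0// exprn_gt0.
have [eta eta0 heta] := geodesic_point_stable gz Us ep0.
(* The displacement is chosen after the tolerance [eta], for which uniqueness brings the displaced
   geodesic within [ep] of [z]. *)
pose ka := Num.min (1 / (16 * C ^+ 3 * K)) (eta / (8 * C)).
have den1 : 0 < 16 * C ^+ 3 * K by rewrite !mulr_gt0// exprn_gt0.
have den2 : 0 < 8 * C by rewrite mulr_gt0.
have ka0 : 0 < ka by rewrite lt_min; apply/andP; split; apply: divr_gt0.
have ka1 : 16 * C ^+ 3 * K * ka <= 1.
  have : ka <= 1 / (16 * C ^+ 3 * K) by rewrite ge_min lexx.
  by rewrite ler_pdivlMr ?mulr_gt0// mulrC.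
have ka2 : 8 * C * ka <= eta.
  have : ka <= eta / (8 * C) by rewrite ge_min lexx orbT.
  by rewrite ler_pdivlMr ?mulr_gt0// mulrC.
have [vs kas kaeta ks1] := displacement_le C1 K1 ka0 sg0 sg_le1 zn ka1 ka2.
(* [e] points from [y] back along the geodesic to [x], so [y'] is [y] pushed beyond its end. *)
pose v := ka *: e; pose uy := phi y - v; pose y' := psi uy.
have vn : `|v| = ka * sg by rewrite normrZ gtr0_norm.
have vr : `|v| < rho by rewrite vn (le_lt_trans (le_trans vs kas))// (lt_trans _ srho1)// ltrDl.
have uyv : uy - phi y = - v by rewrite /uy addrAC subrr add0r.
have buy : ball (phi y) r uy.
  rewrite -ball_normE /= distrC uyv normrN; apply: lt_trans vr _; lra.
have yy' : d y y' <= 2 * C * (ka * sg).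
  have := chart_dist_le H buy; rewrite uyv normrN vn; exact.
have yy's := le_trans yy' kas.
have sy'x : s <= d y' x by have := dtri y y' x; rewrite dyx; lra.
(* [w] lies at distance [s] from [y'] on a minimal geodesic to [x]. As [y] is farthest, its
   distances to [x] and [y] are almost those of [z], which forces it close to [z]. *)
have [w [y'w wx]] := dmid (ltW s0) sy'x.
have [xw yw yws] := displaced_dists far eta0 (le_trans yy' kaeta) y'w wx.
have zw : d z w < ep by exact: heta.
have yw_rho : d y w < rho by rewrite (le_lt_trans yws)// (le_lt_trans _ srho1)// lerD2r.
have [|wK _] := rc_near H (z := w); first by apply: lt_trans yw_rho _; lra.
have bw := fv_ball H yw_rho.
have wy' : d w y' = s by rewrite dsym.
have y'r : d y y' < rho by rewrite (le_lt_trans yy's)// (lt_trans _ srho1)// ltrDl.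
have := displaced_variation H far buy vr yw_rho y'r; rewrite -/y' wy' vn => /(_ s0 wx).
set g := gram_form (G uy).
(* With [z] in place of [w] the first vector would be [- (1 + ka) *: e], opposite to [v]; this
   negative term is what contradicts the first variation. *)
have -> : g (uy - phi w) v = ka * (- (1 + ka) * g e e + g (phi z - phi w) e).
  have -> : uy - phi w = (- (1 + ka)) *: e + (phi z - phi w).
    by rewrite /uy /v /e; apply/rowP => j; rewrite !mxE; ring.
  rewrite /g /v gram_formZr; congr (_ * _).
  by rewrite [LHS]gram_formDl gram_formZl.
have ge : sg ^+ 2 / C <= g e e.
  rewrite ler_pdivrMr// mulrC; exact: (tame_coercive T e buy).
have gz2 : g (phi z - phi w) e <= C ^+ 2 * ep * sg.
  apply: le_trans (le_trans (ler_norm _) (tame_bound T _ _ buy)) _.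
  rewrite -/sg ler_wpM2r ?(ltW sg0)// expr2 -mulrA ler_wpM2l ?(ltW C0)//.
  have := rc_norm H bw bz; rewrite wK zK (dsym w z) => h; apply: le_trans h _.
  by rewrite ler_wpM2l ?(ltW C0)// ltW.
exact: (variation_contradiction C1 K1 ka0 sg0 s0 sg_s sK ka1 ge gz2).
Qed.

Lemma unique_at_0 x y : unique_at x y 0.
Proof. by move=> z z' [h _] [h' _]; rewrite -(metric_eq h) -(metric_eq h'). Qed.

(** Two points at time [t] are both at distance [t - s] from the single point at time [s], and [s]
    can be taken arbitrarily close to [t]. *)
Lemma unique_at_closed x y t : 0 <= t -> t <= d x y ->
  (forall s, 0 <= s -> s < t -> unique_at x y s) -> unique_at x y t.
Proof.
rewrite le_eqVlt => /predU1P[<- _ _|t0 tL hU]; first exact: unique_at_0.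
move=> z z' [xz zy] [xz' zy']; apply: metric_eq; apply/le_anti/andP; split; last exact: d0.
apply/ler_addgt0Pr => e e0; rewrite add0r.
pose s := Num.max 0 (t - e / 2).
have s0 : 0 <= s by rewrite le_max lexx.
have st : s < t by rewrite gt_max t0; lra.
have se : t - e / 2 <= s by rewrite le_max lexx orbT.
have mk u : d x u = t -> d u y = d x y - t -> exists2 w, on_geodesic x y s w & d w u = t - s.
  move=> xu uy; have [||w [xw wu]] := @dmid x u s; [by []|rewrite xu; lra|].
  exists w; last by rewrite wu xu.
  split => //; rewrite xu in wu.
  have h1 := dtri w u y; have h2 := dtri x w y.
  by apply/le_anti/andP; split; lra.
have [w gw wz] := mk z xz zy; have [w' gw' wz'] := mk z' xz' zy'.
have ww := hU s s0 st w w' gw gw'; rewrite -ww in wz'.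
have := dtri z w z'; rewrite (dsym z w); lra.
Qed.

(* Minimal geodesics that agree up to time [t] agree slightly longer, by [nonbranching]. *)
Lemma unique_at_extend x y t : 0 < t -> t < d x y -> unique_at x y t ->
  exists2 e, 0 < e & forall s, t <= s -> s <= t + e -> s <= d x y -> unique_at x y s.
Proof.
move=> t0 tL Ut; set L := d x y in tL.
have [q [xq qy]] := @dmid x y t (ltW t0) (ltW tL); rewrite -/L in qy.
have [phi [psi [G [DG [r [C H]]]]]] := charts q.
have C1 := rc_const H; have C0 : 0 < C := lt_le_trans ltr01 C1.
have rho0 := fv_radius_gt0 H.
pose s := Num.min (fv_radius r C / (8 * C)) (Num.min t (L - t)).
have s0 : 0 < s by rewrite !lt_min t0 subr_gt0 tL !andbT divr_gt0// mulr_gt0.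
have sr : 4 * C * s < fv_radius r C.
  have : s <= fv_radius r C / (8 * C) by rewrite ge_min lexx.
  rewrite ler_pdivlMr ?mulr_gt0//.
  have -> : s * (8 * C) = 2 * (4 * C * s) by ring.
  lra.
have st : s <= t by rewrite !ge_min lexx !orbT.
have sL : s <= L - t by rewrite !ge_min lexx !orbT.
have nb0 : 0 < nb_const C.
  have K1 := fv_const_ge1 H; have K0 : 0 < fv_const C := lt_le_trans ltr01 K1.
  by rewrite /nb_const mulr_gt0// addr_gt0 ?exprn_gt0// !mulr_gt0.
have nbp : 0 < 4 * nb_const C by rewrite mulr_gt0.
pose e := Num.min (s / (4 * nb_const C)) s.
exists e; first by rewrite lt_min divr_gt0.
move=> u tu ue uL a a' [xa ay] [xa' ay'].
rewrite -/L in ay ay'.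
pose tau := u - t.
have tau0 : 0 <= tau by rewrite subr_ge0.
have taue : tau <= e by rewrite /tau; lra.
have taus : tau <= s by apply: le_trans taue _; rewrite ge_min lexx orbT.
have tau4 : 4 * nb_const C * tau <= s.
  rewrite mulrC -ler_pdivlMr//; apply: le_trans taue _; by rewrite ge_min lexx.
have [||o [xo oq]] := @dmid x q (t - s); [by rewrite subr_ge0|rewrite xq; lra|].
rewrite xq in oq.
have side b : d x b = u -> d b y = L - u ->
    d q b = tau /\ exists eb, [/\ d q eb = s, d o eb = 2 * s & d b eb = s - tau].
  move=> xb bY.
  have [||q1 [xq1 q1b]] := @dmid x b t; [exact: ltW|rewrite xb; lra|].
  rewrite xb in q1b.
  have q1q : q1 = q.
    apply: Ut => //; split => //.
    have h1 := dtri q1 b y; have h2 := dtri x q1 y.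
    by rewrite -/L in h2 *; apply/le_anti/andP; split; lra.
  rewrite q1q in q1b.
  split; first by rewrite q1b.
  have [||eb [beb eby]] := @dmid b y (s - tau); [by rewrite subr_ge0|rewrite bY /tau; lra|].
  rewrite bY in eby.
  exists eb; split => //.
    have h1 := dtri q b eb; have h2 := dtri q eb y.
    rewrite /tau in beb eby; apply/le_anti/andP; split; lra.
  have h1 := dtri o q eb; have h2 := dtri q b eb; have h3 := dtri x o eb; have h4 := dtri x eb y.
  rewrite -/L in h4; rewrite /tau in beb eby.
  apply/le_anti/andP; split; lra.
have [qa [ea [qe oe be]]] := side a xa ay.
have [qa' [ea' [qe' oe' be']]] := side a' xa' ay'.
have oqs : d o q = s by rewrite oq; ring.
exact: (nonbranching dxx dsym dtri dmid H s0 sr tau0 tau4 oqs qe qe' oe oe' qa be qa' be').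
Qed.

(** A continuity argument on the largest time up to which uniqueness holds: it is attained by
    [unique_at_closed] and can be passed by [unique_at_extend], so it is [d x y], against
    [farthest_not_unique]. *)
Theorem not_locally_unique x y a0 : 0 < d x y -> (forall z, d x z <= d x y) -> 0 < a0 ->
  ~ (forall t, 0 < t -> t < a0 -> t <= d x y -> unique_at x y t).
Proof.
move=> L0 far a00 hU; set L := d x y in L0 far hU.
pose A := [set t : R | [/\ 0 <= t, t <= L & forall s, 0 <= s -> s <= t -> unique_at x y s]].
have A0 : A 0.
  split => //; first exact: ltW.
  move=> s s0 s0'; have -> : s = 0 by apply/le_anti/andP.
  exact: unique_at_0.
have sA : has_sup A by split; [exists 0|exists L => t []].
set T := sup A.
have TL : T <= L by apply: sup_le_ub; [exists 0|move=> t []].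
pose t1 := Num.min (a0 / 2) L.
have t10 : 0 < t1 by rewrite lt_min divr_gt0.
have t1L : t1 <= L by rewrite ge_min lexx orbT.
have t1a : t1 <= a0 / 2 by rewrite ge_min lexx.
have At1 : A t1.
  split => //; first exact: ltW.
  move=> s; rewrite le_eqVlt => /predU1P[<- _|s0 st]; first exact: unique_at_0.
  apply: hU => //; lra.
have T0 : 0 < T by apply: lt_le_trans t10 _; exact: sup_upper_bound.
have below s : 0 <= s -> s < T -> unique_at x y s.
  move=> s0 sT; have Ts : 0 < T - s by rewrite subr_gt0.
  have [t [_ _ At] ht] := sup_adherent Ts sA.
  apply: At => //; rewrite -/T in ht; lra.
have UT : unique_at x y T by apply: unique_at_closed => //; exact: ltW.
have below' s : 0 <= s -> s <= T -> unique_at x y s.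
  by move=> s0; rewrite le_eqVlt => /predU1P[->//|]; exact: below.
have [TltL|LT] := ltP T L; last first.
  apply: (farthest_not_unique L0 far) => t tt0 tL; apply: below' => //.
  exact: le_trans LT.
have [e e0 he] := unique_at_extend T0 TltL UT.
pose t2 := Num.min (T + e) L.
have t2T : T < t2 by rewrite lt_min TltL ltrDl e0.
have : A t2.
  split; [by rewrite ltW// (lt_trans T0)|by rewrite ge_min lexx orbT|].
  move=> s s0 st; have [sT|Ts] := leP s T; first exact: below'.
  move: st; rewrite le_min => /andP[s1 s2].
  by apply: he => //; exact: ltW.
by move=> At2; have := sup_upper_bound sA At2; rewrite leNgt t2T.
Qed.

End cut_locus.

(** * Compact manifolds: continuity of the distance, intermediate points, farthest points *)

Section compact_manifold.
Variables (R : realType) (n : nat) (M : topologicalType).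
Variables (S : smooth_manifold R n M) (g : riemannian_metric S).
Local Notation V := 'rV[R]_n.
Local Notation d := (riemannian_dist g).

Lemma dist_near x e : 0 < e -> \forall y \near x, d x y < e.
Proof.
move=> e0; have [phi [psi [G [DG [r [C [H cphi nK]]]]]]] := riemannian_chart_exists g x.
have C1 := rc_const H; have C0 : 0 < C := lt_le_trans ltr01 C1.
have r0 := rc_radius H; have T := rc_tame H.
pose del := Num.min r (Num.min 1 (e / (4 * C))).
have del0 : 0 < del by rewrite !lt_min r0 ltr01 divr_gt0// mulr_gt0.
have d1 : del <= 1 by rewrite !ge_min lexx orbT.
have dr : del <= r by rewrite ge_min lexx.
have de : del * (4 * C) <= e.
  by rewrite -ler_pdivlMr ?mulr_gt0// !ge_min lexx !orbT.
have nb : \forall y \near x, ball (phi x) del (phi y) by exact: cphi (nbhsx_ballx _ _ del0).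
apply: filterS2 nb nK => y by1 yK.
have b0 : ball (phi x) r (phi x) by exact: ballxx.
have byr : ball (phi x) r (phi y) by apply: le_ball dr _ by1.
have := rc_upper H b0 byr; rewrite (rc_psiK H) yK.
have := tame_norm_le C1 T (phi y - phi x) b0.
have : `|phi y - phi x| < del by move: by1; rewrite -ball_normE /= distrC.
set a := `|_|; have a0 : 0 <= a by exact: normr_ge0.
move=> ad h1 h2.
have h3 : C * a ^+ 2 <= C * a by rewrite ler_wpM2l ?(ltW C0)// expr2 ler_piMl//; lra.
have h4 : C * a <= C * del by rewrite ler_wpM2l ?ltW.
have h5 : C * del = del * (4 * C) / 4 by field.
lra.
Qed.

Lemma dist_continuous x : continuous (d x).
Proof.
move=> y A /nbhs_ballP[e /= e0 hA].
apply: filterS (dist_near y e0) => z yz; apply: hA; rewrite /ball /=.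
have h1 := dist_tri g x y z; have h2 := dist_tri g x z y.
rewrite (dist_sym g z y) in h2.
by rewrite ltr_norml; apply/andP; split; lra.
Qed.

Hypothesis Mcompact : compact [set: M].

(** Nearly minimal chains, cut at distance [a] from [x], give points that are nearly optimal; [d y]
    attains its minimum on the compact set of points at distance [a] from [x]. *)
Lemma dist_midpoint x y a : 0 <= a -> a <= d x y ->
  exists z, d x z = a /\ d z y = d x y - a.
Proof.
move=> a0 ad.
have approx e : 0 < e -> exists2 z, d x z = a & d z y < d x y - a + e.
  move=> e0; have [l ch le] := dist_chain_approx g x y e0.
  have [|z [l1 [l2 [xz ll c1 c2]]]] := chain_cut (@dist_continuous x) ch _ ad.
    by rewrite distxx.
  exists z => //; have := dist_le_chain c1; have := dist_le_chain c2; lra.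
pose A := [set z | d x z = a].
have A0 : A !=set0 by have [z xz _] := approx 1 ltr01; exists z.
have cA : compact A.
  apply: (subclosed_compact _ Mcompact) => //.
  have -> : A = (d x) @^-1` [set a] by [].
  by apply: closed_comp; [move=> z _; exact: dist_continuous|exact: closed_eq].
have [z zA zmin] := compact_EVT_min A0 cA (continuous_subspaceT (@dist_continuous y)).
have xz : d x z = a by move: zA; rewrite inE.
exists z; split => //; apply/le_anti/andP; split; last first.
  have := dist_tri g x z y; lra.
apply/ler_addgt0Pr => e e0.
have [w xw wy] := approx e e0.
have := zmin w; rewrite inE => /(_ xw).
rewrite (dist_sym g z y) (dist_sym g w y) in wy *; lra.
Qed.

Lemma farthest_point x : exists2 y, 0 < d x y & forall z, d x z <= d x y.
Proof.
have [y _ ymax] := compact_EVT_max (ex_intro _ x I : [set: M] !=set0) Mcompact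
  (continuous_subspaceT (@dist_continuous x)).
exists y; last by move=> z; apply: ymax; rewrite inE.
have [phi [psi [G [DG [r [C [H _ _]]]]]]] := riemannian_chart_exists g x.
have C1 := rc_const H; have C0 : 0 < C := lt_le_trans ltr01 C1.
have r0 := rc_radius H.
(* In positive dimension this vector is nonzero and yields a point other than [x], so the maximum is
   positive. *)
pose v : V := const_mx (r / 2).
have vn : `|v| = r / 2.
  have r20 : 0 <= r / 2 by rewrite divr_ge0// ltW.
  apply/le_anti/andP; split.
    by apply: mx_norm_le => // i j; rewrite mxE ger0_norm.
  by have := mx_norm_ge v ord0 (Ordinal (manifold_dim_gt0 S)); rewrite mxE ger0_norm.
have b0 : ball (phi x) r (phi x) by exact: ballxx.
have bv : ball (phi x) r (phi x + v).
  by rewrite -ball_normE /= opprD addNKr normrN vn; lra.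
have := rc_norm H b0 bv; rewrite addrAC subrr add0r vn (rc_psiK H) => h.
have : 0 < C * d x (psi (phi x + v)) by apply: lt_le_trans h; rewrite divr_gt0.
rewrite pmulr_rgt0// => h2; apply: lt_le_trans h2 _.
by apply: ymax; rewrite inE.
Qed.

Lemma riemannian_not_locally_unique x y a0 : 0 < d x y -> (forall z, d x z <= d x y) -> 0 < a0 ->
  ~ (forall t, 0 < t -> t < a0 -> t <= d x y -> unique_at d x y t).
Proof.
apply: (not_locally_unique (n := n)).
- exact: distxx.
- exact: dist_sym.
- exact: dist_tri.
- exact: dist_midpoint.
- exact: Mcompact.
- exact: dist_continuous.
- move=> q; have [phi [psi [G [DG [r [C [H _ _]]]]]]] := riemannian_chart_exists g q.
  by exists phi, psi, G, DG, r, C.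
Qed.

End compact_manifold.

(** * Two-point measures and the Wasserstein distance *)

Section two_point_measures.
Context {disp : measure_display} {T : measurableType disp} {R : realType}.
Variables (l : R).
Hypothesis l01 : 0 <= l <= 1.

Let l0 : 0 <= l. Proof. by case/andP: l01. Qed.
Let m0 : 0 <= 1 - l. Proof. by rewrite subr_ge0; case/andP: l01. Qed.

Definition two_point (a b : T) : set T -> \bar R :=
  measure_add (mscale (NngNum m0) (\d_a : measure T R)) (mscale (NngNum l0) (\d_b : measure T R)).

HB.instance Definition _ a b := Measure.on (two_point a b).

Lemma two_pointE a b A :
  two_point a b A = ((1 - l) * \1_A a + l * \1_A b)%:E.
Proof. by rewrite /two_point measure_addE /mscale /= EFinD !EFinM. Qed.

Lemma two_point_setT a b : two_point a b setT = 1%E.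
Proof. by rewrite two_pointE !indicT !mulr1 subrK. Qed.

HB.instance Definition _ a b := 
  Measure_isProbability.Build _ _ R (two_point a b) (two_point_setT a b).

Lemma ge0_integral_two_point_measurable a b (f : T -> R) : measurable_fun setT f ->
  (forall t, 0 <= f t) ->
  (\int[two_point a b]_t (f t)%:E = ((1 - l) * f a + l * f b)%:E)%E.
Proof.
move=> mf f0; have mf' : measurable_fun setT (EFin \o f) by exact/measurable_EFinP.
rewrite ge0_integral_measure_add//; last by move=> t _; rewrite lee_fin.
rewrite !ge0_integral_mscale//; try by move=> t _; rewrite lee_fin.
by rewrite !integral_dirac// !diracT !mul1e.
Qed.

Import HBNNSimple.

(** For arbitrary [f] the integral is a supremum over simple functions below [f]. Each of these is
    integrated exactly, and conversely [f] dominates the measurable function [k] that agrees with it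
    at the two atoms and vanishes elsewhere. *)
Lemma ge0_integral_two_point a b (f : T -> R) : a != b ->
  measurable [set a] -> measurable [set b] -> (forall t, 0 <= f t) ->
  (\int[two_point a b]_t (f t)%:E = ((1 - l) * f a + l * f b)%:E)%E.
Proof.
move=> ab ma mb f0.
have f0' : forall t : T, setT t -> (0 <= (f t)%:E)%E by move=> t _; rewrite lee_fin.
apply/le_anti/andP; split.
  rewrite ge0_integralE//; apply: ge_ereal_sup => _ [h hle <-].
  rewrite -integralT_nnsfun ge0_integral_two_point_measurable//.
  have hf t : h t <= f t by have := hle t; rewrite patchE in_setT.
  by rewrite lee_fin lerD// ler_wpM2l.
pose k t := f a * \1_[set a] t + f b * \1_[set b] t.
have ka : k a = f a.
  by rewrite /k !indicE mem_set// memNset ?mulr1 ?mulr0 ?addr0//=; exact/eqP.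
have kb : k b = f b.
  by rewrite /k !indicE memNset ?mem_set// ?mulr1 ?mulr0 ?add0r//= => /esym/eqP; exact/negP.
have k0 t : 0 <= k t by rewrite addr_ge0// mulr_ge0// indicE ler0n.
have kf t : k t <= f t.
  have [->|ta] := eqVneq t a; first by rewrite ka.
  have [->|tb] := eqVneq t b; first by rewrite kb.
  rewrite /k !indicE !memNset ?mulr0 ?addr0//=; exact/eqP.
have mk : measurable_fun setT k.
  by apply: measurable_funD; apply: measurable_funM => //; exact: measurable_indic.
rewrite -ka -kb -(ge0_integral_two_point_measurable a b mk k0).
rewrite !ge0_integralE//; last by move=> t _; rewrite lee_fin.
apply: ereal_sup_le => _ [h hle <-]; exists h => // t.
by apply: le_trans (hle t) _; rewrite !patchE in_setT lee_fin.
Qed.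

(* A probability measure is determined on measurable sets by two atoms of total mass 1. *)
Lemma two_point_unique (P : probability T R) a b : a != b ->
  measurable [set a] -> measurable [set b] ->
  P [set a] = (1 - l)%:E -> P [set b] = l%:E ->
  forall A, measurable A -> P A = two_point a b A.
Proof.
move=> ab ma mb Pa Pb A mA.
have dis : [set a] `&` [set b] = set0.
  by apply/seteqP; split => t //= -[-> e]; move: ab; rewrite e eqxx.
have mE : measurable ([set a] `|` [set b]) by exact: measurableU.
have PE : P ([set a] `|` [set b]) = 1%E.
  by rewrite measureU//= Pa Pb -EFinD subrK.
have PEc : P (~` ([set a] `|` [set b])) = 0%E.
  by rewrite probability_setC// PE -EFinB subrr.
have atom t c : measurable [set t] -> P [set t] = c%:E -> P (A `&` [set t]) = (c * \1_A t)%:E.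
  move=> mt Pt; rewrite indicE; have [tA|tA] := boolP (t \in A).
    rewrite mulr1 -Pt; congr (P _); apply/seteqP; split => u /=; first by case.
    by move=> ->; split => //; exact: set_mem.
  rewrite mulr0 (_ : _ `&` _ = set0) ?measure0//.
  by apply/seteqP; split => u //= -[Au ut]; move: tA; rewrite -ut mem_set.
have dec : P A = (P (A `\` ([set a] `|` [set b])) + P (A `&` ([set a] `|` [set b])))%E.
  exact: measureDI.
rewrite two_pointE dec.
have -> : P (A `\` ([set a] `|` [set b])) = 0%E.
  apply/eqP; rewrite -measure_le0 -PEc; apply: le_measure; rewrite ?inE.
  - exact: measurableD.
  - exact: measurableC.
  - by move=> t [].
rewrite add0e setIUr measureU//=.
- by rewrite (atom a (1 - l))// (atom b l)// -EFinD.
- exact: measurableI.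
- exact: measurableI.
- by rewrite -setIIr dis setI0.
Qed.

End two_point_measures.

Section wasserstein_two_points.
Variables (R : realType) (M : ptopologicalType).
Hypothesis Mhausdorff : hausdorff_space M.
Variables (dist : borel M -> borel M -> R) (p : R).
Hypothesis p0 : 0 < p.
Hypothesis distxx : forall x, dist x x = 0.

Lemma measurable_point (x : borel M) : measurable [set x].
Proof.
rewrite -[X in measurable X]setCK; apply: measurableC; apply: sub_sigma_algebra.
apply: closed_openC; apply: accessible_closed_set1; exact: hausdorff_accessible.
Qed.

Lemma measurable_point_pair (u : (borel M * borel M)%type) : measurable [set u].
Proof.
have -> : [set u] = [set u.1] `*` [set u.2].
  by apply/seteqP; split => -[a b] /=; [move=> <-|case: u => c e /= [-> ->]].
by apply: measurableX; exact: measurable_point.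
Qed.

Variables (l : R) (l01 : 0 <= l <= 1) (x y : borel M).
Hypothesis xy : x != y.

Lemma finite_moment_two_point : finite_moment dist p (two_point l01 x y : probability _ R).
Proof.
exists x; rewrite ge0_integral_two_point ?ltry//; try exact: measurable_point.
by move=> t; exact: powR_ge0.
Qed.

Definition wasserstein_two_point : wasserstein_space dist p :=
  exist _ _ finite_moment_two_point.

Definition two_point_cost (z : borel M) := (1 - l) * dist x z `^ p + l * dist y z `^ p.

Lemma two_point_coupling z :
  couplings (two_point l01 x y : probability _ R) (dirac z : probability _ R)
    (two_point l01 (x, z) (y, z) : probability _ R).
Proof.
move=> A mA; split.
  apply: (etrans (two_pointE l01 _ _ _)); apply/esym/(etrans (two_pointE l01 _ _ _)).
  by rewrite !indicE !in_setX !in_setT !andbT.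
apply: (etrans (two_pointE l01 _ _ _)).
by rewrite /= !indicE !in_setX !in_setT /= -mulrDl subrK mul1r.
Qed.

(** The Dirac marginal leaves no mass where the second coordinate differs from [z]; the other
    marginal then puts masses [1 - l] and [l] at [(x, z)] and [(y, z)], so all couplings have the
    same cost. *)
Lemma coupling_cost z (pi : probability (borel M * borel M)%type R) :
  couplings (two_point l01 x y : probability _ R) (dirac z : probability _ R) pi ->
  (\int[pi]_u (dist u.1 u.2 `^ p)%:E = (two_point_cost z)%:E)%E.
Proof.
move=> cpi.
have xyz : (x, z) != (y, z) by apply: contra xy => /eqP[->].
have mz := measurable_point z.
have null (a : borel M) : pi ([set a] `*` ~` [set z]) = 0%E.
  apply/eqP; rewrite -measure_le0.
  apply: (@le_trans _ _ (pi (setT `*` ~` [set z]))).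
    apply: le_measure; rewrite ?inE.
    - by apply: measurableX; [exact: measurable_point|exact: measurableC].
    - by apply: measurableX; [exact: measurableT|exact: measurableC].
    - by move=> [b c] [].
  have [_ ->] := cpi _ (measurableC mz).
  by rewrite /= /dirac indicE memNset//=; apply.
have atom (a : borel M) c : two_point l01 x y [set a] = c%:E -> pi [set (a, z)] = c%:E.
  move=> <-; have [<- _] := cpi _ (measurable_point a).
  have -> : [set a] `*` setT = [set (a, z)] `|` ([set a] `*` ~` [set z]).
    apply/seteqP; split => -[b c'] /=.
      by move=> [-> _]; have [->|/eqP cz] := eqVneq c' z; [left|right].
    by case=> [[-> _]|[-> _]].
  rewrite measureU//=; first by rewrite null adde0.
  - exact: measurable_point_pair.
  - by apply: measurableX; [exact: measurable_point|exact: measurableC].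
  - by apply/seteqP; split => -[b c'] //= [[-> ->] [_]].
have Pa : pi [set (x, z)] = (1 - l)%:E.
  apply: atom; rewrite two_pointE !indicE mem_set// memNset ?mulr1 ?mulr0 ?addr0//=.
  by move=> e; move: xy; rewrite e eqxx.
have Pb : pi [set (y, z)] = l%:E.
  apply: atom; rewrite two_pointE !indicE memNset ?mem_set// ?mulr1 ?mulr0 ?add0r//=.
  by move=> e; move: xy; rewrite e eqxx.
have mxz := measurable_point_pair (x, z); have myz := measurable_point_pair (y, z).
rewrite (@eq_measure_integral _ _ _ _ (two_point l01 (x, z) (y, z))); last first.
  by move=> A mA _; exact: two_point_unique xyz mxz myz Pa Pb A mA.
by rewrite (ge0_integral_two_point l01 xyz mxz myz)// => t; exact: powR_ge0.
Qed.

Lemma wasserstein_two_point_dirac z :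
  wasserstein_dist wasserstein_two_point (wasserstein_dirac dist p z) =
  two_point_cost z `^ p^-1.
Proof.
rewrite /wasserstein_dist /=; congr (_ `^ _).
set A := [set _ | _ in _].
have -> : A = [set (two_point_cost z)%:E].
  apply/seteqP; split => [_ [pi cpi <-]|_ ->]; first exact: coupling_cost cpi.
  exists (two_point l01 (x, z) (y, z)); first exact: two_point_coupling.
  by apply: coupling_cost; exact: two_point_coupling.
by rewrite ereal_inf1.
Qed.

(** The coupling that keeps the mass [1 - l] at [x] and carries [l] to [y] gives an upper bound,
    which is enough to place the measure in a small ball. *)
Lemma wasserstein_dirac_two_point_le :
  wasserstein_dist (wasserstein_dirac dist p x) wasserstein_two_point <=
  (l * dist x y `^ p) `^ p^-1.
Proof.
rewrite /wasserstein_dist /=; set A := [set _ | _ in _].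
have A0 : (0 <= ereal_inf A)%E.
  apply: le_ereal_inf_tmp => _ [pi _ <-]; apply: integral_ge0 => u _.
  by rewrite lee_fin powR_ge0.
have Ale : (ereal_inf A <= (l * dist x y `^ p)%:E)%E.
  apply: ereal_inf_lbound; exists (two_point l01 (x, x) (x, y)).
    move=> B mB; split; last first.
      apply: (etrans (two_pointE l01 _ _ _)); apply/esym/(etrans (two_pointE l01 _ _ _)).
      by rewrite !indicE !in_setX !in_setT.
    apply: (etrans (two_pointE l01 _ _ _)).
    by rewrite /= !indicE !in_setX !in_setT !andbT -mulrDl subrK mul1r.
  rewrite (ge0_integral_two_point l01) /=.
  - by rewrite distxx powR0 ?gt_eqF// mulr0 add0r.
  - by apply: contra xy => /eqP[->].
  - exact: measurable_point_pair.
  - exact: measurable_point_pair.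
  - by move=> t; exact: powR_ge0.
have fA : ereal_inf A \is a fin_num.
  by rewrite ge0_fin_numE//; apply: le_lt_trans Ale _; exact: ltry.
apply: ge0_ler_powR; rewrite ?invr_ge0 ?(ltW p0)// ?nnegrE.
- exact: fine_ge0.
- by rewrite mulr_ge0 ?powR_ge0//; case/andP: l01.
- by rewrite -lee_fin fineK.
Qed.

Lemma wasserstein_dirac_inj (a b : borel M) :
  wasserstein_dirac dist p a = wasserstein_dirac dist p b -> a = b.
Proof.
move=> e; have : (dirac a : probability _ R) [set a] = (dirac b : probability _ R) [set a].
  exact: (congr1 (fun mu : wasserstein_space dist p => (sval mu : probability _ R) [set a]) e).
rewrite /= /dirac !indicE mem_set//=.
by case: (boolP (b \in [set a])) => [|_ /eqP]; [rewrite inE|rewrite eqe oner_eq0].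
Qed.

(** Each minimiser of the cost gives a nearest Dirac measure; these coincide, and a Dirac measure
    determines its point. *)
Lemma Unp_two_point_unique z1 z2 :
  Unp (wasserstein_dist (p := p)) (range (wasserstein_dirac dist p)) wasserstein_two_point ->
  (forall z, two_point_cost z1 <= two_point_cost z) ->
  (forall z, two_point_cost z2 <= two_point_cost z) -> z1 = z2.
Proof.
move=> [nu [_ nuU]] h1 h2.
have cost0 z : 0 <= two_point_cost z.
  by case/andP: l01 => ? ?; rewrite addr_ge0// mulr_ge0 ?powR_ge0// subr_ge0.
have near z : (forall z', two_point_cost z <= two_point_cost z') ->
    nu = wasserstein_dirac dist p z.
  move=> hz; apply: nuU; split; first by exists z.
  rewrite /dist_to_set; set A := [set _ | _ in _].
  have lbA : lbound A (wasserstein_dist wasserstein_two_point (wasserstein_dirac dist p z)).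
    move=> _ [_ [z' _ <-] <-]; rewrite !wasserstein_two_point_dirac.
    by apply: ge0_ler_powR; rewrite ?invr_ge0 ?(ltW p0)// ?nnegrE.
  have Az : A (wasserstein_dist wasserstein_two_point (wasserstein_dirac dist p z)).
    by exists (wasserstein_dirac dist p z) => //; exists z.
  apply/le_anti/andP; split.
    by apply: ge_inf => //; eexists; exact: lbA.
  by apply: lb_le_inf lbA; eexists; exact: Az.
by apply: wasserstein_dirac_inj; rewrite -(near z1 h1) -(near z2 h2).
Qed.

End wasserstein_two_points.

(** * Cost minimisers and the reach *)

(** Young's inequality for [s] and the power [p - 1] of [a], with conjugate exponents [p] and
    [p / (p - 1)]: a convex power lies above its tangent at [a]. *)
Lemma powR_tangent_le (R : realType) (p s a : R) : 1 < p -> 0 <= s -> 0 < a ->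
  a `^ p + p * a `^ (p - 1) * (s - a) <= s `^ p.
Proof.
move=> p1 s0 a0; have p0 : 0 < p := lt_trans ltr01 p1.
have p10 : 0 < p - 1 by rewrite subr_gt0.
set b := a `^ (p - 1).
have ab : a * b = a `^ p.
  rewrite -{1}[a]powRr1 ?(ltW a0)// /b -powRD; first by congr (_ `^ _); ring.
  by apply/implyP => _; rewrite gt_eqF.
have bq : b `^ (p / (p - 1)) = a `^ p.
  by rewrite /b -powRrM; congr (_ `^ _); rewrite mulrC divfK// gt_eqF.
have := @conjugate_powR R s b p (p / (p - 1)) s0 (powR_ge0 _ _) p0 (divr_gt0 p0 p10).
have -> : p^-1 + (p / (p - 1))^-1 = 1 by field; rewrite !gt_eqF.
move=> /(_ erefl); rewrite bq => h.
have h2 : p * (s * b) <= s `^ p + (p - 1) * a `^ p.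
  have -> : s `^ p + (p - 1) * a `^ p = p * (s `^ p / p + a `^ p / (p / (p - 1))).
    by field; rewrite !gt_eqF.
  by rewrite ler_pM2l.
have -> : a `^ p + p * b * (s - a) = a `^ p + p * (s * b) - p * (a * b) by ring.
rewrite ab; lra.
Qed.

Section reach.
Variables (R : realType) (n : nat) (M : ptopologicalType).
Variables (S : smooth_manifold R n M) (g : riemannian_metric S).
Hypothesis M_compact : compact [set: M].
Variables (p : R) (p1 : 1 < p) (x y : M).
Local Notation d := (riemannian_dist g).
Hypothesis L0 : 0 < d x y.
Hypothesis far : forall z, d x z <= d x y.

Let p0 : 0 < p := lt_trans ltr01 p1.
Let p10 : 0 < p - 1. Proof. by rewrite subr_gt0. Qed.
Let W := wasserstein_dist (p := p) (dist := (d : borel M -> borel M -> R)).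
Let delta : M -> wasserstein_space (d : borel M -> borel M -> R) p :=
  wasserstein_dirac (d : borel M -> borel M -> R) p.

(* The mass at [y] that makes the cost over the geodesic from [x] to [y] minimal at distance [t]
   from [x]: the stationarity condition is [(1 - w) t^(p-1) = w (L - t)^(p-1)]. *)
Definition weight (t : R) := t `^ (p - 1) / (t `^ (p - 1) + (d x y - t) `^ (p - 1)).

Lemma weight_bounds t : 0 < t -> t < d x y -> 0 <= weight t <= 1.
Proof.
move=> t0 tL; have a0 : 0 < t `^ (p - 1) by exact: powR_gt0.
have b0 : 0 < (d x y - t) `^ (p - 1) by apply: powR_gt0; rewrite subr_gt0.
have ab := addr_gt0 a0 b0; apply/andP; split; first by rewrite divr_ge0// ltW.
by rewrite /weight ler_pdivrMr// mul1r lerDl ltW.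
Qed.

(** By the triangle inequality the cost at [z'] is at least a function of the number [d x z'] alone.
    The tangents of the power at [t] and at [L - t] bound that function below, and the weight makes
    their slopes cancel. *)
Lemma geodesic_point_minimises_cost t z z' : 0 < t -> t < d x y -> on_geodesic d x y t z ->
  two_point_cost (d : borel M -> borel M -> R) p (weight t) x y z <=
  two_point_cost (d : borel M -> borel M -> R) p (weight t) x y z'.
Proof.
move=> t0 tL [xz zy]; rewrite /two_point_cost xz (dist_sym g y z) zy.
set L := d x y in tL *; set w := weight t.
have [w0 w1] : 0 <= w /\ w <= 1 by apply/andP; exact: weight_bounds.
have st : (1 - w) * t `^ (p - 1) = w * (L - t) `^ (p - 1).
  have a0 : 0 < t `^ (p - 1) by exact: powR_gt0.
  have b0 : 0 < (L - t) `^ (p - 1) by apply: powR_gt0; rewrite subr_gt0.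
  by rewrite /w /weight -/L; field; rewrite gt_eqF// addr_gt0.
have h1 := powR_tangent_le p1 (dist_ge0 g x z') t0.
have Lt0 : 0 < L - t by rewrite subr_gt0.
have Ls0 : 0 <= L - d x z' by rewrite subr_ge0.
have h2 := powR_tangent_le p1 Ls0 Lt0.
have h3 : (L - d x z') `^ p <= d y z' `^ p.
  apply: ge0_ler_powR; rewrite ?nnegrE ?(ltW p0)// ?dist_ge0//.
  have := dist_tri g x z' y; rewrite (dist_sym g z' y) -/L; lra.
have h4 : w * ((L - t) `^ p + p * (L - t) `^ (p - 1) * (L - d x z' - (L - t))) <= w * d y z' `^ p.
  by rewrite ler_wpM2l//; exact: le_trans h3.
have h5 : (1 - w) * (t `^ p + p * t `^ (p - 1) * (d x z' - t)) <= (1 - w) * d x z' `^ p.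
  by rewrite ler_wpM2l// subr_ge0.
have h6 : (1 - w) * (p * t `^ (p - 1) * (d x z' - t)) = p * (d x z' - t) * ((1 - w) * t `^ (p - 1)).
  by ring.
rewrite st in h6.
have h7 : w * (p * (L - t) `^ (p - 1) * (L - d x z' - (L - t))) =
  - (p * (d x z' - t) * (w * (L - t) `^ (p - 1))) by ring.
rewrite mulrDr h6 in h5; rewrite mulrDr h7 in h4.
lra.
Qed.

(** As [p > 1], the numerator of the weight tends to 0 with [t], while for [t < L / 2] the
    denominator stays above the power [p - 1] of [L / 2]. *)
Lemma small_weight r : 0 < r -> exists2 a0, 0 < a0 & forall t, 0 < t -> t < a0 -> t < d x y ->
  weight t * d x y `^ p < r `^ p.
Proof.
move=> r0; set L := d x y; have L_gt0 : 0 < L by exact: L0.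
have LP : 0 < L `^ p by exact: powR_gt0.
have rp : 0 < r `^ p by exact: powR_gt0.
have L20 : 0 < L / 2 by rewrite divr_gt0.
have Lp : 0 < (L / 2) `^ (p - 1) by exact: powR_gt0.
pose c := (r `^ p / L `^ p) * (L / 2) `^ (p - 1).
have c0 : 0 < c by rewrite mulr_gt0// divr_gt0.
exists (Num.min (L / 2) (c `^ (p - 1)^-1)).
  by rewrite lt_min L20 powR_gt0.
move=> t t0; rewrite lt_min => /andP[tL2 tc] tL.
have Lt : L / 2 < L - t by lra.
have a0 : 0 < t `^ (p - 1) by exact: powR_gt0.
have b0 : 0 < (L - t) `^ (p - 1) by apply: powR_gt0; rewrite subr_gt0.
have tcp : t `^ (p - 1) < c.
  have := @gt0_ltr_powR R (p - 1) p10 t (c `^ (p - 1)^-1).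
  rewrite !nnegrE (ltW t0) powR_ge0 -powRrM mulVf ?gt_eqF// powRr1 ?(ltW c0)//.
  by apply.
have bb : (L / 2) `^ (p - 1) <= (L - t) `^ (p - 1).
  apply: ge0_ler_powR; rewrite ?nnegrE ?(ltW p10)//; lra.
rewrite -ltr_pdivlMr// /weight ltr_pdivrMr ?addr_gt0//; apply: lt_le_trans tcp _.
rewrite /c ler_wpM2l//; first by rewrite divr_ge0// ltW.
by apply: le_trans bb _; rewrite lerDr ltW.
Qed.

Lemma ball_not_sub_Unp r : 0 < r -> ~ [set mu | W (delta x) mu < r] `<=` Unp W (range delta).
Proof.
move=> r0 sub.
have [a0 a00 ha] := small_weight r0.
(* The minimum excludes [t = d x y], where the second atom would carry all the mass. *)
apply: (riemannian_not_locally_unique M_compact L0 far (a0 := Num.min a0 (d x y))).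
  by rewrite lt_min a00.
move=> t t0; rewrite lt_min => /andP[ta tL] _ z z' gz gz'.
have w01 := weight_bounds t0 tL.
have xy : (x : borel M) != y.
  by apply/eqP => e; move: L0; rewrite e distxx ltxx.
have Mh := manifold_hausdorff S.
apply: (@Unp_two_point_unique R M Mh d p p0 (weight t) w01 x y xy z z').
- apply: sub => /=.
  apply: le_lt_trans
    (@wasserstein_dirac_two_point_le R M Mh d p p0 (distxx g) (weight t) w01 x y xy) _.
  have [w0 w1] := andP w01.
  have h := ha t t0 ta tL.
  have ip : 0 < p^-1 by rewrite invr_gt0.
  have := @gt0_ltr_powR R p^-1 ip (weight t * d x y `^ p) (r `^ p).
  rewrite !nnegrE powR_ge0 mulr_ge0 ?powR_ge0//.
  by rewrite -(powRrM r) mulfV ?gt_eqF// powRr1 ?(ltW r0)//; apply.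
- by move=> z''; exact: geodesic_point_minimises_cost.
- by move=> z''; exact: geodesic_point_minimises_cost.
Qed.

End reach.

Theorem corollary4p6 (R : realType) (n : nat) (M : ptopologicalType)
    (S : smooth_manifold R n M) (g : riemannian_metric S)
    (M_compact : compact [set: M]) (p : R) (hp : 1 < p) (x : M) :
  let dist : borel M -> borel M -> R := riemannian_dist g in
  let delta : M -> wasserstein_space dist p := wasserstein_dirac dist p in
  reach (wasserstein_dist (p := p)) (range delta) (delta x) = 0%E.
Proof.
move=> dist delta.
have [y L0 far] := farthest_point g M_compact x.
apply/le_anti/andP; split.
  apply: ge_ereal_sup => _ [r [r0 sub] <-]; rewrite lee_fin leNgt; apply/negP => rp.
  exact: (ball_not_sub_Unp M_compact hp L0 far rp sub).
(* The ball of radius 0 is empty, so 0 is one of the admissible radii. *)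
apply: ereal_sup_ubound; exists 0 => //; split => // mu /=.
by rewrite ltNge powR_ge0.
Qed.
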